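(* Let $r\in(3/2,2)$, $c_\infty>0$, and $f,h\in H^r(\mathbb{R})$ with $c_\infty+f>h$ be given. Then the boundary value problem $$ \begin{aligned} v_i&=-\frac{k}{\mu}\big(\nabla p_i+(0,\rho_i g)\big)&&\text{in } \Omega_i,\ 1\le i\le 3,\\ \operatorname{div} v_i&=0 &&\text{in } \Omega_i,\ 1\le i\le 3,\\ p_i&=p_{i+1}&&\text{on } \partial\Omega_i\cap\partial\Omega_{i+1},\ i=1,2,\\ \langle v_i| \nu_i\rangle&= \langle v_{i+1}| \nu_i\rangle &&\text{on } \partial\Omega_i\cap\partial\Omega_{i+1},\ i=1,2,\\ v_i(x,y)&\to 0 &&\text{for } |(x,y)|\to\infty,\ 1\le i\le 3, \end{aligned} $$ has a unique solution $(v_1,v_2,v_3,p_1,p_2,p_3)$ (where the pressures $(p_1,p_2,p_3)$ are unique only up to the same additive constant) with $$v_i\in {\rm BUC}(\Omega_i)\cap {\rm C}^\infty(\Omega_i)\quad\text{and}\quad p_i\in {\rm UC}^1(\Omega_i)\cap {\rm C}^\infty(\Omega_i),\qquad 1\le i\le 3.$$ Moreover, setting $v:=v_1{\bf 1}_{\Omega_1}+v_2{\bf 1}_{\Omega_2}+v_3{\bf 1}_{\Omega_3}$, for every $z=(x,y)\in\mathbb{R}^2\setminus(\Gamma_h\cup\Gamma_f^{c_\infty})$ it holds that $$ v(z)=\frac{\Theta_1}{\pi}\int_{\mathbb{R}}\frac{(c_\infty+f(s)-y,\,x-s)}{(x-s)^2+(y-c_\infty-f(s))^2}f'(s)\,ds+\frac{\Theta_2}{\pi}\int_{\mathbb{R}}\frac{(h(s)-y,\,x-s)}{(x-s)^2+(y-h(s))^2}h'(s)\,ds,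 $$ with constants $$\Theta_1:=\frac{kg(\rho_1-\rho_2)}{2\mu},\qquad \Theta_2:=\frac{kg(\rho_2-\rho_3)}{2\mu}.$$
   Context: The constants $k,\mu,g>0$ and $\rho_3>\rho_2>\rho_1>0$ are fixed. The curves and domains are $$\Gamma_f^{c_\infty}:=\{(x,c_\infty+f(x)):x\in\mathbb{R}\},\quad \Gamma_h:=\{(x,h(x)):x\in\mathbb{R}\},$$ $$\Omega_1:=\{(x,y): y>f(x)+c_\infty\},\quad \Omega_3:=\{(x,y): y<h(x)\},\quad \Omega_2:=\mathbb{R}^2\setminus\overline{\Omega_1\cup\Omega_3}.$$ Thus $\partial\Omega_1\cap\partial\Omega_2=\Gamma_f^{c_\infty}$ and $\partial\Omega_2\cap\partial\Omega_3=\Gamma_h$; $\nu_i$ is the unit normal at $\partial\Omega_i\cap\partial\Omega_{i+1}$ pointing into $\Omega_i$, and $\langle\cdot|\cdot\rangle$ is the Euclidean inner product of $\mathbb{R}^2$. The unknowns are $v_i:\Omega_i\to\mathbb{R}^2$ and $p_i:\Omega_i\to\mathbb{R}$. For an open set $\Omega\subset\mathbb{R}^n$, ${\rm UC}^k(\Omega)$ is the set of functions in ${\rm C}^k(\Omega)$ whose derivatives up to order $k$ are uniformly continuous, and ${\rm BUC}(\Omega)$ is the space of bounded uniformly continuous functions on $\Omega$ (componentwise for vector fields). Values on the boundary are those of the continuous extensions to $\overline{\Omega_i}$. *)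

(* Defs.v *)
From HB Require Import structures.
From mathcomp Require Import all_boot all_order all_algebra.
From mathcomp Require Import all_classical all_reals all_analysis.

Set Implicit Arguments.
Unset Strict Implicit.
Unset Printing Implicit Defensive.
Import Order.TTheory GRing.Theory Num.Theory.
Import numFieldNormedType.Exports.

Local Open Scope classical_set_scope.
Local Open Scope ring_scope.

Section Sobolev.
Context {R : realType}.
Local Notation leb := (@lebesgue_measure R).

Definition test_function (phi : R -> R) : Prop :=
  [/\ forall x : R, derivable phi x 1,
      continuous (derive1 phi) &
      exists M : R, forall x : R, M < `|x| -> phi x = 0].

Definition weak_derivative (f f1 : R -> R) : Prop :=
  forall phi : R -> R, test_function phi ->
    \int[leb]_x (f x * derive1 phi x) = - \int[leb]_x (f1 x * phi x).

(* On the diagonal the integrand is 0 / 0 = 0. *)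
Definition slobodeckij (s : R) (u : R -> R) : \bar R :=
  (\int[leb]_x \int[leb]_y
     ((`|u x - u y| ^+ 2 / `|x - y| `^ (1 + 2 * s))%:E))%E.

(* H^r(R) = W^{r,2}(R), meant for 1 < r < 2: u and its weak derivative are in
   L^2 and the latter has a finite Slobodeckij seminorm of order r - 1.  Since
   r > 1/2, a class in H^r(R) is identified with its continuous
   representative. *)
Definition sobolev (r : R) (u : R -> R) : Prop :=
  continuous u /\
  exists u1 : R -> R,
    [/\ u \in Lfun leb 2%:E, u1 \in Lfun leb 2%:E, weak_derivative u u1 &
        (slobodeckij (r - 1) u1 < +oo)%E].

End Sobolev.

Notation plane R := (R * R)%type.

Section Plane.
Context {R : realType}.
Implicit Types (D : set (plane R)) (z : plane R).

Definition dx (F : plane R -> R) : plane R -> R := fun z => 'D_(1, 0) F z.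
Definition dy (F : plane R -> R) : plane R -> R := fun z => 'D_(0, 1) F z.

Definition grad (p : plane R -> R) : plane R -> plane R :=
  fun z => (dx p z, dy p z).

Definition divergence (v : plane R -> plane R) : plane R -> R :=
  fun z => dx (fst \o v) z + dy (snd \o v) z.

Definition dot (a b : plane R) : R := a.1 * b.1 + a.2 * b.2.

(* Functions on an open set D are represented by total functions, of which only
   the values on D matter. *)

Fixpoint partials_upto D (P : (plane R -> R) -> Prop) (n : nat)
    (F : plane R -> R) : Prop :=
  P F /\
  if n is m.+1 then
    [/\ forall z, D z -> derivable F z (1, 0) /\ derivable F z (0, 1),
        partials_upto D P m (dx F) & partials_upto D P m (dy F)]
  else True.

Definition unif_continuous_on D (F : plane R -> R) : Prop :=
  unif_continuous (F : subspace D -> R).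

Definition Cn D (n : nat) (F : plane R -> R) : Prop :=
  partials_upto D (fun G => {in D, continuous G}) n F.

Definition Cinfty D (F : plane R -> R) : Prop := forall n, Cn D n F.

Definition UCn D (n : nat) (F : plane R -> R) : Prop :=
  Cn D n F /\ partials_upto D (unif_continuous_on D) n F.

Definition BUC D (F : plane R -> R) : Prop :=
  [bounded F z | z in D] /\ unif_continuous_on D F.

Definition componentwise (P : (plane R -> R) -> Prop)
    (v : plane R -> plane R) : Prop :=
  P (fst \o v) /\ P (snd \o v).

Definition vanishes_at_infinity D (v : plane R -> plane R) : Prop :=
  forall e : R, 0 < e -> exists M : R, forall z, D z -> M < `|z| -> `|v z| < e.

Definition boundary D : set (plane R) := closure D `\` D°.

(* Value at a boundary point z of the continuous extension of F to the
   closure of D; the limit exists when F is uniformly continuous on D. *)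
Definition trace D (F : plane R -> R) z : R :=
  lim (F x @[x --> within D (nbhs z)]).

Definition trace2 D (v : plane R -> plane R) z : plane R :=
  (trace D (fst \o v) z, trace D (snd \o v) z).

End Plane.

Section Muskat.
Context {R : realType}.
Implicit Types (phi : R -> R) (z : plane R) (D : set (plane R)).

Definition curve phi : set (plane R) := range (fun x => (x, phi x)).

Definition above phi : set (plane R) := [set z | phi z.1 < z.2].

Definition below phi : set (plane R) := [set z | z.2 < phi z.1].

Definition between (phi psi : R -> R) : set (plane R) :=
  ~` closure (above phi `|` below psi).

(* Unit normal to the graph of phi at (x, phi x), pointing upwards: this is
   into Omega_i on the interface of Omega_i and Omega_(i+1), as Omega_i lies on
   top of Omega_(i+1). *)
Definition normal phi (x : R) : plane R :=
  (Num.sqrt (1 + derive1 phi x ^+ 2))^-1 *: (- derive1 phi x, 1).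

Definition layer (k mu g rho : R) D
    (v : plane R -> plane R) (p : plane R -> R) : Prop :=
  [/\ componentwise (BUC D) v /\ componentwise (Cinfty D) v,
      UCn D 1 p /\ Cinfty D p,
      forall z, D z -> v z = - (k / mu) *: (grad p z + (0, rho * g)),
      forall z, D z -> divergence v z = 0 &
      vanishes_at_infinity D v].

(* D lies on top of D', and their interface is the graph of phi. *)
Definition transmission phi D D' (v v' : plane R -> plane R)
    (p p' : plane R -> R) : Prop :=
  forall z, (boundary D `&` boundary D') z ->
    trace D p z = trace D' p' z /\
    dot (trace2 D v z) (normal phi z.1) = dot (trace2 D' v' z) (normal phi z.1).

Definition muskat_solution (k mu g rho1 rho2 rho3 : R) (phi psi : R -> R)
    (v1 v2 v3 : plane R -> plane R) (p1 p2 p3 : plane R -> R) : Prop :=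
  let D1 := above phi in
  let D2 := between phi psi in
  let D3 := below psi in
  [/\ layer k mu g rho1 D1 v1 p1,
      layer k mu g rho2 D2 v2 p2,
      layer k mu g rho3 D3 v3 p3,
      transmission phi D1 D2 v1 v2 p1 p2 &
      transmission psi D2 D3 v2 v3 p2 p3].

Definition muskat_kernel phi z (s : R) : plane R :=
  ((z.1 - s) ^+ 2 + (z.2 - phi s) ^+ 2)^-1 *: (phi s - z.2, z.1 - s).

Definition integrable2 (G : R -> plane R) : Prop :=
  lebesgue_measure.-integrable setT (EFin \o (fst \o G)) /\
  lebesgue_measure.-integrable setT (EFin \o (snd \o G)).

Definition integral2 (G : R -> plane R) : plane R :=
  (\int[lebesgue_measure]_s (G s).1, \int[lebesgue_measure]_s (G s).2).

End Muskat.

(* Main.v *)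
Require Import Defs.
From HB Require Import structures.
From mathcomp Require Import all_boot all_order all_algebra.
From mathcomp Require Import all_classical all_reals all_analysis.
From mathcomp Require Import measurable_realfun ring lra.

Set Implicit Arguments.
Unset Strict Implicit.
Unset Printing Implicit Defensive.
Import Order.TTheory GRing.Theory Num.Theory.
Import numFieldNormedType.Exports.

Local Open Scope classical_set_scope.
Local Open Scope ring_scope.

(** For a graph F put Z = (x - s) + i (y - F(s)). The two components of the kernel in the formula
    are the imaginary and the real part of 1 / Z, so the claimed velocity is a combination of two
    Cauchy integrals with densities f' and h'. It must be shown that this field, with a suitable
    pressure, is a solution, and that every solution agrees with it up to a constant in the
    pressures.

    Regularity of the curves. Let a = r - 3/2. A function in H^r(R) is bounded and differentiable,
    and its derivative is bounded, a-Hölder continuous and square integrable ([sobolev_regular]).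
    The Slobodeckij seminorm controls the difference of the means of the weak derivative over nested
    intervals ([mean_diff_le]), and a Campanato argument turns this into a Hölder bound
    ([campanato_holder]).

    Existence. Off its curve a Cauchy integral is smooth, by differentiation under the integral, and
    harmonic. Its gradient grows at most like the vertical gap to the curve to the power a - 1
    ([cauchy2_le]), and integrating this bound gives Hölder continuity up to the curve from either
    side ([cauchy1_holder_above]). With the square integrability of the density this yields
    boundedness and decay at infinity ([tame_cauchy]). Integration by parts ([cauchy_by_parts])
    exhibits the field as a gradient, of [pot], and hence provides the pressure. A blow-up at a
    point of the curve gives the Plemelj formula ([cauchy_jump]): the field jumps by a tangential
    vector, so its normal component is continuous, while [pot] jumps by a multiple of f (or h). The
    constants Theta_1 and Theta_2 balance this jump against that of the hydrostatic term
    ([muskat_exists]).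

    Uniqueness. The difference Phi of the pressures of two solutions is harmonic in each layer, has
    a gradient vanishing at infinity, and is continuous across the curves together with its normal
    derivative. Equality of Phi along a curve forces equality of the tangential derivatives, so the
    vertical derivative is continuous too ([trace_gradient]). For fixed b the function u(z) = Phi(z
    + (0, b)) - Phi(z) vanishes at infinity; were it positive somewhere, it would have a positive
    maximum. A small multiple of |z|^2 makes u strictly subharmonic off the curves and their
    translates, and small multiples of single layer potentials, whose vertical derivatives jump
    upwards across the curves ([kinked_barrier]), keep the maximum away from them: a contradiction.
    Hence u <= 0 for all b, Phi does not depend on y, and since its gradient vanishes at infinity,
    Phi is constant ([harmonic_transmission_rigid]). *)

Section Derivatives.
Context {R : realType}.
Implicit Types (f g : R -> R) (x a b : R).

(** * Derivatives of functions of one real variable *)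

Lemma is_derive1D f g x a b : is_derive x 1 f a -> is_derive x 1 g b ->
  is_derive x 1 (fun y => f y + g y) (a + b).
Proof. by move=> fa gb; exact: is_deriveD. Qed.

Lemma is_derive1B f g x a b : is_derive x 1 f a -> is_derive x 1 g b ->
  is_derive x 1 (fun y => f y - g y) (a - b).
Proof. by move=> fa gb; exact: is_deriveB. Qed.

Lemma is_derive1M f g x a b : is_derive x 1 f a -> is_derive x 1 g b ->
  is_derive x 1 (fun y => f y * g y) (a * g x + f x * b).
Proof.
move=> fa gb; apply: (@is_derive_eq _ _ _ (f * g)).
by rewrite /GRing.scale/= addrC (mulrC a).
Qed.

Lemma is_derive1C (c : R) x : is_derive x 1 (fun=> c) 0.
Proof. exact: is_derive_cst. Qed.

Lemma is_derive1Z (c : R) f x a : is_derive x 1 f a ->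
  is_derive x 1 (fun y => c * f y) (c * a).
Proof.
move=> fa; have := is_derive1M (is_derive1C c x) fa.
by rewrite mul0r add0r.
Qed.

Lemma is_derive1N f x a : is_derive x 1 f a -> is_derive x 1 (fun y => - f y) (- a).
Proof. by move=> fa; exact: is_deriveN. Qed.

Lemma is_derive1V f x a : is_derive x 1 f a -> f x != 0 ->
  is_derive x 1 (fun y => (f y)^-1) (- a / f x ^+ 2).
Proof.
move=> fa fx0; have := is_deriveV fx0 fa; rewrite /GRing.scale/=.
by rewrite mulrC mulrN -mulNr.
Qed.

Lemma is_derive1_continuous f x a : is_derive x 1 f a -> {for x, continuous f}.
Proof. by case=> fx _; exact/differentiable_continuous/derivable1_diffP. Qed.

Lemma is_derive1_derive1 f x : derivable f x 1 -> is_derive x 1 f (derive1 f x).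
Proof. by move=> fx; rewrite derive1E; exact: derivableP. Qed.

Lemma is_derive1E f x a : is_derive x 1 f a -> derive1 f x = a.
Proof. by move=> fx; rewrite derive1E derive_val. Qed.

End Derivatives.

(** * Domination and dominated convergence on the line *)

Section IntegralLine.
Context {R : realType}.
Local Notation mu := (@lebesgue_measure R).
Local Notation integrableT f := (mu.-integrable setT (EFin \o f)).
Implicit Types (f g G : R -> R).

Lemma dominated_integrable f g : measurable_fun setT f -> integrableT g ->
  (forall x, `|f x| <= g x) -> integrableT f.
Proof.
move=> mf gi fg; apply: (le_integrable _ _ _ gi) => //.
  by apply/measurable_EFinP.
move=> x _ /=; rewrite lee_fin; apply: (le_trans (fg x)); exact: ler_norm.
Qed.

Lemma integrableTD f g : integrableT f -> integrableT g ->
  integrableT (fun x => f x + g x).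
Proof.
by move=> fi gi; exact: (integrableD measurableT fi gi).
Qed.

Lemma integrableTZ (c : R) f : integrableT f -> integrableT (fun x => c * f x).
Proof.
by move=> fi; exact: (integrableZl measurableT c fi).
Qed.

Lemma integrableTB f g : integrableT f -> integrableT g ->
  integrableT (fun x => f x - g x).
Proof.
move=> fi gi; have := integrableTD fi (integrableTZ (-1) gi).
by congr (mu.-integrable setT (EFin \o _)); apply/funext => x; rewrite mulN1r.
Qed.

Lemma normr_Rintegral_le f g : measurable_fun setT f -> integrableT g ->
  (forall x, `|f x| <= g x) -> `|\int[mu]_x f x| <= \int[mu]_x g x.
Proof.
move=> mf gi fg; have fi := dominated_integrable mf gi fg.
apply: (le_trans (le_normr_Rintegral _ fi)) => //.
apply: le_Rintegral => //; apply: (dominated_integrable _ gi) => //.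
  exact: measurableT_comp.
by move=> x; rewrite normr_id.
Qed.

Lemma dominated_cvg_Rintegral (u : nat -> R -> R) f g :
  (forall n, measurable_fun setT (u n)) ->
  (forall x, u n x @[n --> \oo] --> f x) -> integrableT g ->
  (forall n x, `|u n x| <= g x) ->
  \int[mu]_x u n x @[n --> \oo] --> \int[mu]_x f x.
Proof.
move=> mu_ uf gi ug.
have mf : measurable_fun setT f.
  by apply: (measurable_fun_cvg mu_) => x _; exact: uf.
have fi : integrableT f.
  apply: (dominated_integrable mf gi) => x.
  apply: cvgr_to_le (cvg_norm (uf x)) _.
  by apply: nearW => n; exact: ug.
apply: fine_cvg; rewrite fineK; last exact: integrable_fin_num.
apply: (@dominated_cvg _ _ _ mu setT measurableT
  (fun n => EFin \o u n) (EFin \o f) (EFin \o g)) => //.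
- by move=> n; apply/measurable_EFinP; exact: mu_.
- by move=> x _; apply: cvg_EFin; [exact: nearW|exact: uf].
- by move=> n x _; rewrite lee_fin; exact: ug.
Qed.

End IntegralLine.

(** * Integrals over the line computed from a primitive *)

Section IntegralPrimitive.
Context {R : realType}.
Local Notation mu := (@lebesgue_measure R).
Local Notation integrableT f := (mu.-integrable setT (EFin \o f)).
Implicit Types (f g G : R -> R).

Lemma integral_segment_primitive f G (a b : R) : a < b -> continuous f ->
  (forall x : R, is_derive x 1 G (f x)) ->
  (\int[mu]_(x in `[a, b]) (f x)%:E = (G b - G a)%:E)%E.
Proof.
move=> ab cf dG; rewrite EFinB; apply: continuous_FTC2 => //.
- exact: continuous_subspaceT.
- split.
  + by move=> x _; case: (dG x).
  + by apply: cvg_at_right_filter; exact: is_derive1_continuous (dG a).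
  + by apply: cvg_at_left_filter; exact: is_derive1_continuous (dG b).
- by move=> x _; exact: is_derive1E (dG x).
Qed.

(** The successor keeps the interval nondegenerate at n = 0, since [integral_segment_primitive] asks
    for a < b. *)
Let sym_itv (n : nat) : set R := `[- n.+1%:R, n.+1%:R].

Let sym_itv_nd : nondecreasing_seq sym_itv.
Proof.
move=> m n mn; apply/subsetPset => x; rewrite /sym_itv /= !in_itv/= => /andP[h1 h2].
have mn' : m.+1%:R <= n.+1%:R :> R by rewrite ler_nat.
by apply/andP; split; lra.
Qed.

Let bigcup_sym_itv : \bigcup_n sym_itv n = setT.
Proof.
apply/seteqP; split=> // x _.
exists (Num.truncn `|x|) => //; rewrite /sym_itv /= in_itv/= -ler_norml.
by apply/ltW; exact: truncnS_gt.
Qed.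

Let sym_itv_lt (n : nat) : - n.+1%:R < n.+1%:R :> R.
Proof. by rewrite gtrN// ltr0n. Qed.

(** Monotone convergence: over each symmetric interval the integral is a difference of two values of
    G, hence at most 2 M. *)
Lemma bounded_primitive_integrable f G (M : R) : continuous f ->
  (forall x, 0 <= f x) -> (forall x : R, is_derive x 1 G (f x)) ->
  (forall x, `|G x| <= M) -> integrableT f.
Proof.
move=> cf f0 dG GM.
have mf : measurable_fun setT f by exact: continuous_measurable_fun.
have cvgi : (\int[mu]_(x in sym_itv n) (f x)%:E @[n --> \oo] -->
    \int[mu]_x (f x)%:E)%E.
  rewrite -bigcup_sym_itv; apply: ge0_nondecreasing_set_cvg_integral => //.
  - by move=> n; exact: measurable_itv.
  - by move=> n; apply/measurable_EFinP; exact: measurable_funTS.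
  - by move=> n x _; rewrite lee_fin.
apply/integrableP; split; first exact/measurable_EFinP.
under eq_integral do rewrite /= ger0_norm//.
apply: (@le_lt_trans _ _ (M + M)%:E); last exact: ltry.
apply: (cvge_to_le cvgi); apply: nearW => n /=.
rewrite (integral_segment_primitive (sym_itv_lt n) cf dG) lee_fin.
have := GM n.+1%:R; have := GM (- n.+1%:R).
by rewrite !ler_norml => /andP[? ?] /andP[? ?]; lra.
Qed.

Lemma Rintegral_primitive f G (l1 l2 : R) : continuous f -> integrableT f ->
  (forall x : R, is_derive x 1 G (f x)) ->
  G n.+1%:R @[n --> \oo] --> l2 -> G (- n.+1%:R) @[n --> \oo] --> l1 ->
  \int[mu]_x f x = l2 - l1.
Proof.
move=> cf fi dG G2 G1.
have mf : measurable_fun setT f by exact: continuous_measurable_fun.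
pose u n := f \_ (sym_itv n).
have : \int[mu]_x u n x @[n --> \oo] --> \int[mu]_x f x.
  apply: (@dominated_cvg_Rintegral _ _ _ (fun x => `|f x|)).
  - move=> n; apply/(measurable_restrictT f); first exact: measurable_itv.
    exact: measurable_funTS.
  - move=> x; have : (\bigcup_n sym_itv n) x by rewrite bigcup_sym_itv.
    move=> [N _ Nx]; apply: cvg_near_cst; exists N => // n /= Nn.
    rewrite /u patchE ifT// inE; have := sym_itv_nd Nn.
    by move/subsetPset; exact.
  - exact: integrable_norm.
  - by move=> n x; rewrite /u patchE; case: ifPn => // _; rewrite normr0.
have -> : (fun n => \int[mu]_x u n x) = (fun n => G n.+1%:R - G (- n.+1%:R)).
  apply/funext => n; rewrite /u -Rintegral_mkcond /Rintegral.
  by rewrite (integral_segment_primitive (sym_itv_lt n) cf dG).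
by move=> h; apply: (cvg_unique _ h) => //; exact: cvgB.
Qed.

End IntegralPrimitive.

(** * Affine change of variables *)

Section ChangeOfVariables.
Context {R : realType}.
Local Notation mu := (@lebesgue_measure R).
Local Notation integrableT f := (mu.-integrable setT (EFin \o f)).
Implicit Types (G : R -> R).

Let affine_derive (x t s : R) : is_derive s 1 (fun s => x + t * s) t.
Proof.
have := is_derive1D (is_derive1C x s) (is_derive1Z t (is_derive_id s 1)).
by rewrite mulr1 add0r.
Qed.

Let ge0_integral_affine G (x t : R) : 0 < t -> continuous G ->
  (forall s, 0 <= G s) ->
  (\int[mu]_s (G s)%:E = \int[mu]_s (t * G (x + t * s))%:E)%E.
Proof.
move=> t0 cG G0.
have dE : derive1 (fun s : R => x + t * s) = (fun=> t).
  by apply/funext => s; exact: is_derive1E (affine_derive x t s).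
rewrite (@increasing_ge0_integration_by_substitutionT _ (fun s => x + t * s))//.
- by apply: eq_integral => s _; rewrite dE /= mulrC.
- by move=> a b ab; rewrite ltrD2l ltr_pM2l.
- by rewrite dE => s; exact: cvg_cst.
- by rewrite dE; apply/cvg_ex; exists t; exact: cvg_cst.
- by rewrite dE; apply/cvg_ex; exists t; exact: cvg_cst.
- apply/cvgrNyPle => A; exists ((A - x) / t); split; first exact: num_real.
  by move=> s /=; rewrite ltr_pdivlMr// mulrC ltrBrDl => /ltW.
- apply/cvgryPge => A; exists ((A - x) / t); split; first exact: num_real.
  by move=> s /=; rewrite ltr_pdivrMr// mulrC ltrBlDl => /ltW.
Qed.

Let continuous_affine G (x t : R) : continuous G ->
  continuous (fun s => t * G (x + t * s)).
Proof.
move=> cG s; apply: cvgM; first exact: cvg_cst.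
apply: continuous_cvg; first exact: cG.
exact: is_derive1_continuous (affine_derive x t s).
Qed.

Lemma integrable_affine G (x t : R) : 0 < t -> continuous G -> integrableT G ->
  integrableT (fun s => t * G (x + t * s)).
Proof.
move=> t0 cG /integrableP[_ Gi]; apply/integrableP; split.
  apply/measurable_EFinP; apply: continuous_measurable_fun.
  exact: continuous_affine.
have cN : continuous (fun s => `|G s|).
  by move=> s; apply: cvg_norm; exact: cG.
move: Gi; rewrite /= (ge0_integral_affine x t0 cN)//.
by under eq_integral do rewrite -{1}(gtr0_norm t0) -normrM.
Qed.

(** Substitution in the nonnegative functions |G| + G and |G|, whose difference is G. *)
Lemma Rintegral_affine G (x t : R) : 0 < t -> continuous G -> integrableT G ->
  \int[mu]_s G s = \int[mu]_s (t * G (x + t * s)).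
Proof.
move=> t0 cG Gi.
have cN : continuous (fun s => `|G s|).
  by move=> s; apply: cvg_norm; exact: cG.
have cP : continuous (fun s => `|G s| + G s).
  by move=> s; apply: cvgD; [exact: cN|exact: cG].
have Ni : integrableT (fun s => `|G s|) by exact: integrable_norm.
have Pi : integrableT (fun s => `|G s| + G s) by exact: integrableTD.
have h (H : R -> R) : continuous H -> (forall s, 0 <= H s) ->
    \int[mu]_s H s = \int[mu]_s (t * H (x + t * s)).
  by move=> cH H0; rewrite /Rintegral (ge0_integral_affine x t0 cH H0).
have hG s : G s = (`|G s| + G s) - `|G s| by ring.
under eq_Rintegral do rewrite hG.
rewrite RintegralB// h//; last first.
  by move=> s; have := ler_norm (- G s); rewrite normrN; lra.
rewrite (h _ cN)// -RintegralB//; first by apply: eq_Rintegral => s _; ring.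
- exact: (integrable_affine x t0 cP).
- exact: (integrable_affine x t0 cN).
Qed.

End ChangeOfVariables.

(** * The integrals of |s|^a / (s^2 + t^2) over the line *)

Section PowerIntegrals.
Context {R : realType}.
Local Notation mu := (@lebesgue_measure R).
Local Notation integrableT f := (mu.-integrable setT (EFin \o f)).
Implicit Types (a x t : R).

Lemma continuous_powR_norm a : 0 <= a -> continuous (fun s : R => `|s| `^ a).
Proof.
rewrite le_eqVlt => /predU1P[<- s|a0 s].
  under eq_fun do rewrite powRr0; exact: cvg_cst.
have [->|s0] := eqVneq s 0.
  rewrite /prop_for /continuous_at normr0 powR0 ?gt_eqF//; apply/cvgrPdist_le => e e0.
  near=> y; rewrite sub0r normrN ger0_norm ?powR_ge0//.
  rewrite (_ : e = (e `^ a^-1) `^ a); last first.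
    by rewrite -powRrM mulVf ?gt_eqF// powRr1// ltW.
  apply: ge0_ler_powR; rewrite ?nnegrE ?powR_ge0 ?(ltW a0)//.
  near: y; apply: (@nbhs0_le _ R); exact: powR_gt0.
have h : {for `|s|, continuous (fun y : R => y `^ a)}.
  apply: (@is_derive1_continuous _ _ _ (a * `|s| `^ (a - 1))).
  by apply: is_derive1_powR; rewrite normr_gt0.
apply: (continuous_cvg _ h); exact: norm_continuous.
Unshelve. all: by end_near. Qed.

Let one_sqr_gt0 (s : R) : 0 < 1 + s ^+ 2.
Proof. by rewrite ltr_pwDl// sqr_ge0. Qed.

Lemma is_derive1_1sqr (s : R) : is_derive s 1 (fun y : R => 1 + y ^+ 2) (2 * s).
Proof.
have h := is_derive1D (is_derive1C 1 s)
  (is_derive1M (is_derive_id s 1) (is_derive_id s 1)).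
by apply: (is_derive_eq h); rewrite add0r mulr1 mul1r mulr2n mulrDl mul1r.
Qed.

Lemma continuous_hl_kernel a : 0 <= a ->
  continuous (fun s : R => `|s| `^ a / (1 + s ^+ 2)).
Proof.
move=> a0 s; apply: cvgM; first exact: continuous_powR_norm.
apply: cvgV; first by rewrite gt_eqF.
exact: is_derive1_continuous (is_derive1_1sqr s).
Qed.

(* The primitive atan (s / (1 + s^2)^(a / 2)) is bounded and its derivative
   dominates the integrand. *)
Lemma integrable_hl_kernel a : 0 <= a < 1 ->
  integrableT (fun s : R => `|s| `^ a / (1 + s ^+ 2)).
Proof.
move=> /andP[a0 a1].
(* [phi] grows like |s|^(1 - a), so the derivative of its arctangent is of order |s|^(a - 2), just
   like the integrand. *)
pose b := a / 2; pose q (s : R) := 1 + s ^+ 2.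
pose w (s : R) := q s `^ (- b).
have q0 s : 0 < q s by exact: one_sqr_gt0.
have w0 s : 0 < w s by apply: powR_gt0; exact: q0.
pose phi (s : R) := s * w s.
pose dphi (s : R) := w s * (1 - a * (s ^+ 2 / q s)).
have dw (s : R) : is_derive s 1 w (- a * s * w s / q s).
  have h : is_derive s 1 ((fun y : R => y `^ (- b)) \o q) (- b * q s `^ (- b - 1) * (2 * s)).
    apply: is_derive1_comp; last exact: is_derive1_1sqr.
    by apply: is_derive1_powR; exact: q0.
  apply: (is_derive_eq h); rewrite powRD; last by apply/implyP => _; rewrite gt_eqF.
  rewrite powR_inv1 ?ltW// -/(w s) /b; field.
  by rewrite gt_eqF.
have dphiP (s : R) : is_derive s 1 phi (dphi s).
  apply: (is_derive_eq (is_derive1M (is_derive_id s 1) (dw s))).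
  by rewrite /dphi; field; rewrite gt_eqF//; exact: one_sqr_gt0.
pose f s := dphi s / (1 + phi s ^+ 2).
have df (s : R) : is_derive s 1 (atan \o phi) (f s).
  have := is_derive1_comp (is_derive1_atan (phi s)) (dphiP s).
  by rewrite mulrC.
have sq s : 0 <= s ^+ 2 / q s <= 1.
  rewrite divr_ge0 ?sqr_ge0 ?(ltW (one_sqr_gt0 s))//=.
  by rewrite ler_pdivrMr// mul1r lerDr.
have dphi_ge s : (1 - a) * w s <= dphi s.
  rewrite /dphi mulrC ler_pM2l// lerB//.
  by have /andP[? ?] := sq s; rewrite ler_piMr.
have f0 s : 0 <= f s.
  rewrite divr_ge0//; last by rewrite ltW.
  by apply: le_trans (dphi_ge s); rewrite mulr_ge0 ?subr_ge0 ?ltW.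
have cw : continuous w by move=> s; exact: is_derive1_continuous (dw s).
have cq : continuous q by move=> s; exact: is_derive1_continuous (is_derive1_1sqr s).
have cf : continuous f.
  move=> s; apply: cvgM.
    apply: cvgM; first exact: cw.
    apply: cvgB; first exact: cvg_cst.
    apply: cvgM; first exact: cvg_cst.
    apply: cvgM; first exact: (@exprn_continuous R 2).
    by apply: cvgV; [rewrite gt_eqF|exact: cq].
  apply: cvgV; first by rewrite gt_eqF.
  apply: cvgD; first exact: cvg_cst.
  apply: (continuous_cvg _ (@exprn_continuous R 2 (phi s))).
  exact: is_derive1_continuous (dphiP s).
have fi : integrableT f.
  apply: (bounded_primitive_integrable (M := pi / 2) cf f0 df) => s /=.
  by rewrite ler_norml !ltW// ?atan_ltpi2// atan_gtNpi2.
apply: (dominated_integrable _ (integrableTZ (2 / (1 - a)) fi)).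
  by apply: continuous_measurable_fun; exact: continuous_hl_kernel.
move=> s; rewrite ger0_norm; last by rewrite divr_ge0 ?powR_ge0// ltW.
have wV : w s * q s `^ b = 1.
  by rewrite /w powRN mulVf// gt_eqF// powR_gt0.
have q1 : 1 <= q s by rewrite lerDl sqr_ge0.
have sqb : `|s| `^ a <= q s `^ b.
  rewrite (_ : `|s| `^ a = (`|s| ^+ 2) `^ b); last first.
    by rewrite -powR_mulrn// -powRrM /b mulrCA divff ?mulr1.
  apply: ge0_ler_powR; rewrite ?nnegrE ?sqr_ge0 ?divr_ge0 ?(ltW (q0 s))//.
  by rewrite real_normK ?num_real// /q lerDr.
(* q w^2 = q^(1 - a) is at least 1, and phi^2 = s^2 w^2 is at most q w^2. *)
have phi2 : 1 + phi s ^+ 2 <= 2 * (q s * w s ^+ 2).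
  have h1 : 1 <= q s * w s ^+ 2.
    have : q s `^ (2 * b) <= q s.
      by rewrite -[leRHS]powRr1 ?(ltW (q0 s))// ler_powR// /b; lra.
    rewrite (_ : 2 * b = b + b); last by rewrite mulr2n mulrDl mul1r.
    rewrite powRD; last by apply/implyP => _; rewrite gt_eqF.
    move=> h; rewrite -[leLHS](_ : (w s * q s `^ b) ^+ 2 = 1); last first.
      by rewrite wV expr1n.
    by rewrite exprMn [leRHS]mulrC ler_wpM2l ?sqr_ge0.
  rewrite /phi exprMn mulr_natl mulr2n lerD// ler_wpM2r ?sqr_ge0//.
  by rewrite lerDr.
rewrite /f ler_pdivrMr// -/(q s).
rewrite [leRHS](_ : _ = 2 / (1 - a) * q s * dphi s / (1 + phi s ^+ 2)); last by ring.
rewrite ler_pdivlMr ?ltr_pwDl ?sqr_ge0//.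
apply: (le_trans (ler_wpM2l (powR_ge0 _ _) phi2)).
apply: (@le_trans _ _ (q s `^ b * (2 * (q s * w s ^+ 2)))).
  by rewrite ler_wpM2r// mulr_ge0// mulr_ge0 ?sqr_ge0// (le_trans _ q1).
rewrite (_ : q s `^ b * _ = 2 * q s * w s * (w s * q s `^ b)); last by ring.
rewrite wV mulr1 (_ : 2 / (1 - a) * q s * _ = 2 * q s * (dphi s / (1 - a))).
  rewrite ler_wpM2l ?mulr_ge0 ?(ltW (q0 s))// ler_pdivlMr ?subr_gt0//.
  by rewrite mulrC.
by ring.
Qed.

Definition hl_const a : R := \int[mu]_s (`|s| `^ a / (1 + s ^+ 2)).

Let hl_scaleE a x t s : 0 <= a -> 0 < t ->
  t^-1 * (`|- x / t + t^-1 * s| `^ a / (1 + (- x / t + t^-1 * s) ^+ 2)) =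
  t `^ (1 - a) * (`|s - x| `^ a / ((s - x) ^+ 2 + t ^+ 2)).
Proof.
move=> a0 t0; have -> : - x / t + t^-1 * s = t^-1 * (s - x) by ring.
rewrite normrM powRM// gtr0_norm ?invr_gt0// -powR_inv1 ?ltW// -powRrM mulN1r.
rewrite powR_inv1 ?ltW// powRD ?powRr1 ?ltW//; last by apply/implyP => _; rewrite gt_eqF.
have d0 : (s - x) ^+ 2 + t ^+ 2 != 0.
  by rewrite gt_eqF// ltr_wpDl ?sqr_ge0 ?exprn_gt0.
by field; rewrite d0 gt_eqF//= addrC.
Qed.

Lemma integrable_hl a x t : 0 <= a < 1 -> 0 < t ->
  integrableT (fun s => `|s - x| `^ a / ((s - x) ^+ 2 + t ^+ 2)).
Proof.
move=> /[dup] /andP[a0 _] a01 t0.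
have ti0 : 0 < t^-1 by rewrite invr_gt0.
have := integrable_affine (- x / t) ti0 (continuous_hl_kernel a0)
  (integrable_hl_kernel a01).
under eq_fun do rewrite (hl_scaleE _ _ a0 t0).
move=> /(integrableTZ (t `^ (1 - a))^-1).
by under eq_fun do rewrite mulKf ?gt_eqF ?powR_gt0//.
Qed.

(** The substitution s = x + t r extracts the power of t. This is the rate at which gradients of
    Cauchy integrals may blow up at the curve. *)
Lemma Rintegral_hl a x t : 0 <= a < 1 -> 0 < t ->
  \int[mu]_s (`|s - x| `^ a / ((s - x) ^+ 2 + t ^+ 2)) =
  t `^ (a - 1) * hl_const a.
Proof.
move=> /[dup] /andP[a0 _] a01 t0.
have ti0 : 0 < t^-1 by rewrite invr_gt0.
rewrite /hl_const (Rintegral_affine (- x / t) ti0 (continuous_hl_kernel a0)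
  (integrable_hl_kernel a01)).
under [in RHS]eq_Rintegral do rewrite (hl_scaleE _ _ a0 t0).
rewrite RintegralZl//; last exact: integrable_hl.
by rewrite -(opprB 1 a) powRN mulKf// gt_eqF// powR_gt0.
Qed.

Lemma hl_const_ge0 a : 0 <= hl_const a.
Proof.
apply: Rintegral_ge0 => s _; rewrite divr_ge0 ?powR_ge0//.
by rewrite addr_ge0 ?sqr_ge0.
Qed.

Lemma integrable_poisson x t : 0 < t ->
  integrableT (fun s => ((s - x) ^+ 2 + t ^+ 2)^-1).
Proof.
move=> t0; have := @integrable_hl 0 x t; rewrite lexx ltr01 => /(_ isT t0).
by under eq_fun do rewrite powRr0 div1r.
Qed.

Lemma Rintegral_poisson x t : 0 < t ->
  \int[mu]_s ((s - x) ^+ 2 + t ^+ 2)^-1 = t^-1 * hl_const 0.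
Proof.
move=> t0; rewrite -[t^-1]powR_inv1 ?ltW// -[-1]sub0r -(Rintegral_hl x) ?lexx ?ltr01//.
by apply: eq_Rintegral => s _; rewrite powRr0 div1r.
Qed.

End PowerIntegrals.

(** * Negative powers of X + iY as real kernels *)

Section Kernel.
Context {R : realType}.
Implicit Types (p q X Y x y s t L a K : R) (n : nat) (F w : R -> R) (z : plane R).

(* Real and imaginary part of (X + iY)^(-n). *)
Fixpoint inv_pow n X Y : R * R :=
  if n is m.+1 then
    let c := inv_pow m X Y in
    ((c.1 * X + c.2 * Y) / (X ^+ 2 + Y ^+ 2),
     (c.2 * X - c.1 * Y) / (X ^+ 2 + Y ^+ 2))
  else (1, 0).

(* Real part of (p - iq) (X + iY)^(-n): with the parameters p and q the family
   is stable under differentiation. *)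
Definition ckernel p q n X Y : R := p * (inv_pow n X Y).1 + q * (inv_pow n X Y).2.

Lemma inv_pow_norm n X Y :
  (inv_pow n X Y).1 ^+ 2 + (inv_pow n X Y).2 ^+ 2 <= (X ^+ 2 + Y ^+ 2) ^- n.
Proof.
elim: n => [|n ih] /=; first by rewrite invr1 !expr2; lra.
set d := X ^+ 2 + Y ^+ 2 in ih *; set c := inv_pow n X Y in ih *.
(* At the origin both sides are 0, since inversion sends 0 to 0. *)
have [d0|d0] := eqVneq d 0.
  by rewrite d0 invr0 !mulr0 !expr0n /= addr0 invr0.
have -> : ((c.1 * X + c.2 * Y) / d) ^+ 2 + ((c.2 * X - c.1 * Y) / d) ^+ 2 =
    (c.1 ^+ 2 + c.2 ^+ 2) / d.
  by rewrite /d; field.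
rewrite [d ^+ n.+1]exprSr invfM ler_wpM2r//.
by rewrite invr_ge0 /d addr_ge0 ?sqr_ge0.
Qed.

(** Cauchy-Schwarz for (p, q) and the components of the power; the defect is a square. *)
Lemma ckernel_sqr_le p q n X Y :
  ckernel p q n X Y ^+ 2 <= (p ^+ 2 + q ^+ 2) * (X ^+ 2 + Y ^+ 2) ^- n.
Proof.
have := inv_pow_norm n X Y; set c := inv_pow n X Y => cd.
apply: le_trans (ler_wpM2l _ cd); last by rewrite addr_ge0 ?sqr_ge0.
rewrite /ckernel -/c -subr_ge0.
by have -> : (p ^+ 2 + q ^+ 2) * (c.1 ^+ 2 + c.2 ^+ 2) -
    (p * c.1 + q * c.2) ^+ 2 = (p * c.2 - q * c.1) ^+ 2; [ring|rewrite sqr_ge0].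
Qed.

(** The rule dZ^(-n) = -n Z^(-n-1) dZ, separated into real and imaginary part. *)
Let is_derive_inv_pow n (X Y : R -> R) (s dX dY : R) :
  is_derive s 1 X dX -> is_derive s 1 Y dY -> X s ^+ 2 + Y s ^+ 2 != 0 ->
  let c := inv_pow n.+1 (X s) (Y s) in
  is_derive s 1 (fun r => (inv_pow n (X r) (Y r)).1) (- n%:R * (c.1 * dX - c.2 * dY)) /\
  is_derive s 1 (fun r => (inv_pow n (X r) (Y r)).2) (- n%:R * (c.2 * dX + c.1 * dY)).
Proof.
move=> hX hY d0; elim: n => [|n [ih1 ih2]].
  by split; apply: (is_derive_eq (is_derive1C _ _)); rewrite oppr0 mul0r.
have hD : is_derive s 1 (fun r => X r ^+ 2 + Y r ^+ 2) (2 * (X s * dX + Y s * dY)).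
  apply: (is_derive_eq (is_derive1D (is_derive1M hX hX) (is_derive1M hY hY))).
  by ring.
have hV := is_derive1V hD d0.
split.
- apply: (is_derive_eq (is_derive1M (is_derive1D (is_derive1M ih1 hX)
    (is_derive1M ih2 hY)) hV)).
  by rewrite /= -natr1; field.
- apply: (is_derive_eq (is_derive1M (is_derive1B (is_derive1M ih2 hX)
    (is_derive1M ih1 hY)) hV)).
  by rewrite /= -natr1; field.
Qed.

(** The derivative is the real part of -n (p - iq) Z^(-n-1) (dX + i dY). As (p - iq) i = q + ip, the
    term with dY has the parameters (q, -p). *)
Lemma is_derive_ckernel p q n (X Y : R -> R) (s dX dY : R) :
  is_derive s 1 X dX -> is_derive s 1 Y dY -> X s ^+ 2 + Y s ^+ 2 != 0 ->
  is_derive s 1 (fun r => ckernel p q n (X r) (Y r))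
    (- n%:R * (dX * ckernel p q n.+1 (X s) (Y s) +
               dY * ckernel q (- p) n.+1 (X s) (Y s))).
Proof.
move=> hX hY d0; have [h1 h2] := is_derive_inv_pow n hX hY d0.
apply: (is_derive_eq (is_derive1D (is_derive1Z p h1) (is_derive1Z q h2))).
by rewrite /ckernel; ring.
Qed.

Lemma ckernelE (p q p' q' c d : R) n X Y :
  ckernel (c * p + d * p') (c * q + d * q') n X Y =
  c * ckernel p q n X Y + d * ckernel p' q' n X Y.
Proof. by rewrite /ckernel; ring. Qed.

End Kernel.

(** * Distance from a point to a Lipschitz graph *)

Section Curve.
Context {R : realType}.
Local Notation mu := (@lebesgue_measure R).
Local Notation integrableT f := (mu.-integrable setT (EFin \o f)).
Implicit Types (p q X Y x y s t L a K : R) (n : nat) (F w : R -> R) (z : plane R).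

Definition lipschitz_fun L F := forall x y, `|F x - F y| <= L * `|x - y|.

Definition holder_fun a K F := forall x y, `|F x - F y| <= K * `|x - y| `^ a.

Definition off_curve F : set (plane R) := [set z | z.2 != F z.1].

Definition dist2 F z s : R := (z.1 - s) ^+ 2 + (z.2 - F s) ^+ 2.

Definition dist_const L : R := 2 + 2 * L ^+ 2.

Lemma dist_const_gt0 L : 0 < dist_const L.
Proof. by rewrite ltr_pwDl// mulr_ge0// sqr_ge0. Qed.

Lemma ler_normr_sqr x y : `|x| <= y -> x ^+ 2 <= y ^+ 2.
Proof.
move=> xy; rewrite -(real_normK (num_real x)).
by rewrite lerXn2r ?nnegrE// (le_trans (normr_ge0 x)).
Qed.

(** The square of the vertical gap over z.1 is at most twice the square of the gap over s plus 2 L^2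
    (s - z.1)^2. So the squared distance to the point of the curve over s dominates a Poisson type
    denominator in s. *)
Lemma dist2_ge L F z s : lipschitz_fun L F ->
  (s - z.1) ^+ 2 + (z.2 - F z.1) ^+ 2 <= dist_const L * dist2 F z s.
Proof.
move=> /(_ s z.1)/ler_normr_sqr; rewrite exprMn real_normK ?num_real// => h.
rewrite /dist_const /dist2.
have h2 : (z.2 - F z.1) ^+ 2 <= 2 * (z.2 - F s) ^+ 2 + 2 * (F s - F z.1) ^+ 2.
  have := sqr_ge0 (z.2 - F s - (F s - F z.1)); rewrite -subr_ge0 => h2.
  rewrite -subr_ge0; apply: le_trans h2 _.
  by rewrite le_eqVlt; apply/orP; left; apply/eqP; ring.
have : 0 <= L ^+ 2 * (z.2 - F s) ^+ 2 by rewrite mulr_ge0 ?sqr_ge0.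
have := sqr_ge0 (s - z.1); have : (z.1 - s) ^+ 2 = (s - z.1) ^+ 2 by ring.
move=> ->; set A := (s - z.1) ^+ 2 in h *; set B := (z.2 - F s) ^+ 2 in h2 *.
set C := (F s - F z.1) ^+ 2 in h h2; set D := L ^+ 2 in h *.
by move=> A0 DB; nra.
Qed.

Lemma dist2_gt0 F z s : off_curve F z -> 0 < dist2 F z s.
Proof.
move=> zF; rewrite /dist2; have [->|xs] := eqVneq s z.1.
  by rewrite subrr expr0n add0r exprn_even_gt0//= subr_eq0.
by rewrite ltr_pwDl ?sqr_ge0// exprn_even_gt0//= subr_eq0 eq_sym.
Qed.

(** Moving both coordinates by at most this amount changes the vertical gap to the curve by at most
    half of it. *)
Definition near_radius L F z : R := `|z.2 - F z.1| / (2 * (1 + `|L|)).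

Lemma near_radius_gt0 L F z : off_curve F z -> 0 < near_radius L F z.
Proof.
move=> zF; rewrite divr_gt0 ?normr_gt0 ?subr_eq0//.
Qed.

(** The lower bound depends on z only, which makes majorants uniform for all z' near z. *)
Lemma dist2_ge_near L F z z' s : lipschitz_fun L F ->
  `|z'.1 - z.1| <= near_radius L F z -> `|z'.2 - z.2| <= near_radius L F z ->
  (s - z.1) ^+ 2 + (z.2 - F z.1) ^+ 2 <= 6 * dist_const L * dist2 F z' s.
Proof.
move=> FL h1 h2; set t0 := `|z.2 - F z.1|.
have d0 : 0 < 1 + `|L| by rewrite ltr_pwDl.
have rE : near_radius L F z * (1 + `|L|) = t0 / 2.
  by rewrite /near_radius -/t0; field; rewrite gt_eqF.
set r := near_radius L F z in h1 h2 rE.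
have hF : `|F z'.1 - F z.1| <= `|L| * r.
  apply: le_trans (FL _ _) _; apply: (@le_trans _ _ (`|L| * `|z'.1 - z.1|)).
    by rewrite ler_wpM2r// ler_norm.
  by rewrite ler_wpM2l.
have r_ge0 : 0 <= r by apply: le_trans h1.
have Lr : 0 <= `|L| * r by rewrite mulr_ge0.
have t_ge : t0 / 2 <= `|z'.2 - F z'.1|.
  have : t0 <= `|z'.2 - F z'.1| + (`|z'.2 - z.2| + `|F z'.1 - F z.1|).
    rewrite /t0 (_ : z.2 - F z.1 = (z'.2 - F z'.1) + ((z.2 - z'.2) + (F z'.1 - F z.1))).
      apply: le_trans (ler_normD _ _) _; rewrite lerD2l.
      by apply: le_trans (ler_normD _ _) _; rewrite (distrC z.2).
    by ring.
  by rewrite mulrDr mulr1 in rE; nra.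
have t_ge2 : t0 ^+ 2 <= 4 * (z'.2 - F z'.1) ^+ 2.
  rewrite -(real_normK (num_real (z'.2 - F z'.1))).
  have t00 : 0 <= t0 / 2 by rewrite divr_ge0 ?normr_ge0.
  have : (t0 / 2) ^+ 2 <= `|z'.2 - F z'.1| ^+ 2.
    by rewrite lerXn2r ?nnegrE ?normr_ge0.
  by rewrite exprMn exprVn; lra.
have rt : r ^+ 2 <= (z'.2 - F z'.1) ^+ 2.
  rewrite -(real_normK (num_real (z'.2 - F z'.1))) lerXn2r ?nnegrE ?normr_ge0//.
  by apply: le_trans t_ge; rewrite -rE mulrDr mulr1 mulrC lerDl.
have hx := ler_normr_sqr h1.
have t0E : (z.2 - F z.1) ^+ 2 = t0 ^+ 2 by rewrite real_normK// num_real.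
have := dist2_ge z' s FL; rewrite t0E => h.
(* The constant 6 arises as 2 + 4: the offset of z' costs twice the squared gap at z', and the
   squared gap at z is at most four times that at z'. *)
have : (s - z.1) ^+ 2 <= 2 * (s - z'.1) ^+ 2 + 2 * (z'.1 - z.1) ^+ 2.
  rewrite -subr_ge0; have := sqr_ge0 (s - z'.1 - (z'.1 - z.1)).
  by move=> /le_trans; apply; rewrite le_eqVlt; apply/orP; left; apply/eqP; ring.
rewrite -mulrA; have := sqr_ge0 (s - z'.1); nra.
Qed.

End Curve.

(** * Differentiation under the integral sign *)

Section DifferentiationUnderIntegral.
Context {R : realType}.
Local Notation mu := (@lebesgue_measure R).
Local Notation integrableT f := (mu.-integrable setT (EFin \o f)).

Lemma is_derive_Rintegral (k k' : R -> R -> R) (g : R -> R) (x d : R) : 0 < d ->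
  (forall y, `|y - x| < d -> integrableT (k y)) ->
  (forall y s : R, `|y - x| < d -> is_derive y 1 (k^~ s) (k' y s)) ->
  integrableT g -> (forall y s, `|y - x| < d -> `|k' y s| <= g s) ->
  is_derive x 1 (fun y => \int[mu]_s k y s) (\int[mu]_s k' x s).
Proof.
move=> d0 ki dk gi kg.
have itvE y : `]x - d, x + d[%classic y -> `|y - x| < d.
  by rewrite /= in_itv/= ltr_distl.
have xI : `]x - d, x + d[%classic x by rewrite /= in_itv/= ltrDl ltrBlDr ltrDl d0.
have g0 s : 0 <= g s.
  by apply: le_trans (kg x s _); rewrite ?subrr ?normr0.
have ki' y : `]x - d, x + d[%classic y -> integrableT (k y).
  by move=> /itvE; exact: ki.
have dk' y s : `]x - d, x + d[%classic y -> setT s -> derivable (k^~ s) y 1.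
  by move=> /itvE yx _; case: (dk y s yx).
have p1E y s : `|y - x| < d -> partial1of2 k y s = k' y s.
  by move=> yx; exact: is_derive1E (dk y s yx).
have kg' y s : `]x - d, x + d[%classic y -> setT s -> `|partial1of2 k y s| <= g s.
  by move=> /itvE yx _; rewrite p1E//; exact: kg.
split; first exact: (derivable_under_integral measurableT xI ki' dk' g0 gi kg').
rewrite -derive1E.
rewrite (differentiation_under_integral measurableT xI ki' dk' g0 gi kg').
by apply: eq_Rintegral => s _; rewrite p1E// subrr normr0.
Qed.

End DifferentiationUnderIntegral.

(** * Cauchy integrals along a graph and their partial derivatives *)

Section CauchyIntegral.
Context {R : realType}.
Local Notation mu := (@lebesgue_measure R).
Local Notation integrableT f := (mu.-integrable setT (EFin \o f)).
Implicit Types (p q X Y x y s t L a K : R) (n : nat) (z : plane R).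

(** Of the n + 1 factors 1 / D one is kept, to be integrated in s; each of the others is at most 1 /
    tau. *)
Lemma ckernel_sqr_dom p q n (M D tau X Y : R) : 0 < tau -> tau <= D -> 0 < M ->
  D <= M * (X ^+ 2 + Y ^+ 2) ->
  ckernel p q n.+1 X Y ^+ 2 <= (p ^+ 2 + q ^+ 2) * M ^+ n.+1 / tau ^+ n * D^-1.
Proof.
move=> tau0 tauD M0 DM; apply: (le_trans (ckernel_sqr_le _ _ _ _ _)).
have D0 : 0 < D by exact: lt_le_trans tauD.
rewrite -!mulrA ler_wpM2l ?addr_ge0 ?sqr_ge0//.
have d0 : 0 < X ^+ 2 + Y ^+ 2.
  by rewrite -(pmulr_rgt0 _ M0); exact: lt_le_trans DM.
set d := X ^+ 2 + Y ^+ 2 in DM d0 *.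
have -> : d ^- n.+1 = M ^+ n.+1 / (M * d) ^+ n.+1.
  by rewrite exprMn; field; rewrite !expf_neq0 ?gt_eqF.
rewrite ler_pM2l ?exprn_gt0// -invfM lef_pV2 ?posrE ?exprn_gt0 ?mulr_gt0 ?exprn_gt0//.
rewrite exprSr ler_pM ?exprn_ge0 ?(ltW D0) ?(ltW tau0)//.
rewrite lerXn2r ?nnegrE ?(ltW tau0)// ?(le_trans tauD)//.
by rewrite mulr_ge0 ?ltW.
Qed.

Lemma normrM_le_sqr (u v : R) : `|u * v| <= u ^+ 2 + v ^+ 2.
Proof.
rewrite normrM -(real_normK (num_real u)) -(real_normK (num_real v)).
have := sqr_ge0 (`|u| - `|v|); have := normr_ge0 u; have := normr_ge0 v.
by move=> v0 u0; rewrite sqrrB; nra.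
Qed.

(** Real part of (p - iq) times the integral of w(s) ((x - s) + i (y - F(s)))^(-n) over the line. *)
Definition cauchy_int p q n (F w : R -> R) z : R :=
  \int[mu]_s (w s * ckernel p q n (z.1 - s) (z.2 - F s)).

Context (F w : R -> R) (L : R).
Hypotheses (dF : forall x : R, derivable F x 1) (FL : lipschitz_fun L F).
Hypotheses (cw : continuous w) (wi : integrableT (fun s => w s ^+ 2)).

Lemma is_derive_ckernel_s p q n z (s : R) : off_curve F z ->
  is_derive s 1 (fun s => ckernel p q n (z.1 - s) (z.2 - F s))
    (n%:R * (ckernel p q n.+1 (z.1 - s) (z.2 - F s) +
             derive1 F s * ckernel q (- p) n.+1 (z.1 - s) (z.2 - F s))).
Proof.
move=> zF.
have hX : is_derive s 1 (fun s => z.1 - s) (-1).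
  apply: (is_derive_eq (is_derive1B (is_derive1C z.1 s) (is_derive_id s 1))).
  by rewrite sub0r.
have hY : is_derive s 1 (fun s => z.2 - F s) (- derive1 F s).
  have h := is_derive1B (is_derive1C z.2 s) (is_derive1_derive1 (@dF s)).
  by rewrite sub0r in h.
apply: (is_derive_eq (is_derive_ckernel p q n hX hY _)); last by ring.
by rewrite gt_eqF//; exact: dist2_gt0 zF.
Qed.

Lemma continuous_ckernel p q n z : off_curve F z ->
  continuous (fun s => ckernel p q n (z.1 - s) (z.2 - F s)).
Proof.
by move=> zF s; exact: is_derive1_continuous (is_derive_ckernel_s p q n s zF).
Qed.

Lemma continuous_cauchy_integrand p q n z : off_curve F z ->
  continuous (fun s => w s * ckernel p q n (z.1 - s) (z.2 - F s)).
Proof. by move=> zF s; apply: cvgM; [exact: cw|exact: continuous_ckernel]. Qed.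

Definition dom_const p q n z : R := (p ^+ 2 + q ^+ 2) *
  (6 * dist_const L) ^+ n.+1 / ((z.2 - F z.1) ^+ 2) ^+ n.

(** The majorant from |u v| <= u^2 + v^2: square integrability of w pays for the first factor, a
    Poisson type kernel for the second. *)
Definition dom_fun p q n z s : R := w s ^+ 2 +
  dom_const p q n z * ((s - z.1) ^+ 2 + (z.2 - F z.1) ^+ 2)^-1.

Lemma integrable_dom p q n z : off_curve F z -> integrableT (dom_fun p q n z).
Proof.
move=> zF; apply: integrableTD => //; apply: integrableTZ.
rewrite -(real_normK (num_real (z.2 - F z.1))).
by apply: integrable_poisson; rewrite normr_gt0 subr_eq0.
Qed.

Lemma cauchy_integrand_dom p q n z z' s : off_curve F z ->
  `|z'.1 - z.1| <= near_radius L F z -> `|z'.2 - z.2| <= near_radius L F z ->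
  `|w s * ckernel p q n.+1 (z'.1 - s) (z'.2 - F s)| <= dom_fun p q n z s.
Proof.
move=> zF h1 h2; apply: (le_trans (normrM_le_sqr _ _)); rewrite lerD2l.
apply: ckernel_sqr_dom.
- by rewrite exprn_even_gt0//= subr_eq0.
- by rewrite lerDr sqr_ge0.
- by rewrite mulr_gt0// dist_const_gt0.
- exact: dist2_ge_near FL h1 h2.
Qed.

Lemma integrable_cauchy p q n z : off_curve F z ->
  integrableT (fun s => w s * ckernel p q n.+1 (z.1 - s) (z.2 - F s)).
Proof.
move=> zF; apply: (dominated_integrable _ (integrable_dom p q n zF)).
  by apply: continuous_measurable_fun; exact: continuous_cauchy_integrand.
move=> s; apply: cauchy_integrand_dom => //; rewrite subrr normr0.
  exact/ltW/near_radius_gt0.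
exact/ltW/near_radius_gt0.
Qed.

Lemma near_off_curve z z' : off_curve F z ->
  `|z'.1 - z.1| <= near_radius L F z -> `|z'.2 - z.2| <= near_radius L F z ->
  off_curve F z'.
Proof.
move=> zF h1 h2; apply/eqP => zE.
have := dist2_ge_near z'.1 FL h1 h2.
rewrite /dist2 zE !subrr expr0n /= addr0 mulr0 leNgt => /negP; apply.
by rewrite ltr_wpDl ?sqr_ge0// exprn_even_gt0//= subr_eq0.
Qed.

Let is_derive_integrand_x p q n (y s x : R) : off_curve F (x, y) ->
  is_derive x 1 (fun x => w s * ckernel p q n (x - s) (y - F s))
    (- n%:R * (w s * ckernel p q n.+1 (x - s) (y - F s))).
Proof.
move=> zF.
have hX : is_derive x 1 (fun x => x - s) 1.
  apply: (is_derive_eq (is_derive1B (is_derive_id x 1) (is_derive1C s x))).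
  by rewrite subr0.
have d0 := dist2_gt0 s zF; rewrite /dist2 /= in d0.
apply: (is_derive_eq (is_derive1Z (w s) (is_derive_ckernel p q n hX
  (is_derive1C (y - F s) x) _))); last by ring.
by rewrite gt_eqF.
Qed.

Let is_derive_integrand_y p q n (y s x : R) : off_curve F (x, y) ->
  is_derive y 1 (fun y => w s * ckernel p q n (x - s) (y - F s))
    (- n%:R * (w s * ckernel q (- p) n.+1 (x - s) (y - F s))).
Proof.
move=> zF.
have hY : is_derive y 1 (fun y => y - F s) 1.
  apply: (is_derive_eq (is_derive1B (is_derive_id y 1) (is_derive1C (F s) y))).
  by rewrite subr0.
have d0 := dist2_gt0 s zF; rewrite /dist2 /= in d0.
apply: (is_derive_eq (is_derive1Z (w s) (is_derive_ckernel p q n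
  (is_derive1C (x - s) y) hY _))); last by ring.
by rewrite gt_eqF.
Qed.

Lemma is_derive_cauchy_x p q n (x y : R) : off_curve F (x, y) ->
  is_derive x 1 (fun x => cauchy_int p q n.+1 F w (x, y))
    (- n.+1%:R * cauchy_int p q n.+2 F w (x, y)).
Proof.
move=> zF; have r0 := near_radius_gt0 L zF.
have off x' : `|x' - x| < near_radius L F (x, y) -> off_curve F (x', y).
  by move=> x'x; apply: (near_off_curve zF) => /=; rewrite ?subrr ?normr0 ltW.
have := @is_derive_Rintegral R
  (fun x s => w s * ckernel p q n.+1 (x - s) (y - F s))
  (fun x s => - n.+1%:R * (w s * ckernel p q n.+2 (x - s) (y - F s)))
  (fun s => n.+1%:R * dom_fun p q n.+1 (x, y) s) x _ r0.
move=> h; apply: (is_derive_eq (h _ _ _ _)).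
- by move=> x' /off x'F; exact: (integrable_cauchy p q n x'F).
- by move=> x' s /off x'F; exact: is_derive_integrand_x.
- by apply: integrableTZ; exact: integrable_dom.
- move=> x' s x'x; rewrite normrM normrN normr_nat ler_wpM2l//.
  apply: (@cauchy_integrand_dom p q n.+1 (x, y) (x', y)) => //=.
    exact: ltW.
  by rewrite subrr normr0 ltW.
- by rewrite RintegralZl//; exact: integrable_cauchy zF.
Qed.

Lemma is_derive_cauchy_y p q n (x y : R) : off_curve F (x, y) ->
  is_derive y 1 (fun y => cauchy_int p q n.+1 F w (x, y))
    (- n.+1%:R * cauchy_int q (- p) n.+2 F w (x, y)).
Proof.
move=> zF; have r0 := near_radius_gt0 L zF.
have off y' : `|y' - y| < near_radius L F (x, y) -> off_curve F (x, y').
  by move=> y'y; apply: (near_off_curve zF) => /=; rewrite ?subrr ?normr0 ltW.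
have := @is_derive_Rintegral R
  (fun y s => w s * ckernel p q n.+1 (x - s) (y - F s))
  (fun y s => - n.+1%:R * (w s * ckernel q (- p) n.+2 (x - s) (y - F s)))
  (fun s => n.+1%:R * dom_fun q (- p) n.+1 (x, y) s) y _ r0.
move=> h; apply: (is_derive_eq (h _ _ _ _)).
- by move=> y' /off y'F; exact: (integrable_cauchy p q n y'F).
- by move=> y' s /off y'F; exact: is_derive_integrand_y.
- by apply: integrableTZ; exact: integrable_dom.
- move=> y' s y'y; rewrite normrM normrN normr_nat ler_wpM2l//.
  apply: (@cauchy_integrand_dom q (- p) n.+1 (x, y) (x, y')) => //=.
    by rewrite subrr normr0 ltW.
  exact: ltW.
- by rewrite RintegralZl//; exact: integrable_cauchy zF.
Qed.

End CauchyIntegral.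

(** * Mean value inequalities *)

Section MeanValue.
Context {R : realType}.
Implicit Types (f g df : R -> R) (a b : R).

(** The mean value theorem for g - f and g + f. Comparing with a function instead of a constant
    admits derivatives that are unbounded at an end point, such as (t - y')^(a - 1). *)
Lemma ler_MVT_dom f g df dg a b : a <= b ->
  {within `[a, b], continuous f} -> {within `[a, b], continuous g} ->
  (forall x : R, a < x < b -> is_derive x 1 f (df x)) ->
  (forall x : R, a < x < b -> is_derive x 1 g (dg x)) ->
  (forall x, a < x < b -> `|df x| <= dg x) ->
  `|f b - f a| <= g b - g a.
Proof.
move=> ab cf cg hf hg fg.
have key (s : R) : `|s| = 1 -> s * (f b - f a) <= g b - g a.
  move=> s1.
  have cgf : {within `[a, b], continuous (fun x => g x - s * f x)}.
    by move=> x; apply: cvgB; [exact: cg|apply: cvgM; [exact: cvg_cst|exact: cf]].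
  have [aeb|anb] := eqVneq a b; first by rewrite aeb !subrr mulr0.
  have altb : a < b by rewrite lt_neqAle anb.
  have [|d dab] := @MVT _ (fun x => g x - s * f x)
    (fun x => dg x - s * df x) a b altb _ cgf.
    move=> x; rewrite in_itv/= => xab.
    by apply: is_derive1B; [exact: hg|apply: is_derive1Z; exact: hf].
  move=> h; rewrite in_itv/= in dab.
  have : 0 <= (dg d - s * df d) * (b - a).
    rewrite mulr_ge0 ?subr_ge0//; apply: le_trans (fg _ dab).
    by apply: (le_trans (ler_norm _)); rewrite normrM s1 mul1r.
  by rewrite -h; lra.
rewrite ler_norml; apply/andP; split.
  by have := key (-1); rewrite normrN1 => /(_ erefl); lra.
by have := key 1; rewrite normr1 => /(_ erefl); lra.
Qed.

Lemma is_derive_within_continuous f df a b :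
  (forall x : R, a <= x <= b -> is_derive x 1 f (df x)) ->
  {within `[a, b], continuous f}.
Proof.
move=> h; apply: continuous_in_subspaceT => x; rewrite inE/= in_itv/= => xab.
exact: is_derive1_continuous (h x xab).
Qed.

Lemma ler_MVT f df a b (B : R) : a <= b ->
  (forall x : R, a <= x <= b -> is_derive x 1 f (df x)) ->
  (forall x, a <= x <= b -> `|df x| <= B) -> `|f b - f a| <= B * (b - a).
Proof.
move=> ab hf hB.
have hg (x : R) : is_derive x 1 (fun y => B * y) B.
  by have h := is_derive1Z B (is_derive_id x 1); rewrite mulr1 in h.
rewrite mulrBr; apply: (@ler_MVT_dom f (fun y => B * y) df (fun=> B)) => //.
- exact: is_derive_within_continuous hf.
- by apply: (@is_derive_within_continuous _ (fun=> B)) => x _.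
- by move=> x /andP[ax xb]; apply: hf; rewrite !ltW.
- by move=> x /andP[ax xb]; apply: hB; rewrite !ltW.
Qed.

Lemma ler_MVT_ball f df a b (B : R) :
  (forall x : R, `|x - a| <= `|b - a| -> is_derive x 1 f (df x)) ->
  (forall x, `|x - a| <= `|b - a| -> `|df x| <= B) ->
  `|f b - f a| <= B * `|b - a|.
Proof.
move=> hf hB; have [ab|ba] := leP a b.
  have h x : a <= x <= b -> `|x - a| <= `|b - a|.
    move=> /andP[ax xb].
    by rewrite !ger0_norm ?subr_ge0// lerD2r.
  rewrite (@ger0_norm _ (b - a)) ?subr_ge0//; apply: (ler_MVT ab) => x /h; [exact: hf|exact: hB].
have h x : b <= x <= a -> `|x - a| <= `|b - a|.
  move=> /andP[bx xa].
  by rewrite !ler0_norm ?subr_le0// ?(ltW ba)// lerN2 lerD2r.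
rewrite distrC (distrC b) [`|a - b|]gtr0_norm ?subr_gt0//.
by apply: (ler_MVT (ltW ba)) => x /h; [exact: hf|exact: hB].
Qed.

End MeanValue.

(** * Partial derivatives and function classes in the plane *)

Section PlaneCalculus.
Context {R : realType}.
Implicit Types (D : set (plane R)) (z : plane R) (G A B : plane R -> R).

(** The difference quotient along (1, 0) is that of the function of the first variable alone, so
    partial derivatives reduce to derivatives on the line. *)
Let growth_x G z : (fun h : R => h^-1 *: ((G \o shift z) (h *: ((1, 0) : plane R)) - G z)) =
  (fun h : R => h^-1 *: (((fun x : R => G (x, z.2)) \o shift z.1) (h *: (1 : R)) -
     G (z.1, z.2))).
Proof.
apply/funext => h; rewrite /= -surjective_pairing; congr (_ *: (G _ - _)).
by apply/pair_eqP; rewrite /= scaler0 add0r !eqxx.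
Qed.

Let growth_y G z : (fun h : R => h^-1 *: ((G \o shift z) (h *: ((0, 1) : plane R)) - G z)) =
  (fun h : R => h^-1 *: (((fun y : R => G (z.1, y)) \o shift z.2) (h *: (1 : R)) -
     G (z.1, z.2))).
Proof.
apply/funext => h; rewrite /= -surjective_pairing; congr (_ *: (G _ - _)).
by apply/pair_eqP; rewrite /= scaler0 add0r !eqxx.
Qed.

Lemma is_derive_dx G z (d : R) :
  is_derive z (1, 0) G d <-> is_derive z.1 1 (fun x : R => G (x, z.2)) d.
Proof.
by split=> -[h1 h2]; split; rewrite -?h2 /derivable /derive ?growth_x//;
  rewrite -?growth_x.
Qed.

Lemma is_derive_dy G z (d : R) :
  is_derive z (0, 1) G d <-> is_derive z.2 1 (fun y : R => G (z.1, y)) d.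
Proof.
by split=> -[h1 h2]; split; rewrite -?h2 /derivable /derive ?growth_y//;
  rewrite -?growth_y.
Qed.

Lemma open_near D z : open D -> D z -> \forall z' \near z, D z'.
Proof. by move=> oD Dz; exact: open_nbhs_nbhs. Qed.

Lemma is_derive_congr D G G' z v (d : R) : open D -> D z ->
  (forall z', D z' -> G z' = G' z') ->
  is_derive z v G d -> is_derive z v G' d.
Proof.
move=> oD Dz GG'; apply: near_eq_is_derive.
by apply: filterS (open_near oD Dz) => z'; exact: GG'.
Qed.

Lemma continuous_congr D G G' : open D -> (forall z, D z -> G z = G' z) ->
  {in D, continuous G} -> {in D, continuous G'}.
Proof.
move=> oD GG' cG z zD; have Dz : D z by rewrite inE in zD.
rewrite /prop_for /continuous_at -(GG' _ Dz).
apply: (cvg_trans _ (cG z zD)); apply: near_eq_cvg.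
by apply: filterS (open_near oD Dz) => z'; exact: GG'.
Qed.

Lemma partials_upto_congr D (P : (plane R -> R) -> Prop) : open D ->
  (forall G G', (forall z, D z -> G z = G' z) -> P G -> P G') ->
  forall n G G', (forall z, D z -> G z = G' z) ->
  partials_upto D P n G -> partials_upto D P n G'.
Proof.
move=> oD PP; elim=> [|n ih] G G' GG' /=.
  by move=> [PG _]; split=> //; exact: PP PG.
move=> [PG [dG dxG dyG]]; split; first exact: PP PG.
have dE v z : D z -> 'D_v G z = 'D_v G' z.
  move=> Dz; apply: near_eq_derive.
  by apply: filterS (open_near oD Dz) => z'; exact: GG'.
split.
- move=> z Dz; have [h1 h2] := dG z Dz.
  by split; [move: h1|move: h2]; apply: near_eq_derivable;
    apply: filterS (open_near oD Dz) => z'; exact: GG'.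
- by apply: ih dxG => z Dz; exact: dE.
- by apply: ih dyG => z Dz; exact: dE.
Qed.

Lemma Cn_congr D n G G' : open D -> (forall z, D z -> G z = G' z) ->
  Cn D n G -> Cn D n G'.
Proof.
by move=> oD; apply: partials_upto_congr => // ? ?; exact: continuous_congr.
Qed.

(** Allows induction on n with partial derivatives that are known by a formula on D only. *)
Lemma CnS D n G A B : open D -> {in D, continuous G} ->
  (forall z, D z -> is_derive z (1, 0) G (A z)) ->
  (forall z, D z -> is_derive z (0, 1) G (B z)) ->
  Cn D n A -> Cn D n B -> Cn D n.+1 G.
Proof.
move=> oD cG hA hB cA cB; split=> //; split.
- by move=> z Dz; split; [case: (hA z Dz)|case: (hB z Dz)].
- by apply: Cn_congr cA => // z Dz; case: (hA z Dz).
- by apply: Cn_congr cB => // z Dz; case: (hB z Dz).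
Qed.

Lemma Cn_lin D n (c d : R) G G' : open D -> Cn D n G -> Cn D n G' ->
  Cn D n (fun z => c * G z + d * G' z).
Proof.
move=> oD; elim: n G G' => [|n ih] G G'.
  move=> [cG _] [cG' _]; split=> // z zD.
  by apply: cvgD; (apply: cvgM; first exact: cvg_cst); [exact: cG|exact: cG'].
move=> hG hG'; have [cG _] := hG; have [cG' _] := hG'.
have [_ [dG dxG dyG]] := hG; have [_ [dG' dxG' dyG']] := hG'.
apply: (@CnS _ _ _ (fun z => c * dx G z + d * dx G' z)
                   (fun z => c * dy G z + d * dy G' z)) => //.
- move=> z zD.
  by apply: cvgD; (apply: cvgM; first exact: cvg_cst); [exact: cG|exact: cG'].
- move=> z Dz; have [h1 _] := dG z Dz; have [h1' _] := dG' z Dz.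
  apply/is_derive_dx; apply: is_derive1D; apply: is_derive1Z;
    apply/is_derive_dx; exact: derivableP.
- move=> z Dz; have [_ h1] := dG z Dz; have [_ h1'] := dG' z Dz.
  apply/is_derive_dy; apply: is_derive1D; apply: is_derive1Z;
    apply/is_derive_dy; exact: derivableP.
- exact: ih.
- exact: ih.
Qed.

Lemma Cn_cst D n (c : R) : open D -> Cn D n (fun=> c).
Proof.
move=> oD; elim: n c => [|n ih] c; first by split=> // z _; exact: cvg_cst.
apply: (@CnS _ _ _ (fun=> 0) (fun=> 0)) => //.
by move=> z _; exact: cvg_cst.
Qed.

Lemma Cn_snd D n : open D -> Cn D n (fun z : plane R => z.2).
Proof.
move=> oD; case: n => [|n]; first by split=> // z _; exact: cvg_snd.
apply: (@CnS _ _ _ (fun=> 0) (fun=> 1)) => //.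
- by move=> z _; exact: cvg_snd.
- by move=> z _; apply/is_derive_dx; exact: is_derive1C.
- by move=> z _; apply/is_derive_dy; exact: is_derive_id.
- exact: Cn_cst.
- exact: Cn_cst.
Qed.

Lemma unif_continuous_onP D G : unif_continuous_on D G <->
  forall e, 0 < e -> exists2 d, 0 < d &
    forall z z', D z -> D z' -> `|z - z'| < d -> `|G z - G z'| < e.
Proof.
split=> [cG e e0|h].
  have /= := cG [set xy | ball xy.1 e xy.2] _.
  have : entourage [set xy : R * R | ball xy.1 e xy.2] by rewrite -entourage_ballE; exists e.
  move=> E /(_ E)[/= W]; rewrite -entourage_ballE => -[d /= d0 dW] WE.
  exists d => // z z' Dz Dz' zz'.
  have /= := WE (z, z'); rewrite /ball/=; apply; right; split=> //; split=> //.
  by apply: dW => /=; rewrite -ball_normE.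
move=> E; rewrite -entourage_ballE => -[e /= e0 eE].
have [d d0 dG] := h e e0.
exists [set xy | ball xy.1 d xy.2]; first by rewrite -entourage_ballE; exists d.
move=> [z z'] /= [->|[Dz [Dz' zz']]].
  by apply: eE => /=; exact: ballxx.
apply: eE => /=; rewrite -ball_normE /=; apply: dG => //.
by move: zz'; rewrite -ball_normE.
Qed.

Lemma norm_nearP (V : normedModType R) (z : V) (P : set V) :
  nbhs z P <-> exists2 d : R, 0 < d & forall z' : V, `|z' - z| < d -> P z'.
Proof.
split=> [/nbhs_ballP[d /= d0 dP]|[d d0 dP]].
  by exists d => // z' zz'; apply: dP; rewrite -ball_normE /= distrC.
by apply/nbhs_ballP; exists d => //= z'; rewrite -ball_normE /= distrC; exact: dP.
Qed.

Lemma norm_plane (z : plane R) : `|z| = Num.max `|z.1| `|z.2|.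
Proof. by []. Qed.

End PlaneCalculus.

(** * Smoothness of Cauchy integrals off the curve *)

Section CauchySmooth.
Context {R : realType}.
Local Notation mu := (@lebesgue_measure R).
Local Notation integrableT f := (mu.-integrable setT (EFin \o f)).
Implicit Types (p q x y s t L a K : R) (n : nat) (z : plane R) (D : set (plane R)).

Context (F w : R -> R) (L : R).
Hypotheses (dF : forall x : R, derivable F x 1) (FL : lipschitz_fun L F).
Hypotheses (cw : continuous w) (wi : integrableT (fun s => w s ^+ 2)).

Lemma cauchy_lin p q p' q' (c d : R) n z : off_curve F z ->
  cauchy_int (c * p + d * p') (c * q + d * q') n.+1 F w z =
  c * cauchy_int p q n.+1 F w z + d * cauchy_int p' q' n.+1 F w z.
Proof.
move=> zF; rewrite /cauchy_int -!RintegralZl//; last 2 first.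
  exact: (integrable_cauchy dF FL cw wi).
  exact: (integrable_cauchy dF FL cw wi).
rewrite -RintegralD//; last 2 first.
  by apply: integrableTZ; exact: (integrable_cauchy dF FL cw wi).
  by apply: integrableTZ; exact: (integrable_cauchy dF FL cw wi).
by apply: eq_Rintegral => s _; rewrite ckernelE; ring.
Qed.

Lemma cauchyZ p q (c : R) n z : off_curve F z ->
  c * cauchy_int p q n.+1 F w z = cauchy_int (c * p) (c * q) n.+1 F w z.
Proof.
move=> zF; have := cauchy_lin p q 0 0 c 0 n zF.
by rewrite !mul0r !addr0.
Qed.

Lemma is_derive_cauchy_dx p q n z : off_curve F z ->
  is_derive z (1, 0) (cauchy_int p q n.+1 F w) (- n.+1%:R * cauchy_int p q n.+2 F w z).
Proof.
move=> zF; apply/is_derive_dx; case: z zF => x y zF /=.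
exact: (is_derive_cauchy_x dF FL cw wi).
Qed.

Lemma is_derive_cauchy_dy p q n z : off_curve F z ->
  is_derive z (0, 1) (cauchy_int p q n.+1 F w) (- n.+1%:R * cauchy_int q (- p) n.+2 F w z).
Proof.
move=> zF; apply/is_derive_dy; case: z zF => x y zF /=.
exact: (is_derive_cauchy_y dF FL cw wi).
Qed.

Let cauchy_near_bound p q n z z' : off_curve F z ->
  `|z'.1 - z.1| <= near_radius L F z -> `|z'.2 - z.2| <= near_radius L F z ->
  `|cauchy_int p q n.+1 F w z'| <= \int[mu]_s dom_fun F w L p q n z s.
Proof.
move=> zF h1 h2; apply: normr_Rintegral_le.
- apply: continuous_measurable_fun; apply: continuous_cauchy_integrand => //.
  exact: (near_off_curve FL zF).
- exact: integrable_dom.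
- by move=> s; exact: cauchy_integrand_dom.
Qed.

(** Near z both partial derivatives are bounded by the integrals of their majorants; the mean value
    inequality along a horizontal and a vertical segment then gives a local Lipschitz bound. *)
Lemma continuous_cauchy p q n z : off_curve F z ->
  {for z, continuous (cauchy_int p q n.+1 F w)}.
Proof.
move=> zF; have r0 := near_radius_gt0 L zF; set r := near_radius L F z in r0.
pose B1 := \int[mu]_s dom_fun F w L p q n.+1 z s.
pose B2 := \int[mu]_s dom_fun F w L q (- p) n.+1 z s.
pose B := n.+1%:R * (`|B1| + `|B2|).
have B0 : 0 <= B by rewrite mulr_ge0 ?addr_ge0.
have dist z' : `|z' - z| < r ->
    `|cauchy_int p q n.+1 F w z' - cauchy_int p q n.+1 F w z| <= B * (`|z'.1 - z.1| + `|z'.2 - z.2|).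
  rewrite norm_plane gt_max => /andP[/= h1 h2].
  have e1 : `|cauchy_int p q n.+1 F w (z'.1, z'.2) - cauchy_int p q n.+1 F w (z.1, z'.2)| <=
      B * `|z'.1 - z.1|.
    apply: (@ler_MVT_ball _ (fun x => cauchy_int p q n.+1 F w (x, z'.2))
      (fun x => - n.+1%:R * cauchy_int p q n.+2 F w (x, z'.2))) => x xz.
      apply: (is_derive_cauchy_x dF FL cw wi); apply: (near_off_curve FL zF) => /=.
        exact: (le_trans xz (ltW h1)).
      exact: ltW.
    rewrite normrM normrN normr_nat ler_wpM2l//.
    apply: (@le_trans _ _ B1); last by rewrite (le_trans (ler_norm _))// lerDl.
    apply: cauchy_near_bound => //=; [exact: (le_trans xz (ltW h1))|exact: ltW].
  have e2 : `|cauchy_int p q n.+1 F w (z.1, z'.2) - cauchy_int p q n.+1 F w (z.1, z.2)| <=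
      B * `|z'.2 - z.2|.
    apply: (@ler_MVT_ball _ (fun y => cauchy_int p q n.+1 F w (z.1, y))
      (fun y => - n.+1%:R * cauchy_int q (- p) n.+2 F w (z.1, y))) => y yz.
      apply: (is_derive_cauchy_y dF FL cw wi); apply: (near_off_curve FL zF) => /=.
        by rewrite subrr normr0 ltW.
      exact: (le_trans yz (ltW h2)).
    rewrite normrM normrN normr_nat ler_wpM2l//.
    apply: (@le_trans _ _ B2); last by rewrite (le_trans (ler_norm _))// lerDr.
    apply: cauchy_near_bound => //=; first by rewrite subrr normr0 ltW.
    exact: (le_trans yz (ltW h2)).
  rewrite -!surjective_pairing in e1 e2.
  rewrite mulrDr (_ : _ - _ = (cauchy_int p q n.+1 F w z' - cauchy_int p q n.+1 F w (z.1, z'.2))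
    + (cauchy_int p q n.+1 F w (z.1, z'.2) - cauchy_int p q n.+1 F w z)); last by ring.
  by apply: (le_trans (ler_normD _ _)); apply: lerD.
apply/cvgrPdist_lt => e e0.
pose d := Num.min r (e / (2 * (B + 1))).
have d0 : 0 < d.
  rewrite lt_min r0 divr_gt0// mulr_gt0// ltr_wpDl//.
apply: (norm_nearP z _).2; exists d => // z'; rewrite /d lt_min => /andP[z'r z'e].
rewrite distrC; apply: (le_lt_trans (dist _ z'r)).
move: z'e; rewrite norm_plane gt_max ltr_pdivlMr ?mulr_gt0 ?ltr_wpDl//.
rewrite ltr_pdivlMr ?mulr_gt0 ?ltr_wpDl// => /andP[/= a1 a2].
have := normr_ge0 (z'.1 - z.1); have := normr_ge0 (z'.2 - z.2).
by nra.
Qed.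

Lemma open_off_curve : open (off_curve F).
Proof.
have cF x : {for x, continuous F}.
  exact: is_derive1_continuous (is_derive1_derive1 (@dF x)).
rewrite openE => z zF; have r0 := near_radius_gt0 L zF.
apply/norm_nearP; exists (near_radius L F z) => // z'.
rewrite norm_plane gt_max => /andP[/= h1 h2].
by apply: (near_off_curve FL zF); exact: ltW.
Qed.

Lemma Cn_cauchy D m p q n : open D -> D `<=` off_curve F ->
  Cn D m (cauchy_int p q n.+1 F w).
Proof.
move=> oD DF; elim: m p q n => [|m ih] p q n.
  by split=> // z; rewrite inE => /DF; exact: continuous_cauchy.
apply: (@CnS _ _ _ _ (fun z => - n.+1%:R * cauchy_int p q n.+2 F w z)
  (fun z => - n.+1%:R * cauchy_int q (- p) n.+2 F w z)) => //.
- by move=> z; rewrite inE => /DF; exact: continuous_cauchy.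
- by move=> z /DF; exact: is_derive_cauchy_dx.
- by move=> z /DF; exact: is_derive_cauchy_dy.
- apply: (Cn_congr oD _ (ih (- n.+1%:R * p) (- n.+1%:R * q) n.+1)).
  by move=> z /DF zF; rewrite cauchyZ.
- apply: (Cn_congr oD _ (ih (- n.+1%:R * q) (- n.+1%:R * - p) n.+1)).
  by move=> z /DF zF; rewrite cauchyZ.
Qed.

End CauchySmooth.

(** * Integration by parts in Cauchy integrals *)

Section IntegrationByParts.
Context {R : realType}.
Local Notation mu := (@lebesgue_measure R).
Local Notation integrableT f := (mu.-integrable setT (EFin \o f)).
Implicit Types (p q x y s t L a K M : R) (n : nat) (z : plane R).

Lemma ckernel2_le p q X Y :
  `|ckernel p q 2 X Y| <= (`|p| + `|q|) * (X ^+ 2 + Y ^+ 2)^-1.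
Proof.
have d0 : 0 <= (X ^+ 2 + Y ^+ 2)^-1 by rewrite invr_ge0 addr_ge0 ?sqr_ge0.
rewrite -[leRHS]ger0_norm ?mulr_ge0 ?addr_ge0// -ler_sqr ?nnegrE//.
rewrite !real_normK ?num_real//; apply: (le_trans (ckernel_sqr_le _ _ _ _ _)).
rewrite exprMn exprVn ler_wpM2r ?invr_ge0 ?exprn_ge0 ?addr_ge0 ?sqr_ge0//.
rewrite sqrrD !real_normK ?num_real// -addrA lerD2l lerDr.
by rewrite mulrn_wge0// mulr_ge0.
Qed.

Context (F : R -> R) (L : R).
Hypotheses (dF : forall x : R, derivable F x 1) (FL : lipschitz_fun L F).
Hypothesis cF' : continuous (derive1 F).
Hypothesis F'L : forall x, `|derive1 F x| <= L.

Lemma dist2V_le z s : off_curve F z -> (dist2 F z s)^-1 <=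
  dist_const L * ((s - z.1) ^+ 2 + (z.2 - F z.1) ^+ 2)^-1.
Proof.
move=> zF; have d0 := dist2_gt0 s zF; have c0 := dist_const_gt0 L.
have D0 : 0 < (s - z.1) ^+ 2 + (z.2 - F z.1) ^+ 2.
  by rewrite ltr_wpDl ?sqr_ge0// exprn_even_gt0//= subr_eq0.
by rewrite ler_pdivlMr// mulrC ler_pdivrMr// dist2_ge.
Qed.

Lemma ckernel2_dom p q z s : off_curve F z ->
  `|ckernel p q 2 (z.1 - s) (z.2 - F s)| <= (`|p| + `|q|) * dist_const L *
    ((s - z.1) ^+ 2 + (z.2 - F z.1) ^+ 2)^-1.
Proof.
move=> zF; apply: (le_trans (ckernel2_le _ _ _ _)).
by rewrite -mulrA ler_wpM2l ?addr_ge0//; exact: dist2V_le.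
Qed.

Lemma integrable_D z : off_curve F z ->
  integrableT (fun s => ((s - z.1) ^+ 2 + (z.2 - F z.1) ^+ 2)^-1).
Proof.
move=> zF; rewrite -(real_normK (num_real (z.2 - F z.1))).
by apply: integrable_poisson; rewrite normr_gt0 subr_eq0.
Qed.

Lemma integrable_ckernel2 (f : R -> R) M p q z : continuous f -> (forall s, `|f s| <= M) ->
  off_curve F z -> integrableT (fun s => f s * ckernel p q 2 (z.1 - s) (z.2 - F s)).
Proof.
move=> cf fM zF.
apply: (dominated_integrable _
  (integrableTZ (M * ((`|p| + `|q|) * dist_const L)) (integrable_D zF))).
  apply: continuous_measurable_fun => s; apply: cvgM; first exact: cf.
  exact: continuous_ckernel.
move=> s; rewrite normrM -mulrA; apply: ler_pM => //.
exact: ckernel2_dom.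
Qed.

Lemma cvg_ckernel1 p q z (u : nat -> R) (f : R -> R) M : off_curve F z ->
  (forall s, `|f s| <= M) -> `|u n| @[n --> \oo] --> +oo ->
  f (u n) * ckernel p q 1 (z.1 - u n) (z.2 - F (u n)) @[n --> \oo] --> 0.
Proof.
move=> zF fM uoo; apply/cvgr0Pnorm_le => e e0.
pose c := M ^+ 2 * (p ^+ 2 + q ^+ 2) * dist_const L.
have M0 : 0 <= M by apply: le_trans (fM 0).
have c0 : 0 <= c.
  apply: mulr_ge0; last exact/ltW/dist_const_gt0.
  by apply: mulr_ge0; rewrite ?addr_ge0 ?sqr_ge0.
have h : \forall n \near \oo, `|z.1| + (c / e ^+ 2 + 1) <= `|u n|.
  by move/cvgryPge: uoo; exact.
apply: filterS h => n hn.
rewrite -ler_sqr ?nnegrE ?(ltW e0)// real_normK ?num_real// exprMn.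
have f2 : f (u n) ^+ 2 <= M ^+ 2 by exact: ler_normr_sqr.
have k2 := ckernel_sqr_le p q 1 (z.1 - u n) (z.2 - F (u n)).
have d2 := dist2V_le (u n) zF; rewrite /dist2 in d2.
set k := ckernel _ _ _ _ _ in k2 *; rewrite expr1 in k2.
set V := (_ + _)^-1 in k2; rewrite -/V in d2.
set D := (u n - z.1) ^+ 2 + _ in d2.
have Dge : c / e ^+ 2 <= D.
  have x1 : 0 <= c / e ^+ 2 by rewrite divr_ge0// sqr_ge0.
  have x2 : c / e ^+ 2 + 1 <= `|u n - z.1|.
    have := ler_normD (u n - z.1) z.1; rewrite subrK; lra.
  have x3 : (c / e ^+ 2 + 1) ^+ 2 <= (u n - z.1) ^+ 2.
    rewrite -(real_normK (num_real (u n - z.1))) ler_sqr ?nnegrE//.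
    by rewrite addr_ge0.
  have := sqr_ge0 (z.2 - F z.1); rewrite /D; move: x3; rewrite sqrrD; nra.
have Dgt : 0 < D.
  by rewrite ltr_wpDl ?sqr_ge0// exprn_even_gt0//= subr_eq0.
apply: (@le_trans _ _ (c * D^-1)).
  apply: (@le_trans _ _ (M ^+ 2 * k ^+ 2)).
    by rewrite ler_wpM2r ?sqr_ge0.
  rewrite /c -(mulrA _ (dist_const L)) -(mulrA (M ^+ 2)) ler_wpM2l ?sqr_ge0//.
  apply: (le_trans k2).
  by rewrite ler_wpM2l ?addr_ge0 ?sqr_ge0.
by rewrite ler_pdivrMr// mulrC -ler_pdivrMr// exprn_gt0.
Qed.

(* The product of a bounded f and the kernel of order one vanishes at infinity,
   so the integral of its derivative is zero. *)
Lemma cauchy_by_parts (f f' : R -> R) M p q z :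
  (forall x : R, is_derive x 1 f (f' x)) -> continuous f' ->
  (forall s, `|f s| <= M) -> integrableT (fun s => f' s ^+ 2) ->
  off_curve F z ->
  cauchy_int p q 1 F f' z =
  - \int[mu]_s (f s * (ckernel p q 2 (z.1 - s) (z.2 - F s) +
      derive1 F s * ckernel q (- p) 2 (z.1 - s) (z.2 - F s))).
Proof.
move=> df cf' fM f'i zF.
have cf : continuous f by move=> s; exact: is_derive1_continuous (df s).
have i1 := integrable_cauchy dF FL cf' f'i p q 0 zF.
have cfF' : continuous (fun s => f s * derive1 F s).
  by move=> s; apply: cvgM; [exact: cf|exact: cF'].
have M0 : 0 <= M by apply: le_trans (fM 0).
have fF'M s : `|f s * derive1 F s| <= M * L.
  by rewrite normrM ler_pM.
have i2 : integrableT (fun s => f s * (ckernel p q 2 (z.1 - s) (z.2 - F s) +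
      derive1 F s * ckernel q (- p) 2 (z.1 - s) (z.2 - F s))).
  have := integrableTD (integrable_ckernel2 p q cf fM zF)
    (integrable_ckernel2 q (- p) cfF' fF'M zF).
  by congr (mu.-integrable _ (EFin \o _)); apply/funext => s; ring.
pose g s := f' s * ckernel p q 1 (z.1 - s) (z.2 - F s) +
  f s * (ckernel p q 2 (z.1 - s) (z.2 - F s) +
      derive1 F s * ckernel q (- p) 2 (z.1 - s) (z.2 - F s)).
pose G s := f s * ckernel p q 1 (z.1 - s) (z.2 - F s).
suff gE : \int[mu]_s g s = 0 - 0.
  by apply/eqP; rewrite -addr_eq0 /cauchy_int -RintegralD// -/g gE subrr.
apply: (@Rintegral_primitive R g G 0 0).
- move=> s; apply: cvgD.
    by apply: cvgM; [exact: cf'|exact: (continuous_ckernel dF)].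
  apply: cvgM; first exact: cf.
  apply: cvgD; first exact: (continuous_ckernel dF).
  by apply: cvgM; [exact: cF'|exact: (continuous_ckernel dF)].
- exact: integrableTD.
- move=> s; have h := is_derive1M (df s)
    (is_derive_ckernel_s dF p q 1 s zF).
  by apply: (is_derive_eq h); rewrite mul1r.
- apply: cvg_ckernel1 => //; apply/cvgryPge => A; 
  apply: filterS (@nbhs_infty_ger R A) => n An.
  by rewrite ger0_norm// (le_trans An)// ler_nat.
- apply: cvg_ckernel1 => //; apply/cvgryPge => A; 
  apply: filterS (@nbhs_infty_ger R A) => n An.
  by rewrite normrN ger0_norm// (le_trans An)// ler_nat.
Qed.

(** [cauchy_by_parts] for the constant function 1: the integrand is the derivative along the curve
    of the kernel of order one. *)
Lemma ckernel2_integral0 p q z : off_curve F z ->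
  \int[mu]_s (ckernel p q 2 (z.1 - s) (z.2 - F s) +
      derive1 F s * ckernel q (- p) 2 (z.1 - s) (z.2 - F s)) = 0.
Proof.
move=> zF.
have c0 : continuous (fun _ : R => 0 : R) by move=> s; exact: cvg_cst.
have n1 (s : R) : `|(fun=> 1) s| <= 1 :> R by rewrite normr1.
have i0 : integrableT (fun=> 0 ^+ 2).
  have := @integrable0 _ _ R mu setT; congr (mu.-integrable setT _).
  by apply/funext => s; rewrite /= expr0n.
have h := cauchy_by_parts p q (is_derive1C 1) c0 n1 i0 zF.
have h0 : cauchy_int p q 1 F (fun=> 0) z = 0.
  rewrite /cauchy_int; under eq_Rintegral do rewrite mul0r.
  by rewrite Rintegral_cst// mul0r.
rewrite h0 in h; apply/eqP; rewrite -oppr_eq0 [X in _ == X]h; apply/eqP; congr (- _).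
by apply: eq_Rintegral => s _; rewrite mul1r.
Qed.

End IntegrationByParts.

(** * Hölder and Lipschitz functions *)

Section HolderFunctions.
Context {R : realType}.
Implicit Types (a K L M : R) (F w : R -> R).

Lemma holder_continuous a K w : 0 < a -> holder_fun a K w -> continuous w.
Proof.
move=> a0 wK x; apply/cvgrPdist_le => e e0.
have := @continuous_powR_norm R a (ltW a0) 0.
rewrite /continuous_at normr0 powR0 ?gt_eqF// => /cvgrPdist_lt.
pose K1 := `|K| + 1; have K10 : 0 < K1 by rewrite ltr_wpDl.
have eK : 0 < e / K1 by rewrite divr_gt0.
move=> /(_ _ eK) /norm_nearP[d d0 dP].
apply: (norm_nearP x _).2; exists d => // y xy.
have := dP (x - y); rewrite subr0 distrC => /(_ xy).
rewrite sub0r normrN ger0_norm ?powR_ge0// ltr_pdivlMr// => h.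
rewrite distrC in h *.
apply: (le_trans (wK _ _)); apply: le_trans (ltW h); rewrite mulrC.
by rewrite ler_wpM2l ?powR_ge0// (le_trans (ler_norm _))// lerDl.
Qed.

Lemma derive_bounded_lipschitz F L : (forall x : R, derivable F x 1) ->
  (forall x, `|derive1 F x| <= L) -> lipschitz_fun L F.
Proof.
move=> dF FL x y; rewrite -normrN opprB distrC.
apply: (@ler_MVT_ball _ F (derive1 F)) => // z _.
exact: is_derive1_derive1.
Qed.

End HolderFunctions.

(** * Growth of the gradient of a Cauchy integral at the curve *)

Section HardyLittlewood.
Context {R : realType}.
Local Notation mu := (@lebesgue_measure R).
Local Notation integrableT f := (mu.-integrable setT (EFin \o f)).
Implicit Types (p q x y s t : R) (z : plane R).

Context (a : R) (F w : R -> R) (L K M : R).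
Hypothesis a01 : 0 < a < 1.
Hypotheses (dF : forall x : R, derivable F x 1)
  (F'L : forall x, `|derive1 F x| <= L) (F'K : holder_fun a K (derive1 F)).
Hypotheses (wM : forall x, `|w x| <= M) (wK : holder_fun a K w)
  (wi : integrableT (fun s => w s ^+ 2)).

Let a0 : 0 < a. Proof. by case/andP: a01. Qed.
Let FL : lipschitz_fun L F. Proof. exact: derive_bounded_lipschitz. Qed.
Let cF' : continuous (derive1 F). Proof. exact: holder_continuous F'K. Qed.
Let cw : continuous w. Proof. exact: holder_continuous wK. Qed.
Let M0 : 0 <= M. Proof. by apply: le_trans (wM 0). Qed.
Let L0 : 0 <= L. Proof. by apply: le_trans (F'L 0). Qed.
Let K0 : 0 <= K.
Proof. by have := wK 1 0; rewrite subr0 normr1 powR1 mulr1; exact: le_trans. Qed.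

(** The first K bounds the increment of w, the term 2 M K the increment of F' multiplied by w and by
    a kernel with parameters of twice the size. *)
Definition hl_bound p q : R :=
  (K + 2 * M * K) * (`|p| + `|q|) * dist_const L * hl_const a.

Lemma hl_bound_ge0 p q : 0 <= hl_bound p q.
Proof.
rewrite /hl_bound; apply: mulr_ge0; last exact: hl_const_ge0.
apply: mulr_ge0; last exact/ltW/dist_const_gt0.
by rewrite mulr_ge0 ?addr_ge0 ?mulr_ge0.
Qed.

(* With b = F'(x), the kernel is ck p' q' + b ck q' (-p') for the parameters
   p' and q' below; replacing b by F'(s) gives an exact derivative. *)
Lemma cauchy2_le p q z : off_curve F z ->
  `|cauchy_int p q 2 F w z| <= hl_bound p q * `|z.2 - F z.1| `^ (a - 1).
Proof.
move=> zF; pose b := derive1 F z.1; pose w0 := w z.1.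
pose p' := (p - b * q) / (1 + b ^+ 2); pose q' := (q + b * p) / (1 + b ^+ 2).
have b0 : 0 < 1 + b ^+ 2 by rewrite ltr_pwDl// sqr_ge0.
pose k p q s := ckernel p q 2 (z.1 - s) (z.2 - F s).
have kE s : k p q s = k p' q' s + b * k q' (- p') s.
  by rewrite /k /ckernel /p' /q'; field; rewrite gt_eqF.
have b1 : `|b| / (1 + b ^+ 2) <= 1.
  rewrite ler_pdivrMr// mul1r; have := sqr_ge0 (1 - `|b|).
  by rewrite sqrrB expr1n mul1r real_normK ?num_real//; have := normr_ge0 b; lra.
have bi1 : (1 + b ^+ 2)^-1 <= 1 by rewrite invf_le1// lerDl sqr_ge0.
have pq' : `|q'| + `|- p'| <= 2 * (`|p| + `|q|).
  rewrite normrN /p' /q' !normrM (ger0_norm (x := (1 + b ^+ 2)^-1)) ?invr_ge0 ?(ltW b0)//.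
  have h1 : `|q + b * p| / (1 + b ^+ 2) <= `|q| + `|p|.
    apply: (@le_trans _ _ ((`|q| + `|b| * `|p|) / (1 + b ^+ 2))).
      rewrite ler_wpM2r ?invr_ge0 ?(ltW b0)//.
      by rewrite (le_trans (ler_normD _ _))// normrM.
    rewrite mulrDl; apply: lerD; first by rewrite ler_piMr.
    by rewrite mulrAC ler_piMl.
  have h2 : `|p - b * q| / (1 + b ^+ 2) <= `|p| + `|q|.
    apply: (@le_trans _ _ ((`|p| + `|b| * `|q|) / (1 + b ^+ 2))).
      rewrite ler_wpM2r ?invr_ge0 ?(ltW b0)//.
      by rewrite (le_trans (ler_normB _ _))// normrM.
    rewrite mulrDl; apply: lerD; first by rewrite ler_piMr.
    by rewrite mulrAC ler_piMl.
  by lra.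
have i1 := integrable_cauchy dF FL cw wi p q 1 zF.
have i2 : integrableT (fun s => k p' q' s + derive1 F s * k q' (- p') s).
  apply: integrableTD.
    have c1 : continuous (fun _ : R => 1 : R) by move=> s; exact: cvg_cst.
    have n1 (s : R) : `|(fun=> 1) s| <= 1 :> R by rewrite normr1.
    have := integrable_ckernel2 dF FL p' q' c1 n1 zF.
    by congr (mu.-integrable _ (EFin \o _)); apply/funext => s; rewrite mul1r.
  exact: (integrable_ckernel2 dF FL q' (- p') cF' F'L zF).
rewrite (_ : cauchy_int _ _ _ _ _ _ =
  \int[mu]_s (w s * k p q s - w0 * (k p' q' s + derive1 F s * k q' (- p') s))); last first.
  rewrite RintegralB//; last exact: integrableTZ.
  rewrite RintegralZl//.
  by rewrite (ckernel2_integral0 dF FL cF' F'L p' q' zF) mulr0 subr0.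
have t0 : 0 < `|z.2 - F z.1| by rewrite normr_gt0 subr_eq0.
have a01' : 0 <= a < 1 by case/andP: a01 => /ltW -> ->.
have gi := integrable_hl z.1 a01' t0.
pose C := (K + 2 * M * K) * (`|p| + `|q|) * dist_const L.
apply: (@le_trans _ _ (\int[mu]_s (C *
  (`|s - z.1| `^ a / ((s - z.1) ^+ 2 + `|z.2 - F z.1| ^+ 2))))); last first.
  by rewrite RintegralZl// Rintegral_hl// /hl_bound -/C; lra.
apply: normr_Rintegral_le; [|exact: integrableTZ|].
  apply: continuous_measurable_fun => s; apply: cvgB.
    exact: (continuous_cauchy_integrand dF cw).
  apply: cvgM; first exact: cvg_cst.
  apply: cvgD; first exact: (continuous_ckernel dF).
  by apply: cvgM; [exact: cF'|exact: (continuous_ckernel dF)].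
move=> s; rewrite real_normK ?num_real//.
(* Both terms now contain an increment, of w or of F', which supplies the factor |s - x|^a. *)
rewrite (_ : _ - _ = (w s - w0) * k p q s - w0 * ((derive1 F s - b) * k q' (- p') s));
  last by rewrite kE; ring.
apply: (le_trans (ler_normB _ _)); rewrite !normrM.
have S0 : 0 <= `|s - z.1| `^ a by exact: powR_ge0.
set S := `|s - z.1| `^ a in S0 *.
set D := ((s - z.1) ^+ 2 + (z.2 - F z.1) ^+ 2)^-1.
have D0 : 0 <= D by rewrite invr_ge0 addr_ge0 ?sqr_ge0.
have k1 : `|k p q s| <= (`|p| + `|q|) * dist_const L * D by exact: ckernel2_dom.
have k2 : `|k q' (- p') s| <= 2 * (`|p| + `|q|) * dist_const L * D.
  apply: (le_trans (ckernel2_dom FL _ _ _ zF)); rewrite -/D.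
  by rewrite ler_wpM2r// ler_wpM2r// ltW// dist_const_gt0.
have e1 : `|w s - w0| <= K * S by exact: wK.
have e2 : `|derive1 F s - b| <= K * S by exact: F'K.
have e3 : `|w0| <= M by exact: wM.
have l1 := ler_pM (normr_ge0 _) (normr_ge0 _) e1 k1.
have l2 := ler_pM (normr_ge0 _) (normr_ge0 _) e2 k2.
have l3 := ler_pM (normr_ge0 _) (mulr_ge0 (normr_ge0 _) (normr_ge0 _)) e3 l2.
by apply: (le_trans (lerD l1 l3)); rewrite /C le_eqVlt; apply/orP; left; apply/eqP; ring.
Qed.

End HardyLittlewood.

(** * Hölder continuity up to the curve, from above *)

Section HolderUpToTheCurve.
Context {R : realType}.
Local Notation mu := (@lebesgue_measure R).
Local Notation integrableT f := (mu.-integrable setT (EFin \o f)).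
Implicit Types (p q x y s t : R) (z : plane R).

Lemma powR_antitone (e x y : R) : e <= 0 -> 0 < x -> x <= y -> y `^ e <= x `^ e.
Proof.
move=> e0 x0 xy; have y0 : 0 < y by exact: lt_le_trans xy.
rewrite -(opprK e) !(powRN _ (- e)) lef_pV2 ?posrE ?powR_gt0//.
by apply: ge0_ler_powR; rewrite ?oppr_ge0 ?nnegrE ?(ltW x0) ?(ltW y0).
Qed.

Context (a : R) (F w : R -> R) (L K M : R).
Hypothesis a01 : 0 < a < 1.
Hypotheses (dF : forall x : R, derivable F x 1)
  (F'L : forall x, `|derive1 F x| <= L) (F'K : holder_fun a K (derive1 F)).
Hypotheses (wM : forall x, `|w x| <= M) (wK : holder_fun a K w)
  (wi : integrableT (fun s => w s ^+ 2)).

Let a0 : 0 < a. Proof. by case/andP: a01. Qed.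
Let FL : lipschitz_fun L F. Proof. exact: derive_bounded_lipschitz. Qed.
Let cF' : continuous (derive1 F). Proof. exact: holder_continuous F'K. Qed.
Let cw : continuous w. Proof. exact: holder_continuous wK. Qed.
Let L0 : 0 <= L. Proof. by apply: le_trans (F'L 0). Qed.
Let Cst p q := hl_bound a L K M p q.
Let Cst0 p q : 0 <= Cst p q. Proof. exact: (@hl_bound_ge0 R a w L K M wM wK). Qed.
Let CstN p q : Cst q (- p) = Cst p q.
Proof. by rewrite /Cst /hl_bound normrN (addrC `|q|). Qed.

Let above_off z : above F z -> off_curve F z.
Proof. by rewrite /above /off_curve /= => h; rewrite gt_eqF. Qed.

Let a1_le0 : a - 1 <= 0.
Proof. by case/andP: a01 => _ /ltW; rewrite subr_le0. Qed.

(** At height t the gradient is bounded by C (t - y')^(a - 1), an integrable function of t with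
    primitive (C / a) (t - y')^a. *)
Lemma cauchy1_vertical p q x y y' : F x < y' -> y' <= y ->
  `|cauchy_int p q 1 F w (x, y) - cauchy_int p q 1 F w (x, y')| <=
  Cst p q / a * `|y - y'| `^ a.
Proof.
move=> Fy' y'y.
pose g (t : R) := Cst p q / a * `|t - y'| `^ a.
have -> : Cst p q / a * `|y - y'| `^ a = g y - g y'.
  by rewrite /g subrr normr0 powR0 ?gt_eqF// mulr0 subr0.
pose f t := cauchy_int p q 1 F w (x, t).
pose df t := - 1%:R * cauchy_int q (- p) 2 F w (x, t).
pose dg t := Cst p q * (t - y') `^ (a - 1).
rewrite -[cauchy_int _ _ _ _ _ (x, y)]/(f y) -[cauchy_int _ _ _ _ _ (x, y')]/(f y').
apply: (@ler_MVT_dom R f g df dg y' y y'y).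
- apply: is_derive_within_continuous => t /andP[y't _].
  apply: (is_derive_cauchy_y dF FL cw wi); apply: above_off => /=.
  exact: lt_le_trans y't.
- apply: continuous_subspaceT => t; apply: cvgM; first exact: cvg_cst.
  have h : {for t - y', continuous (fun s : R => `|s| `^ a)}.
    exact: (continuous_powR_norm (ltW a0)).
  by apply: (continuous_cvg _ h); apply: cvgB; [exact: cvg_id|exact: cvg_cst].
- move=> t /andP[y't _]; apply: (is_derive_cauchy_y dF FL cw wi).
  by apply: above_off => /=; exact: lt_trans y't.
- move=> t /andP[y't _].
  have ty : 0 < t - y' by rewrite subr_gt0.
  have dt : is_derive t 1 (fun s : R => s - y') 1.
    apply: (is_derive_eq (is_derive1B (is_derive_id t 1) (is_derive1C y' t))).
    by rewrite subr0.
  have h : is_derive t 1 ((fun s : R => s `^ a) \o (fun s : R => s - y'))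
      (a * (t - y') `^ (a - 1) * 1).
    by apply: is_derive1_comp; exact: is_derive1_powR.
  have h2 := is_derive1Z (Cst p q / a) h.
  have h3 : is_derive t 1 g (Cst p q / a * (a * (t - y') `^ (a - 1) * 1)).
    apply: near_eq_is_derive h2; apply: (norm_nearP t _).2.
    exists (t - y') => // s; rewrite /g ltr_norml => /andP[h1 _].
    by rewrite /= gtr0_norm//; lra.
  by apply: (is_derive_eq h3); rewrite /dg; field; rewrite gt_eqF.
- move=> t /andP[y't _].
  have ty : 0 < t - y' by rewrite subr_gt0.
  have zt : above F (x, t) by rewrite /above /=; exact: lt_trans y't.
  rewrite /df mulN1r normrN.
  apply: (le_trans (cauchy2_le a01 dF F'L F'K wM wK wi _ _ (above_off zt))).
  rewrite -/(Cst q (- p)) CstN ler_wpM2l// powR_antitone//=.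
  by rewrite (le_trans _ (ler_norm _))// lerB// ltW.
Qed.

Lemma cauchy1_horizontal p q x x' y (rho : R) : 0 < rho ->
  (forall s, `|s - x| <= `|x' - x| -> F s + rho <= y) ->
  `|cauchy_int p q 1 F w (x', y) - cauchy_int p q 1 F w (x, y)| <=
  Cst p q * rho `^ (a - 1) * `|x' - x|.
Proof.
move=> r0 Fy.
have ab s : `|s - x| <= `|x' - x| -> above F (s, y).
  by move=> /Fy h; rewrite /above /=; apply: lt_le_trans h; rewrite ltrDl.
pose f s := cauchy_int p q 1 F w (s, y).
pose df s := - 1%:R * cauchy_int p q 2 F w (s, y).
rewrite -[cauchy_int _ _ _ _ _ (x', y)]/(f x') -[cauchy_int _ _ _ _ _ (x, y)]/(f x).
apply: (@ler_MVT_ball R f df) => s sx.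
  by apply: (is_derive_cauchy_x dF FL cw wi); apply: above_off; exact: ab.
rewrite /df mulN1r normrN.
apply: (le_trans (cauchy2_le a01 dF F'L F'K wM wK wi _ _ (above_off (ab _ sx)))).
rewrite -/(Cst p q) ler_wpM2l// powR_antitone//=.
by rewrite (le_trans _ (ler_norm _))// lerBrDl Fy.
Qed.

(** The summand 1 belongs to the horizontal segment, the other one to the two vertical segments,
    whose lengths are at most L + 2 times the distance of the points. *)
Definition holder_const p q : R := Cst p q * (1 + 2 * (L + 2) `^ a / a).

(* Go up by (L + 1) rho, where rho is the distance of the points, then
   horizontally at height at least rho above the curve, and down again. *)
Lemma cauchy1_holder_above p q z z' : above F z -> above F z' ->
  `|cauchy_int p q 1 F w z - cauchy_int p q 1 F w z'| <=
  holder_const p q * `|z - z'| `^ a.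
Proof.
move=> zF z'F; set rho := `|z - z'|.
have [r0|r0] := eqVneq rho 0.
  move: (r0) => /normr0_eq0/eqP; rewrite subr_eq0 => /eqP ->.
  by rewrite subrr normr0 mulr_ge0 ?powR_ge0// mulr_ge0// addr_ge0// divr_ge0
    ?mulr_ge0 ?powR_ge0// ltW.
have rp : 0 < rho by rewrite lt_neqAle eq_sym r0 normr_ge0.
have h1 : `|z.1 - z'.1| <= rho by rewrite /rho norm_plane le_max lexx.
have h2 : `|z.2 - z'.2| <= rho by rewrite /rho norm_plane le_max lexx orbT.
set u := cauchy_int p q 1 F w.
pose Y := z.2 + (L + 1) * rho.
have Lr : 0 <= L * rho by rewrite mulr_ge0// ltW.
have Yz : z.2 <= Y by rewrite /Y; nra.
have Yz' : z'.2 <= Y by move: h2; rewrite ler_norml /Y => /andP[]; nra.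
have e1 : `|u (z.1, Y) - u (z.1, z.2)| <= Cst p q / a * `|Y - z.2| `^ a.
  exact: cauchy1_vertical.
have e3 : `|u (z'.1, Y) - u (z'.1, z'.2)| <= Cst p q / a * `|Y - z'.2| `^ a.
  exact: cauchy1_vertical.
have e2 : `|u (z'.1, Y) - u (z.1, Y)| <= Cst p q * rho `^ (a - 1) * `|z'.1 - z.1|.
  apply: cauchy1_horizontal => // s sx.
  have := FL s z.1; rewrite ler_norml => /andP[_].
  have : `|s - z.1| <= rho by rewrite (le_trans sx)// distrC.
  move=> /(ler_wpM2l L0); move: zF; rewrite /above /Y /=; lra.
have p1 : `|Y - z.2| `^ a <= (L + 2) `^ a * rho `^ a.
  rewrite -powRM ?(ltW rp) ?addr_ge0//; apply: ge0_ler_powR.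
  - exact: ltW.
  - by rewrite nnegrE.
  - by rewrite nnegrE mulr_ge0 ?(ltW rp) ?addr_ge0.
  - by rewrite ger0_norm ?subr_ge0// /Y; nra.
have p3 : `|Y - z'.2| `^ a <= (L + 2) `^ a * rho `^ a.
  rewrite -powRM ?(ltW rp) ?addr_ge0//; apply: ge0_ler_powR.
  - exact: ltW.
  - by rewrite nnegrE.
  - by rewrite nnegrE mulr_ge0 ?(ltW rp) ?addr_ge0.
  - rewrite ger0_norm ?subr_ge0// /Y; move: h2; rewrite ler_norml => /andP[_]; nra.
have p2 : rho `^ (a - 1) * `|z'.1 - z.1| <= rho `^ a.
  apply: (@le_trans _ _ (rho `^ (a - 1) * rho)).
    by rewrite ler_wpM2l ?powR_ge0// distrC.
  by rewrite mulrC mulr_powRB1 ?(ltW rp)//.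
have Ca : 0 <= Cst p q / a by rewrite divr_ge0// ltW.
have q1 := le_trans e1 (ler_wpM2l Ca p1).
have q3 := le_trans e3 (ler_wpM2l Ca p3).
have q2 : `|u (z'.1, Y) - u (z.1, Y)| <= Cst p q * rho `^ a.
  by apply: (le_trans e2); rewrite -mulrA ler_wpM2l.
rewrite -!surjective_pairing in q1 q3.
have -> : u z - u z' = - (u (z.1, Y) - u z) - (u (z'.1, Y) - u (z.1, Y)) +
   (u (z'.1, Y) - u z') by ring.
apply: (le_trans (ler_normD _ _)); apply: (le_trans (lerD (ler_normB _ _) (lexx _))).
rewrite normrN; apply: (le_trans (lerD (lerD q1 q2) q3)).
by rewrite /holder_const le_eqVlt; apply/orP; left; apply/eqP; ring.
Qed.

End HolderUpToTheCurve.

(** * Reflection in the horizontal axis *)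

Section Reflection.
Context {R : realType}.
Local Notation mu := (@lebesgue_measure R).
Implicit Types (p q X Y : R) (n : nat) (F w : R -> R) (z : plane R).

Lemma inv_pow_mirror n X Y :
  inv_pow n X (- Y) = ((inv_pow n X Y).1, - (inv_pow n X Y).2).
Proof.
elim: n => [|n ih] /=; first by rewrite oppr0.
by rewrite ih /= sqrrN; congr pair; ring.
Qed.

Lemma ckernel_mirror p q n X Y : ckernel p q n X (- Y) = ckernel p (- q) n X Y.
Proof. by rewrite /ckernel inv_pow_mirror /=; ring. Qed.

Definition mirror z : plane R := (z.1, - z.2).

(** Reflection is complex conjugation of Z. It transfers estimates above a curve to estimates below
    one. *)
Lemma cauchy_int_mirror p q n F w z :
  cauchy_int p q n F w z = cauchy_int p (- q) n (fun x => - F x) w (mirror z).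
Proof.
rewrite /cauchy_int; apply: eq_Rintegral => s _; rewrite /mirror /=.
have -> : - z.2 - - F s = - (z.2 - F s) by ring.
by rewrite ckernel_mirror opprK.
Qed.

Lemma norm_mirror z : `|mirror z| = `|z|.
Proof. by rewrite !norm_plane /mirror /= normrN. Qed.

Lemma mirrorB z z' : `|mirror z - mirror z'| = `|z - z'|.
Proof.
rewrite !norm_plane /mirror /=.
have -> : - z.2 - - z'.2 = - (z.2 - z'.2) by ring.
by rewrite normrN.
Qed.

End Reflection.

(** * Regular curves and admissible densities *)

Section RegularCurves.
Context {R : realType}.
Local Notation mu := (@lebesgue_measure R).
Local Notation integrableT f := (mu.-integrable setT (EFin \o f)).
Implicit Types (a p q : R) (F w : R -> R) (z : plane R).

(** The regularity which graphs of functions in H^r have for a = r - 3/2. *)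
Definition regular_curve a F : Prop :=
  [/\ forall x : R, derivable F x 1, exists L, forall x, `|derive1 F x| <= L &
      exists K, holder_fun a K (derive1 F)].

(** Boundedness and the Hölder condition govern the behaviour at the curve, square integrability
    governs convergence and decay at infinity. *)
Definition density a w : Prop :=
  [/\ exists M, forall x, `|w x| <= M, exists K, holder_fun a K w &
      integrableT (fun s => w s ^+ 2)].

Lemma regular_curveN a F : regular_curve a F -> regular_curve a (fun x => - F x).
Proof.
move=> [dF [L F'L] [K F'K]].
have dE x : derive1 (fun x => - F x) x = - derive1 F x.
  by apply: is_derive1E; apply: is_derive1N; exact: is_derive1_derive1.
split.
- by move=> x; case: (is_derive1N (is_derive1_derive1 (dF x))).
- by exists L => x; rewrite dE normrN.
- by exists K => x y; rewrite !dE -opprD normrN.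
Qed.

Lemma holder_funW a K K' F : K <= K' -> holder_fun a K F -> holder_fun a K' F.
Proof.
move=> KK' FK x y; apply: (le_trans (FK x y)).
by rewrite ler_wpM2r// powR_ge0.
Qed.

Lemma regular_curve_lipschitz a F : regular_curve a F -> exists L, lipschitz_fun L F.
Proof. by move=> [dF [L F'L] _]; exists L; exact: derive_bounded_lipschitz. Qed.

Lemma density_continuous a w : 0 < a -> density a w -> continuous w.
Proof. by move=> a0 [_ [K wK] _]; exact: holder_continuous wK. Qed.

Lemma regular_curve_continuous a F : regular_curve a F -> continuous F.
Proof.
by move=> [dF _ _] x; exact: is_derive1_continuous (is_derive1_derive1 (dF x)).
Qed.

Lemma cauchy_holder_above a F w p q : 0 < a < 1 -> regular_curve a F ->
  density a w -> exists2 C, 0 <= C & forall z z', above F z -> above F z' ->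
  `|cauchy_int p q 1 F w z - cauchy_int p q 1 F w z'| <= C * `|z - z'| `^ a.
Proof.
move=> a01 [dF [L F'L] [K F'K]] [[M wM] [K' wK'] wi].
have F'K1 : holder_fun a (Num.max K K') (derive1 F).
  by apply: holder_funW F'K; rewrite le_max lexx.
have wK1 : holder_fun a (Num.max K K') w.
  by apply: holder_funW wK'; rewrite le_max lexx orbT.
exists (Num.max 0 (holder_const a L (Num.max K K') M p q)).
  by rewrite le_max lexx.
move=> z z' zF z'F.
apply: (le_trans (cauchy1_holder_above a01 dF F'L F'K1 wM wK1 wi p q zF z'F)).
by rewrite ler_wpM2r ?powR_ge0// le_max lexx orbT.
Qed.

Lemma above_mirror F z : above (fun x => - F x) (mirror z) = below F z.
Proof. by rewrite /above /below /mirror /= ltrN2. Qed.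

Lemma cauchy_holder_below a F w p q : 0 < a < 1 -> regular_curve a F ->
  density a w -> exists2 C, 0 <= C & forall z z', below F z -> below F z' ->
  `|cauchy_int p q 1 F w z - cauchy_int p q 1 F w z'| <= C * `|z - z'| `^ a.
Proof.
move=> a01 /regular_curveN rF dw.
have [C C0 CP] := cauchy_holder_above p (- q) a01 rF dw.
exists C => // z z' zF z'F; rewrite !(cauchy_int_mirror p q) -mirrorB.
by apply: CP; rewrite above_mirror.
Qed.

(** The inequality |w k| <= l w^2 + k^2 / l for any l > 0; a large l makes the second term small at
    the expense of the first. *)
Lemma cauchy_far F L w p q (l : R) z : 0 < l ->
  (forall x : R, derivable F x 1) -> lipschitz_fun L F -> continuous w ->
  integrableT (fun s => w s ^+ 2) -> off_curve F z ->
  forall s, `|w s * ckernel p q 1 (z.1 - s) (z.2 - F s)| <=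
    l * w s ^+ 2 + l^-1 * ((p ^+ 2 + q ^+ 2) * dist_const L) *
      ((s - z.1) ^+ 2 + (z.2 - F z.1) ^+ 2)^-1.
Proof.
move=> l0 dF FL cw wi zF s.
have k2 := ckernel_sqr_le p q 1 (z.1 - s) (z.2 - F s).
have d2 := dist2V_le FL s zF; rewrite /dist2 in d2; rewrite expr1 in k2.
set k := ckernel _ _ _ _ _ in k2 *; set D := (_ + (z.2 - F z.1) ^+ 2)^-1 in d2 *.
have k3 : k ^+ 2 <= (p ^+ 2 + q ^+ 2) * dist_const L * D.
  by apply: (le_trans k2); rewrite -mulrA ler_wpM2l ?addr_ge0 ?sqr_ge0.
have : `|w s * k| <= l * w s ^+ 2 + l^-1 * k ^+ 2.
  rewrite normrM -(real_normK (num_real (w s))) -(real_normK (num_real k)).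
  have x0 := normr_ge0 (w s); have y0 := normr_ge0 k.
  set x := `|w s| in x0 *; set y := `|k| in y0 *.
  have : 0 <= l^-1 * (l * x - y) ^+ 2.
    by rewrite mulr_ge0 ?sqr_ge0// invr_ge0 ltW.
  have -> : l^-1 * (l * x - y) ^+ 2 = l * x ^+ 2 - 2 * (x * y) + l^-1 * y ^+ 2.
    by field; rewrite gt_eqF.
  have : 0 <= x * y by rewrite mulr_ge0.
  lra.
move=> /le_trans; apply; rewrite lerD2l -(mulrA l^-1); apply: ler_wpM2l => //.
by rewrite invr_ge0 ltW.
Qed.

End RegularCurves.

(** * Boundedness and decay of Cauchy integrals *)

Section CauchyAtInfinity.
Context {R : realType}.
Local Notation mu := (@lebesgue_measure R).
Local Notation integrableT f := (mu.-integrable setT (EFin \o f)).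
Implicit Types (a p q : R) (F w : R -> R) (z : plane R).

Let shift_above F z (t : R) : 0 <= t -> above F z -> above F (z.1, z.2 + t).
Proof. by rewrite /above /= => t0 /lt_le_trans; apply; rewrite lerDl. Qed.

Lemma above_off_curve F z : above F z -> off_curve F z.
Proof. by rewrite /above /off_curve /= => h; rewrite gt_eqF. Qed.

Lemma below_off_curve F z : below F z -> off_curve F z.
Proof. by rewrite /below /off_curve /= => h; rewrite lt_eqF. Qed.

Let norm_up z (t : R) : 0 <= t -> `|(z.1, z.2 + t) - z| = t.
Proof.
move=> t0; rewrite norm_plane /= subrr normr0 addrC addKr ger0_norm//.
exact/max_idPr.
Qed.

(** At vertical gap at least 1 the majorant of [cauchy_far] has a uniformly bounded integral. Any
    point is compared with the one a unit higher by the Hölder estimate. *)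
Lemma cauchy_bounded_above a F w p q : 0 < a < 1 -> regular_curve a F ->
  density a w -> exists B, forall z, above F z -> `|cauchy_int p q 1 F w z| <= B.
Proof.
move=> a01 rF dw; have [C C0 CP] := cauchy_holder_above p q a01 rF dw.
have [L FL] := regular_curve_lipschitz rF.
have pq0 : 0 <= (p ^+ 2 + q ^+ 2) * dist_const L.
  apply: mulr_ge0; first by rewrite addr_ge0 ?sqr_ge0.
  exact/ltW/dist_const_gt0.
have [dF _ _] := rF; have [_ _ wi] := dw.
have a0 : 0 < a by case/andP: a01.
have cw := density_continuous a0 dw.
pose c := 1^-1 * ((p ^+ 2 + q ^+ 2) * dist_const L).
have c0 : 0 <= c by rewrite /c invr1 mul1r.
pose B := 1 * \int[mu]_s (w s ^+ 2) + c * hl_const 0.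
have far z : off_curve F z -> 1 <= `|z.2 - F z.1| -> `|cauchy_int p q 1 F w z| <= B.
  move=> zF t1; have t0 : 0 < `|z.2 - F z.1| by exact: lt_le_trans t1.
  have Di := integrable_poisson z.1 t0.
  apply: (@le_trans _ _ (\int[mu]_s (1 * w s ^+ 2 +
      c * ((s - z.1) ^+ 2 + `|z.2 - F z.1| ^+ 2)^-1))).
    apply: normr_Rintegral_le.
    - apply: continuous_measurable_fun.
      exact: (continuous_cauchy_integrand dF cw).
    - by apply: integrableTD; apply: integrableTZ.
    - move=> s; rewrite real_normK ?num_real//.
      exact: (cauchy_far _ _ ltr01 dF FL cw wi zF).
  rewrite RintegralD//; [|exact: integrableTZ|exact: integrableTZ].
  rewrite !RintegralZl// lerD2l ler_wpM2l// Rintegral_poisson//.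
  by rewrite ler_piMl ?hl_const_ge0// invf_le1.
exists (B + C) => z zF.
have zF1 := shift_above ler01 zF.
have := CP _ _ zF1 zF; rewrite norm_up// powR1 mulr1 => h.
have /far : off_curve F (z.1, z.2 + 1) by exact: above_off_curve.
rewrite /= => /(_ _)/wrap[].
  rewrite (le_trans _ (ler_norm _))//; move: zF; rewrite /above /=; lra.
set u1 := cauchy_int _ _ _ _ _ _ in h *; move=> h1.
set u := cauchy_int _ _ _ _ _ _ in h *.
have -> : u = u1 - (u1 - u) by ring.
by apply: (le_trans (ler_normB _ _)); exact: lerD.
Qed.

(** Raising the point by a small d changes the integral little, by Hölder continuity, and keeps it
    off the curve. Then the integral is split: over |s| <= N the kernel is small when the point is
    far away; over |s| > N the density has a small square integral, and [cauchy_far] applies. *)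
Lemma cauchy_vanishes_above a F w p q : 0 < a < 1 -> regular_curve a F ->
  density a w -> forall e, 0 < e ->
  exists r, forall z, above F z -> r < `|z| -> `|cauchy_int p q 1 F w z| < e.
Proof.
move=> a01 rF dw e e0; have [C C0 CP] := cauchy_holder_above p q a01 rF dw.
have [L FL] := regular_curve_lipschitz rF.
have pq0 : 0 <= (p ^+ 2 + q ^+ 2) * dist_const L.
  apply: mulr_ge0; first by rewrite addr_ge0 ?sqr_ge0.
  exact/ltW/dist_const_gt0.
have [dF _ _] := rF; have [[M wM] _ wi] := dw.
have a0 : 0 < a by case/andP: a01.
have cw := density_continuous a0 dw.
have cF := regular_curve_continuous rF.
have M0 : 0 <= M by apply: le_trans (wM 0).
have e4 : 0 < e / 4 by rewrite divr_gt0.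
(* Chosen such that C d^a, the cost of raising the point, is at most e / 4. *)
pose d := (e / 4 / (C + 1)) `^ a^-1.
have d0 : 0 < d by rewrite powR_gt0// divr_gt0// ltr_wpDl.
have dC : C * d `^ a <= e / 4.
  rewrite -powRrM mulVf ?gt_eqF// powRr1; last by rewrite divr_ge0 ?ltW ?ltr_wpDl.
  by rewrite mulrA ler_pdivrMr ?ltr_wpDl// mulrC ler_pM2l// lerDl.
have cc0 : 0 <= (p ^+ 2 + q ^+ 2) * dist_const L * (d^-1 * hl_const 0).
  by apply: mulr_ge0 => //; rewrite mulr_ge0 ?hl_const_ge0 ?invr_ge0 ?(ltW d0).
set cc := _ * _ * (_ * _) in cc0.
(* Chosen such that the Poisson part of [cauchy_far], at vertical gap at least d, integrates to at
   most e / 4. *)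
pose l := (cc + 1) / (e / 4).
have l0 : 0 < l by rewrite divr_gt0// ltr_wpDl.
have lcc : l^-1 * cc <= e / 4.
  rewrite /l invf_div mulrAC ler_pdivrMr ?ltr_wpDl// ler_pM2l//.
  by rewrite lerDl.
(* A continuous substitute for l w^2 on |s| > n + 1: the factor 2 s^2 / (s^2 + (n + 1)^2) is at
   least 1 there, and it tends to 0 pointwise. *)
pose tail (n : nat) s := 2 * l * (w s ^+ 2 * (s ^+ 2 / (s ^+ 2 + n.+1%:R ^+ 2))).
have den0 (n : nat) (s : R) : 0 < s ^+ 2 + n.+1%:R ^+ 2.
  by rewrite ltr_wpDl ?sqr_ge0// exprn_gt0.
have frac01 (n : nat) (s : R) : 0 <= s ^+ 2 / (s ^+ 2 + n.+1%:R ^+ 2) <= 1.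
  rewrite divr_ge0 ?sqr_ge0 ?(ltW (den0 _ _))//=.
  by rewrite ler_pdivrMr// mul1r lerDl sqr_ge0.
have tail_ge0 n s : 0 <= tail n s.
  have /andP[f0 _] := frac01 n s.
  apply: mulr_ge0; first by apply: mulr_ge0 => //; exact: ltW.
  by apply: mulr_ge0 => //; exact: sqr_ge0.
have ctail n : continuous (tail n).
  move=> s; apply: cvgM; first exact: cvg_cst.
  apply: cvgM; first by apply: (continuous_cvg _ (@exprn_continuous R 2 (w s))); exact: cw.
  apply: cvgM; first exact: exprn_continuous.
  apply: cvgV; first by rewrite gt_eqF.
  by apply: cvgD; [exact: exprn_continuous|exact: cvg_cst].
have tail_le n s : `|tail n s| <= 2 * l * w s ^+ 2.
  have /andP[f0 f1] := frac01 n s.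
  rewrite ger0_norm//.
  rewrite /tail; apply: ler_wpM2l; first by rewrite mulr_ge0 ?(ltW l0).
  by rewrite ler_piMr ?sqr_ge0.
have taili n : integrableT (tail n).
  apply: (dominated_integrable _ (integrableTZ (2 * l) wi)) => //.
  exact: continuous_measurable_fun.
have : \int[mu]_s tail n s @[n --> \oo] --> \int[mu]_s (fun=> 0) s.
  apply: (dominated_cvg_Rintegral _ _ (integrableTZ (2 * l) wi)) => //.
    by move=> n; exact: continuous_measurable_fun.
  move=> s; apply/cvgr0Pnorm_le => eps eps0.
  pose A := 2 * l * w s ^+ 2 * s ^+ 2.
  apply: filterS (@nbhs_infty_ger R (A / eps)) => n An.
  have /andP[f0 f1] := frac01 n s.
  rewrite ger0_norm//.
  have -> : tail n s = A / (s ^+ 2 + n.+1%:R ^+ 2) by rewrite /tail /A; ring.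
  rewrite ler_pdivrMr// mulrC -ler_pdivrMr//.
  apply: (le_trans An); apply: (@le_trans _ _ (n.+1%:R ^+ 2)); last by rewrite lerDr sqr_ge0.
  apply: (@le_trans _ _ n.+1%:R); first by rewrite ler_nat.
  by rewrite expr2 ler_peMl// ler1n.
rewrite Rintegral_cst// mul0r => /cvgr0Pnorm_lt/(_ _ e4)[n0 _ /(_ n0 (leqnn _)) htail].
set N := n0.+1%:R : R.
pose core := M * (1 + N ^+ 2) * hl_const 0.
have core0 : 0 <= core by rewrite !mulr_ge0 ?addr_ge0 ?sqr_ge0 ?hl_const_ge0.
pose r0 := `|p| + `|q| + 1; have r00 : 0 < r0 by rewrite ltr_wpDl ?addr_ge0.
pose eta := e / 4 / (core + 1).
have eta0 : 0 < eta by rewrite divr_gt0// ltr_wpDl.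
(* Bounds both coordinates of the points of the curve over |s| <= N, so a point of norm B + r0 / eta
   has distance at least r0 / eta from them. *)
pose B := N + `|F 0| + `|L| * N.
have N0 : 0 <= N by [].
exists (d + B + r0 / eta) => z0 zF0 rz.
pose z := (z0.1, z0.2 + d) : plane R.
have zF : above F z by apply: shift_above => //; exact: ltW.
have offz := above_off_curve zF.
have zbig : B + r0 / eta <= `|z|.
  have := ler_normB z (z - z0); rewrite opprB addrC subrK norm_up ?(ltW d0)//.
  by move: rz; lra.
have td : d <= `|z.2 - F z.1|.
  by rewrite (le_trans _ (ler_norm _))//; move: zF0; rewrite /above /=; lra.
have t0 : 0 < `|z.2 - F z.1| by exact: lt_le_trans td.
have near0 s : `|s| <= N -> `|ckernel p q 1 (z.1 - s) (z.2 - F s)| <= eta.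
  move=> sN.
  have FsN : `|F s| <= `|F 0| + `|L| * N.
    have : `|F s - F 0| <= `|L| * N.
      apply: (le_trans (FL _ _)); rewrite subr0.
      apply: (@le_trans _ _ (`|L| * `|s|)); first by rewrite ler_wpM2r// ler_norm.
      by rewrite ler_wpM2l.
    have := ler_normD (F s - F 0) (F 0); rewrite subrK; lra.
  have dbig : (r0 / eta) ^+ 2 <= (z.1 - s) ^+ 2 + (z.2 - F s) ^+ 2.
    have LN : 0 <= `|L| * N by rewrite mulr_ge0.
    have F00 := normr_ge0 (F 0).
    have re : 0 <= r0 / eta by rewrite divr_ge0 ?ltW.
    move: zbig; rewrite norm_plane le_max => /orP[h|h].
      have : r0 / eta <= `|z.1 - s|.
        have := ler_normD (z.1 - s) s; rewrite subrK; rewrite /B in h; lra.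
      rewrite -ler_sqr ?nnegrE// real_normK ?num_real// => h2.
      by rewrite (le_trans h2)// lerDl sqr_ge0.
    have : r0 / eta <= `|z.2 - F s|.
      have := ler_normD (z.2 - F s) (F s); rewrite subrK; rewrite /B in h; lra.
    rewrite -ler_sqr ?nnegrE// real_normK ?num_real// => h2.
    by rewrite (le_trans h2)// lerDr sqr_ge0.
  rewrite -ler_sqr ?nnegrE ?(ltW eta0)// real_normK ?num_real//.
  apply: (le_trans (ckernel_sqr_le _ _ _ _ _)); rewrite expr1.
  have r2 : p ^+ 2 + q ^+ 2 <= r0 ^+ 2.
    rewrite /r0 -(real_normK (num_real p)) -(real_normK (num_real q)).
    by have := normr_ge0 p; have := normr_ge0 q; nra.
  have dpos : 0 < (z.1 - s) ^+ 2 + (z.2 - F s) ^+ 2 by exact: dist2_gt0.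
  rewrite ler_pdivrMr//; apply: (le_trans r2).
  have -> : r0 ^+ 2 = eta ^+ 2 * (r0 / eta) ^+ 2 by field; rewrite gt_eqF.
  by rewrite ler_wpM2l ?sqr_ge0.
(* An integrable function that is at least M eta for |s| <= N. *)
pose g1 s := M * eta * (1 + N ^+ 2) * (`|s| `^ 0 / (1 + s ^+ 2)).
pose g3 s := l^-1 * ((p ^+ 2 + q ^+ 2) * dist_const L) *
   ((s - z.1) ^+ 2 + `|z.2 - F z.1| ^+ 2)^-1.
have a00 : 0 <= (0 : R) < 1 by rewrite lexx ltr01.
have g1i : integrableT g1 by apply: integrableTZ; exact: integrable_hl_kernel.
have g3i : integrableT g3 by apply: integrableTZ; exact: integrable_poisson.
have g13i : integrableT (fun s => g1 s + g3 s) by exact: integrableTD.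
have main : `|cauchy_int p q 1 F w z| <= \int[mu]_s ((g1 s + g3 s) + tail n0 s).
  apply: normr_Rintegral_le.
  - apply: continuous_measurable_fun.
    exact: (continuous_cauchy_integrand dF cw).
  - exact: integrableTD.
  - move=> s.
    have q1 : 0 < 1 + s ^+ 2 by rewrite ltr_pwDl ?sqr_ge0.
    have g10 : 0 <= g1 s.
      rewrite /g1 powRr0 mul1r; apply: mulr_ge0; last by rewrite invr_ge0 ltW.
      apply: mulr_ge0; first by rewrite mulr_ge0 ?(ltW eta0).
      by rewrite addr_ge0 ?sqr_ge0.
    have g30 : 0 <= g3 s.
      rewrite /g3; apply: mulr_ge0; last by rewrite invr_ge0 addr_ge0 ?sqr_ge0.
      by apply: mulr_ge0 => //; rewrite invr_ge0 ltW.
    have /andP[f0 f1] := frac01 n0 s.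
    have tail0 := tail_ge0 n0 s.
    have [sN|Ns] := leP `|s| N.
      apply: (@le_trans _ _ (g1 s)); last by rewrite -addrA lerDl addr_ge0.
      rewrite normrM; apply: (@le_trans _ _ (M * eta)); first by apply: ler_pM => //; exact: near0.
      rewrite /g1 powRr0 mul1r -(mulrA (M * eta)).
      apply: ler_peMr; first by rewrite mulr_ge0 ?(ltW eta0).
      rewrite ler_pdivlMr// mul1r lerD2l -(real_normK (num_real s)).
      by rewrite ler_sqr ?nnegrE.
    apply: (@le_trans _ _ (tail n0 s + g3 s)); last by move: g10; lra.
    have := cauchy_far p q l0 dF FL cw wi offz s.
    rewrite -(real_normK (num_real (z.2 - F z.1))) => /le_trans; apply.
    rewrite /g3 lerD2r /tail -/N.
    rewrite [leRHS](_ : _ = l * w s ^+ 2 * (2 * s ^+ 2 / (s ^+ 2 + N ^+ 2))); last by ring.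
    apply: ler_peMr; first by rewrite mulr_ge0 ?sqr_ge0 ?(ltW l0).
    rewrite ler_pdivlMr ?den0// mul1r.
    have : N ^+ 2 <= s ^+ 2.
      by rewrite -(real_normK (num_real s)) ler_sqr ?nnegrE ?(ltW Ns).
    lra.
have := CP _ _ zF zF0; rewrite -/z norm_up ?(ltW d0)// => hC.
have hC2 := le_trans hC dC.
move: main; rewrite RintegralD// RintegralD// => main.
have I1 : \int[mu]_s g1 s <= e / 4.
  rewrite RintegralZl//; last exact: integrable_hl_kernel.
  rewrite -/(hl_const 0) (_ : _ * hl_const 0 = eta * core); last by rewrite /core; ring.
  by rewrite /eta mulrAC ler_pdivrMr ?ltr_wpDl// ler_pM2l// lerDl.
have I3 : \int[mu]_s g3 s <= e / 4.
  rewrite RintegralZl//; last exact: integrable_poisson.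
  rewrite Rintegral_poisson//; apply: le_trans lcc; rewrite -mulrA.
  rewrite ler_wpM2l ?invr_ge0 ?(ltW l0)// /cc ler_wpM2l//.
  by rewrite ler_wpM2r ?hl_const_ge0// lef_pV2.
have I2 : \int[mu]_s tail n0 s < e / 4 by apply: le_lt_trans htail; exact: ler_norm.
set u1 := cauchy_int _ _ _ _ _ _ in hC2 main *.
set u := cauchy_int _ _ _ _ _ _ in hC2 *.
have : `|u| <= `|u1| + `|u1 - u|.
  by rewrite -{1}[u](subKr u1); exact: ler_normB.
by move: main hC2 I1 I2 I3; lra.
Qed.

End CauchyAtInfinity.

(** * The jump across a straight line *)

Section Jump.
Context {R : realType}.
Local Notation mu := (@lebesgue_measure R).
Local Notation integrableT f := (mu.-integrable setT (EFin \o f)).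
Implicit Types (a p q x y s t X Y : R) (z : plane R).

Lemma ckernel1E p q X Y : ckernel p q 1 X Y = (p * X - q * Y) / (X ^+ 2 + Y ^+ 2).
Proof. by rewrite /ckernel /=; ring. Qed.

Lemma ckernel1_scale p q t X Y : t != 0 ->
  t * ckernel p q 1 (t * X) (t * Y) = ckernel p q 1 X Y.
Proof.
move=> t0; rewrite !ckernel1E.
have -> : (t * X) ^+ 2 + (t * Y) ^+ 2 = t ^+ 2 * (X ^+ 2 + Y ^+ 2) by ring.
have [->|] := eqVneq (X ^+ 2 + Y ^+ 2) 0; first by rewrite !(mulr0, invr0).
by move: (X ^+ 2 + Y ^+ 2) => d d0; field; rewrite d0 t0.
Qed.

(* 1 / (X + iY1) - 1 / (X + iY2) = i (Y2 - Y1) / ((X + iY1) (X + iY2)). *)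
Lemma ckernel1B_le p q X Y1 Y2 : 0 < X ^+ 2 + Y1 ^+ 2 -> 0 < X ^+ 2 + Y2 ^+ 2 ->
  `|ckernel p q 1 X Y1 - ckernel p q 1 X Y2| <= `|Y2 - Y1| / 2 * (`|p| + `|q|) *
    ((X ^+ 2 + Y1 ^+ 2)^-1 + (X ^+ 2 + Y2 ^+ 2)^-1).
Proof.
set d1 := X ^+ 2 + Y1 ^+ 2; set d2 := X ^+ 2 + Y2 ^+ 2 => d10 d20.
pose U := X ^+ 2 - Y1 * Y2; pose V := X * (Y1 + Y2).
have -> : ckernel p q 1 X Y1 - ckernel p q 1 X Y2 =
    (Y2 - Y1) * (q * U + p * V) / (d1 * d2).
  rewrite !ckernel1E /U /V /d1 /d2; field.
  by rewrite -/d1 -/d2 !gt_eqF.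
have hU : `|U| <= (d1 + d2) / 2.
  rewrite /U /d1 /d2 ler_norml; apply/andP; split.
    have := sqr_ge0 (Y1 - Y2); have := sqr_ge0 X; rewrite sqrrB; lra.
  have := sqr_ge0 (Y1 + Y2); have := sqr_ge0 X; rewrite sqrrD; lra.
have hV : `|V| <= (d1 + d2) / 2.
  rewrite /V /d1 /d2 ler_norml; apply/andP; split.
    have := sqr_ge0 (X + Y1); have := sqr_ge0 (X + Y2); rewrite !sqrrD; lra.
  have := sqr_ge0 (X - Y1); have := sqr_ge0 (X - Y2); rewrite !sqrrB; lra.
rewrite !normrM (gtr0_norm (x := (d1 * d2)^-1)) ?invr_gt0 ?mulr_gt0//.
have -> : d1^-1 + d2^-1 = (d1 + d2) / (d1 * d2) by field; rewrite !gt_eqF.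
rewrite [leRHS]mulrA ler_wpM2r ?invr_ge0 ?mulr_ge0 ?(ltW d10) ?(ltW d20)//.
have -> : `|Y2 - Y1| / 2 * (`|p| + `|q|) * (d1 + d2) =
  `|Y2 - Y1| * (`|q| * ((d1 + d2) / 2) + `|p| * ((d1 + d2) / 2)) by field.
rewrite ler_wpM2l//; apply: (le_trans (ler_normD _ _)); rewrite (normrM q) (normrM p).
by apply: lerD; apply: ler_wpM2l.
Qed.

(** Difference of the kernels at the points one unit above and below the origin, for the line of
    slope a through the origin: the blow-up limit of the jump across a curve. *)
Definition jump_kernel p q a s : R :=
  ckernel p q 1 (- s) (1 - a * s) - ckernel p q 1 (- s) (- 1 - a * s).

Let Qm a s : R := s ^+ 2 + (1 - a * s) ^+ 2.
Let Qp a s : R := s ^+ 2 + (1 + a * s) ^+ 2.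

Let Qm_gt0 a s : 0 < Qm a s.
Proof.
have [->|s0] := eqVneq s 0.
  by rewrite /Qm mulr0 subr0 expr1n expr0n add0r.
by rewrite ltr_pwDl ?sqr_ge0// exprn_even_gt0.
Qed.

Let Qp_gt0 a s : 0 < Qp a s.
Proof.
have [->|s0] := eqVneq s 0.
  by rewrite /Qp mulr0 addr0 expr1n expr0n add0r.
by rewrite ltr_pwDl ?sqr_ge0// exprn_even_gt0.
Qed.

Let dist_lb L X d : `|d| <= L * `|X| -> forall e : R, e ^+ 2 = 1 ->
  1 + X ^+ 2 <= dist_const L * (X ^+ 2 + (e - d) ^+ 2).
Proof.
move=> /ler_normr_sqr; rewrite exprMn real_normK ?num_real// => h e e1.
have h2 : 1 <= 2 * (e - d) ^+ 2 + 2 * d ^+ 2.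
  have : 2 * (e - d) ^+ 2 + 2 * d ^+ 2 - e ^+ 2 = (e - d - d) ^+ 2 by ring.
  by have := sqr_ge0 (e - d - d); rewrite e1; lra.
have : 0 <= L ^+ 2 * (e - d) ^+ 2 by rewrite mulr_ge0 ?sqr_ge0.
have := sqr_ge0 X; rewrite /dist_const; set A := X ^+ 2 in h *.
set B := (e - d) ^+ 2 in h2 *; set D := L ^+ 2 in h *; set C := d ^+ 2 in h h2.
by move=> A0 DB; nra.
Qed.

(** The number d may be a s as well as a difference quotient of F, so that one majorant fits the
    limit and the other the rescaled integrands. The difference of the kernels gains one order of
    decay, hence integrability. *)
Lemma jump_dom p q L s (d : R) : `|d| <= L * `|s| ->
  `|ckernel p q 1 (- s) (1 - d) - ckernel p q 1 (- s) (- 1 - d)| <=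
  2 * (`|p| + `|q|) * dist_const L * (1 + s ^+ 2)^-1.
Proof.
move=> dL.
have dc0 := dist_const_gt0 L.
have q0 : 0 < 1 + s ^+ 2 by rewrite ltr_pwDl ?sqr_ge0.
have h1 := dist_lb dL (expr1n _ 2); have h2 := dist_lb dL (sqrr_sign R 1).
rewrite expr1 in h2.
set d1 := s ^+ 2 + (1 - d) ^+ 2 in h1; set d2 := s ^+ 2 + (- 1 - d) ^+ 2 in h2.
have d10 : 0 < d1 by rewrite -(pmulr_rgt0 _ dc0) (lt_le_trans q0).
have d20 : 0 < d2 by rewrite -(pmulr_rgt0 _ dc0) (lt_le_trans q0).
have := @ckernel1B_le p q (- s) (1 - d) (- 1 - d).
rewrite sqrrN -/d1 -/d2 => /(_ d10 d20) /le_trans; apply.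
have -> : - 1 - d - (1 - d) = - 2 by ring.
rewrite normrN normr_nat divff// mul1r.
have v1 : d1^-1 <= dist_const L / (1 + s ^+ 2).
  by rewrite ler_pdivlMr// mulrC ler_pdivrMr.
have v2 : d2^-1 <= dist_const L / (1 + s ^+ 2).
  by rewrite ler_pdivlMr// mulrC ler_pdivrMr.
have -> : 2 * (`|p| + `|q|) * dist_const L * (1 + s ^+ 2)^-1 =
  (`|p| + `|q|) * (dist_const L / (1 + s ^+ 2) + dist_const L / (1 + s ^+ 2)) by ring.
by rewrite ler_wpM2l ?addr_ge0// lerD.
Qed.

Lemma integrable_inv_1sqr : integrableT (fun s : R => (1 + s ^+ 2)^-1).
Proof.
have := @integrable_poisson R 0 1 ltr01.
by congr (mu.-integrable _ (EFin \o _)); apply/funext => s; rewrite subr0 expr1n addrC.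
Qed.

Let continuous_jump_kernel p q a : continuous (jump_kernel p q a).
Proof.
move=> s; rewrite /jump_kernel.
have dX (u : R) : is_derive u 1 (fun r : R => - r) (- 1).
  by apply: is_derive1N; exact: is_derive_id.
have dY (c u : R) : is_derive u 1 (fun r : R => c - a * r) (- a).
  apply: (is_derive_eq (is_derive1B (is_derive1C c u)
    (is_derive1Z a (is_derive_id u 1)))).
  by rewrite mulr1 sub0r.
apply: cvgB.
  apply: is_derive1_continuous (is_derive_ckernel p q 1 (dX s) (dY 1 s) _).
  by rewrite sqrrN gt_eqF//; exact: Qm_gt0.
apply: is_derive1_continuous (is_derive_ckernel p q 1 (dX s) (dY (- 1) s) _).
by rewrite sqrrN -opprD [(- _) ^+ 2]sqrrN gt_eqF//; exact: Qp_gt0.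
Qed.

Lemma integrable_jump_kernel p q a : integrableT (jump_kernel p q a).
Proof.
apply: (dominated_integrable _ (integrableTZ
  (2 * (`|p| + `|q|) * dist_const `|a|) integrable_inv_1sqr)).
  by apply: continuous_measurable_fun; exact: continuous_jump_kernel.
by move=> s; apply: jump_dom; rewrite normrM.
Qed.

Let cvg_affine_oo (c d : R) : 0 < c -> (fun n : nat => c * n.+1%:R + d) @ \oo --> +oo.
Proof.
move=> c0; apply/cvgryPge => A.
apply: filterS (@nbhs_infty_ger R ((A - d) / c)) => n.
rewrite ler_pdivrMr// => h.
have : n%:R * c <= c * n.+1%:R by rewrite mulrC ler_pM2l// ler_nat.
lra.
Qed.

(** ln (1 + x) <= x bounds the difference above by 4 |a| / |u n|. Changing the sign of a exchanges
    [Qp] and [Qm], which gives the lower bound. *)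
Let cvg_ratio a (u : nat -> R) :
  (forall n, `|u n| = n.+1%:R) -> 
  ln (Qp a (u n)) - ln (Qm a (u n)) @[n --> \oo] --> 0.
Proof.
move=> un.
have key b s : s != 0 -> ln (Qp b s) - ln (Qm b s) <= 4 * `|b| / `|s|.
  move=> s0; rewrite -ln_div ?posrE//.
  have q0 := Qm_gt0 b s; have p0 := Qp_gt0 b s.
  apply: (@le_trans _ _ (Qp b s / Qm b s - 1)).
    have := @le_ln1Dx R (Qp b s / Qm b s - 1).
    rewrite addrCA subrr addr0; apply.
    by rewrite ltrBrDl addrN divr_gt0.
  have -> : Qp b s / Qm b s - 1 = 4 * (b * s) / Qm b s.
    by rewrite /Qp /Qm; field; rewrite -/(Qm b s) gt_eqF.
  rewrite ler_pdivrMr//.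
  apply: (@le_trans _ _ (4 * `|b| / `|s| * s ^+ 2)).
    have -> : 4 * `|b| / `|s| * s ^+ 2 = 4 * (`|b| * `|s|).
      by rewrite -(real_normK (num_real s)); field; rewrite normr_eq0.
    by rewrite ler_wpM2l// -normrM ler_norm.
  by rewrite ler_wpM2l ?divr_ge0 ?mulr_ge0// /Qm lerDl sqr_ge0.
have keyN b s : Qm b s = Qp (- b) s by rewrite /Qm /Qp mulNr.
have keyN' b s : Qp b s = Qm (- b) s by rewrite /Qm /Qp mulNr opprK.
apply/cvgr0Pnorm_le => eps eps0.
apply: filterS (@nbhs_infty_ger R (4 * `|a| / eps)) => n hn.
have un0 : u n != 0 by rewrite -normr_eq0 un.
have bound : 4 * `|a| / `|u n| <= eps.
  rewrite un ler_pdivrMr// [leRHS]mulrC -ler_pdivrMr// (le_trans hn)//.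
  by rewrite ler_nat.
rewrite ler_norml; apply/andP; split; last exact: le_trans (key _ _ un0) bound.
have := key (- a) (u n) un0; rewrite -keyN -keyN' normrN; lra.
Qed.

Lemma jump_kernel_integral p q a :
  \int[mu]_s jump_kernel p q a s = - (2 * pi) * (q + p * a) / (1 + a ^+ 2).
Proof.
have c0 : 0 < 1 + a ^+ 2 by rewrite ltr_pwDl ?sqr_ge0.
set c := 1 + a ^+ 2 in c0 *.
(* The primitive: the arctangents contribute the value of the integral, the logarithms cancel at
   both ends. *)
pose A s := atan (c * s - a) + atan (c * s + a).
pose B s := (ln (Qp a s) - ln (Qm a s)) / 2.
pose G s := (- (q + p * a) * A s + (p - q * a) * B s) / c.
have dlin (e s : R) : is_derive s 1 (fun r : R => c * r + e) c.
  apply: (is_derive_eq (is_derive1D (is_derive1Z c (is_derive_id s 1)) (is_derive1C e s))).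
  by rewrite mulr1 addr0.
have dat (e s : R) : is_derive s 1 (fun r : R => atan (c * r + e))
    ((1 + (c * s + e) ^+ 2)^-1 * c).
  exact: (@is_derive1_comp R atan (fun r : R => c * r + e) s _ _
    (is_derive1_atan (c * s + e)) (dlin e s)).
have dA (s : R) : is_derive s 1 A ((Qm a s)^-1 + (Qp a s)^-1).
  apply: (is_derive_eq (is_derive1D (dat (- a) s) (dat a s))); congr (_ + _).
    have -> : 1 + (c * s - a) ^+ 2 = c * Qm a s by rewrite /c /Qm; ring.
    by field; rewrite !gt_eqF.
  have -> : 1 + (c * s + a) ^+ 2 = c * Qp a s by rewrite /c /Qp; ring.
  by field; rewrite !gt_eqF.
have dQ (b s : R) : is_derive s 1 (fun r : R => r ^+ 2 + (1 + b * r) ^+ 2)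
    (2 * ((1 + b ^+ 2) * s + b)).
  have h1 := is_derive1M (is_derive_id s 1) (is_derive_id s 1).
  have h2 := is_derive1D (is_derive1C 1 s) (is_derive1Z b (is_derive_id s 1)).
  apply: (is_derive_eq (is_derive1D h1 (is_derive1M h2 h2))).
  by rewrite /=; ring.
have dB (s : R) : is_derive s 1 B ((c * s + a) / Qp a s - (c * s - a) / Qm a s).
  have h1 := @is_derive1_comp R (@ln R) (Qp a) s _ _ (is_derive1_ln (Qp_gt0 a s)) (dQ a s).
  have QmE r : Qm a r = r ^+ 2 + (1 + - a * r) ^+ 2 by rewrite /Qm mulNr.
  have dQm : is_derive s 1 (Qm a) (2 * ((1 + (- a) ^+ 2) * s - a)).
    have -> : Qm a = (fun r => r ^+ 2 + (1 + - a * r) ^+ 2) by apply/funext.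
    exact: dQ.
  have h2 := @is_derive1_comp R (@ln R) (Qm a) s _ _ (is_derive1_ln (Qm_gt0 a s)) dQm.
  have h3 := is_derive1M (is_derive1B h1 h2) (is_derive1C 2^-1 s).
  apply: (is_derive_eq h3).
  by rewrite sqrrN -/c mulr0 addr0; field; rewrite !gt_eqF.
have dG (s : R) : is_derive s 1 G (jump_kernel p q a s).
  have h := is_derive1M (is_derive1D (is_derive1Z (- (q + p * a)) (dA s))
    (is_derive1Z (p - q * a) (dB s))) (is_derive1C c^-1 s).
  apply: (is_derive_eq h).
  rewrite /jump_kernel !ckernel1E !sqrrN -/(Qm a s).
  have -> : s ^+ 2 + (- 1 - a * s) ^+ 2 = Qp a s by rewrite /Qp; ring.
  rewrite mulr0 addr0 /c /Qm /Qp; field.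
  by rewrite -/(Qm a s) -/(Qp a s) -/c !gt_eqF.
have at_oo (e : R) : atan (c * n.+1%:R + e) @[n --> \oo] --> (pi / 2 : R).
  apply: (cvg_comp _ _ (cvg_affine_oo e c0) (@cvgy_atan R)).
have at_noo (e : R) : atan (c * - n.+1%:R + e) @[n --> \oo] --> (- (pi / 2) : R).
  rewrite [X in X @ _](_ : _ = (fun n => - atan (c * n.+1%:R + - e))).
    by apply: cvgN; exact: at_oo.
  by apply/funext => n; rewrite -atanN; congr atan; ring.
have limB (u : nat -> R) : (forall n, `|u n| = n.+1%:R) -> B (u n) @[n --> \oo] --> 0.
  move=> un; rewrite -[0](mul0r 2^-1); apply: cvgM; last exact: cvg_cst.
  exact: cvg_ratio.
have G2 : G n.+1%:R @[n --> \oo] --> (- (q + p * a) * (pi / 2 + pi / 2) + (p - q * a) * 0) / c.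
  apply: cvgM; last exact: cvg_cst.
  apply: cvgD; apply: cvgM; try exact: cvg_cst.
    by apply: cvgD; exact: at_oo.
  by apply: limB => n; rewrite normr_nat.
have G1 : G (- n.+1%:R) @[n --> \oo] -->
    (- (q + p * a) * (- (pi / 2) - pi / 2) + (p - q * a) * 0) / c.
  apply: cvgM; last exact: cvg_cst.
  apply: cvgD; apply: cvgM; try exact: cvg_cst.
    by apply: cvgD; exact: at_noo.
  by apply: limB => n; rewrite normrN normr_nat.
rewrite (Rintegral_primitive (@continuous_jump_kernel p q a)
  (@integrable_jump_kernel p q a) dG G2 G1).
by field; rewrite gt_eqF.
Qed.

End Jump.

(** * The Plemelj formula *)

Section CauchyJump.
Context {R : realType}.
Local Notation mu := (@lebesgue_measure R).
Local Notation integrableT f := (mu.-integrable setT (EFin \o f)).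
Implicit Types (a p q x y s t X Y : R) (z : plane R).

Lemma cvg_invS : (n.+1%:R : R)^-1 @[n --> \oo] --> (0 : R).
Proof. exact: cvg_harmonic. Qed.

Lemma cvg_difference_quotient (F : R -> R) x s (t : nat -> R) :
  derivable F x 1 -> (forall n, t n != 0) -> t n @[n --> \oo] --> (0 : R) ->
  (F (x + t n * s) - F x) / t n @[n --> \oo] --> derive1 F x * s.
Proof.
move=> dF t0 tn.
have [->|s0] := eqVneq s 0.
  rewrite mulr0; apply: cvg_near_cst; apply: nearW => n.
  by rewrite mulr0 addr0 subrr mul0r.
have : (fun h : R => h^-1 *: (F (h + x) - F x)) @ 0^' --> derive1 F x.
  have /cvg_ex[/= l] := dF; under eq_fun do rewrite scaler1.
  by move=> hl; rewrite (_ : derive1 F x = l)//; exact/cvg_lim.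
move=> /cvgr_dnbhsP/(_ (fun n => t n * s)) h.
have {}h : (t n * s)^-1 *: (F (t n * s + x) - F x) @[n --> \oo] --> derive1 F x.
  apply: h; split; first by move=> n; rewrite mulf_neq0.
  by rewrite -(mul0r s); apply: cvgM => //; exact: cvg_cst.
have -> : (fun n => (F (x + t n * s) - F x) / t n) =
    (fun n => (t n * s)^-1 *: (F (t n * s + x) - F x) * s).
  apply/funext => n; rewrite /GRing.scale /= [t n * s + x]addrC.
  by field; rewrite s0 t0.
by apply: cvgM => //; exact: cvg_cst.
Qed.

Context (F w : R -> R) (L M : R).
Hypotheses (dF : forall x : R, derivable F x 1) (FL : lipschitz_fun L F).
Hypotheses (cw : continuous w) (wM : forall x, `|w x| <= M)
  (wi : integrableT (fun s => w s ^+ 2)).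

(* Blow-up at the point (x, F x): substitute s = x + t r and let t tend to 0. *)
Lemma cauchy_jump p q x :
  cauchy_int p q 1 F w (x, F x + n.+1%:R^-1) -
  cauchy_int p q 1 F w (x, F x - n.+1%:R^-1) @[n --> \oo] -->
  - (2 * pi) * w x * (q + p * derive1 F x) / (1 + derive1 F x ^+ 2).
Proof.
have M0 : 0 <= M by apply: le_trans (wM 0).
pose t (n : nat) : R := n.+1%:R^-1.
have t0 n : 0 < t n by rewrite invr_gt0.
pose d n s := (F (x + t n * s) - F x) / t n.
pose G (e : R) n s := w s * ckernel p q 1 (x - s) (F x + e * t n - F s).
have off (e : R) n : e != 0 -> off_curve F (x, F x + e * t n).
  by move=> e0; rewrite /off_curve /= -subr_eq0 addrC addKr mulf_neq0// gt_eqF.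
have cG e n : e != 0 -> continuous (G e n).
  by move=> e0; exact: (continuous_cauchy_integrand dF cw (off e n e0)).
have iG e n : e != 0 -> integrableT (G e n).
  by move=> e0; exact: (integrable_cauchy dF FL cw wi p q 0 (off e n e0)).
have GE e n s : t n * G e n (x + t n * s) =
    w (x + t n * s) * ckernel p q 1 (- s) (e - d n s).
  rewrite /G mulrCA; congr (_ * _).
  rewrite -(@ckernel1_scale _ p q (t n) (- s)) ?gt_eqF//.
  congr (_ * ckernel _ _ _ _ _); first by ring.
  by rewrite /d; field; rewrite gt_eqF.
pose u n s := t n * G 1 n (x + t n * s) - t n * G (-1) n (x + t n * s).
have caff e n : e != 0 -> continuous (fun s => t n * G e n (x + t n * s)).
  move=> e0 s; apply: cvgM; first exact: cvg_cst.
  apply: (continuous_cvg _ (@cG e n e0 (x + t n * s))).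
  apply: cvgD; first exact: cvg_cst.
  by apply: cvgM; [exact: cvg_cst|exact: cvg_id].
have n1 : (-1 : R) != 0 by rewrite oppr_eq0.
have uE n : cauchy_int p q 1 F w (x, F x + n.+1%:R^-1) -
    cauchy_int p q 1 F w (x, F x - n.+1%:R^-1) = \int[mu]_s u n s.
  rewrite /u RintegralB//; last 2 first.
    exact: (integrable_affine x (t0 n) (cG _ n (oner_neq0 R)) (iG _ n (oner_neq0 R))).
    exact: (integrable_affine x (t0 n) (cG _ n n1) (iG _ n n1)).
  rewrite -(Rintegral_affine x (t0 n) (cG _ n (oner_neq0 R)) (iG _ n (oner_neq0 R))).
  rewrite -(Rintegral_affine x (t0 n) (cG _ n n1) (iG _ n n1)).
  by rewrite /cauchy_int /G /= mul1r mulN1r.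
rewrite (_ : (fun n => _) = (fun n => \int[mu]_s u n s)); last exact/funext.
have -> : - (2 * pi) * w x * (q + p * derive1 F x) / (1 + derive1 F x ^+ 2) =
    \int[mu]_s (w x * jump_kernel p q (derive1 F x) s).
  rewrite RintegralZl//; last exact: integrable_jump_kernel.
  by rewrite jump_kernel_integral; ring.
apply: (@dominated_cvg_Rintegral R u _
  (fun s => M * (2 * (`|p| + `|q|) * dist_const L * (1 + s ^+ 2)^-1))).
- move=> n; apply: continuous_measurable_fun => s.
  by apply: cvgB; apply: caff => //; exact: oner_neq0.
- move=> s; rewrite /u.
  have tn0 n : t n != 0 by rewrite gt_eqF.
  have dn := @cvg_difference_quotient F x s t (@dF x) tn0 cvg_invS.
  have wn : w (x + t n * s) @[n --> \oo] --> w x.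
    apply: (continuous_cvg _ (@cw x)); rewrite -{2}[x]addr0 -(mul0r s).
    apply: cvgD; first exact: cvg_cst.
    by apply: cvgM; [exact: cvg_invS|exact: cvg_cst].
  have kn (e : R) : e ^+ 2 = 1 -> ckernel p q 1 (- s) (e - d n s) @[n --> \oo] -->
      ckernel p q 1 (- s) (e - derive1 F x * s).
    move=> e1.
    have h : {for derive1 F x * s, continuous (fun r : R => ckernel p q 1 (- s) (e - r))}.
      set b := derive1 F x * s.
      have hY : is_derive b 1 (fun r : R => e - r) (- 1).
        apply: (is_derive_eq (is_derive1B (is_derive1C e b) (is_derive_id b 1))).
        by rewrite sub0r.
      apply: (is_derive1_continuous (is_derive_ckernel p q 1 (is_derive1C (- s) b) hY _)).
      rewrite /b.
      rewrite sqrrN; have [->|s0] := eqVneq s 0.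
        by rewrite mulr0 subr0 e1 expr0n add0r oner_neq0.
      by rewrite gt_eqF// ltr_pwDl ?sqr_ge0// exprn_even_gt0.
    exact: (continuous_cvg _ h dn).
  rewrite (_ : (fun n => _) = (fun n => w (x + t n * s) *
     (ckernel p q 1 (- s) (1 - d n s) - ckernel p q 1 (- s) (- 1 - d n s)))); last first.
    by apply/funext => n; rewrite !GE mulrBr.
  apply: cvgM => //; apply: cvgB; apply: kn; first exact: expr1n.
  by rewrite sqrrN expr1n.
- by apply: integrableTZ; apply: integrableTZ; exact: integrable_inv_1sqr.
- move=> n s; rewrite /u !GE -mulrBr normrM; apply: ler_pM => //.
  apply: jump_dom; rewrite /d normrM normfV (gtr0_norm (t0 n)) ler_pdivrMr//.
  apply: (le_trans (FL _ _)); rewrite addrAC subrr add0r normrM (gtr0_norm (t0 n)).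
  by rewrite le_eqVlt; apply/orP; left; apply/eqP; ring.
Qed.

End CauchyJump.

(** * A continuously differentiable step function *)

Section SmoothStep.
Context {R : realType}.
Local Notation mu := (@lebesgue_measure R).
Local Notation integrableT f := (mu.-integrable setT (EFin \o f)).
Implicit Types (x y h c : R) (f : R -> R).

Lemma is_derive_quadratic f x (d C : R) :
  (forall h, `|f (x + h) - f x - d * h| <= C * h ^+ 2) -> is_derive x 1 f d.
Proof.
move=> fC.
have lim : (fun h : R => h^-1 *: ((f \o shift x) (h *: (1 : R)) - f x)) @ 0^' --> d.
  apply/cvgrPdist_le => e e0.
  have C0 : 0 < `|C| + 1 by rewrite ltr_wpDl.
  near=> h.
  have h0 : h != 0 by near: h; exact: nbhs_dnbhs_neq.
  have hs : `|h| <= e / (`|C| + 1).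
    by near: h; apply: dnbhs0_le; rewrite divr_gt0.
  rewrite distrC /= scaler1 /GRing.scale /=.
  have -> : h^-1 * (f (h + x) - f x) - d = h^-1 * (f (x + h) - f x - d * h).
    by rewrite (addrC h x); field.
  rewrite normrM normfV mulrC ler_pdivrMr ?normr_gt0//.
  apply: (le_trans (fC h)); rewrite -(real_normK (num_real h)) expr2 mulrA.
  rewrite ler_wpM2r//; apply: (@le_trans _ _ (`|C| * `|h|)).
    by rewrite ler_wpM2r// ler_norm.
  apply: (@le_trans _ _ ((`|C| + 1) * `|h|)); first by rewrite ler_wpM2r// lerDl.
  by rewrite mulrC -ler_pdivlMr.
split; first by apply/cvg_ex; exists d.
exact/cvg_lim.
Unshelve. all: by end_near. Qed.

Definition pos_part x : R := Num.max 0 x.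

Lemma pos_partP x : pos_part x = x /\ 0 <= x \/ pos_part x = 0 /\ x <= 0.
Proof.
rewrite /pos_part; case: (lerP 0 x) => h.
  by left.
by right; split=> //; exact: ltW.
Qed.

Lemma is_derive_pos_part2 x :
  is_derive x 1 (fun y => pos_part y ^+ 2) (2 * pos_part x).
Proof.
apply: (@is_derive_quadratic _ _ _ 1) => h.
have [[-> h1]|[-> h1]] := pos_partP (x + h); have [[-> h2]|[-> h2]] := pos_partP x;
  rewrite ler_norml; apply/andP; split; nra.
Qed.

Lemma continuous_pos_part : continuous pos_part.
Proof.
move=> x; have -> : pos_part = (fun y : R => (y + `|y|) / 2).
  apply/funext => y; have [[-> h]|[-> h]] := pos_partP y.
    by rewrite ger0_norm//; field.
  by rewrite ler0_norm// subrr mul0r.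
apply: cvgM; last exact: cvg_cst.
by apply: cvgD; [exact: cvg_id|exact: norm_continuous].
Qed.

(** A quadratic spline with nodes 0, 1/2 and 1, rising from 0 to 1; it has the one continuous
    derivative that test functions must have. *)
Definition step x : R :=
  2 * (pos_part x ^+ 2 - 2 * pos_part (x - 2^-1) ^+ 2 + pos_part (x - 1) ^+ 2).

(** The hat function of height 2 on [0, 1]; its rescalings form an approximate identity. *)
Definition dstep x : R :=
  4 * (pos_part x - 2 * pos_part (x - 2^-1) + pos_part (x - 1)).

Lemma is_derive_step x : is_derive x 1 step (dstep x).
Proof.
have d c y : is_derive y 1 (fun z : R => pos_part (z - c) ^+ 2) (2 * pos_part (y - c)).
  have h1 : is_derive y 1 (fun z : R => z - c) 1.
    apply: (is_derive_eq (is_derive1B (is_derive_id y 1) (is_derive1C c y))).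
    by rewrite subr0.
  apply: (is_derive_eq (@is_derive1_comp R (fun z => pos_part z ^+ 2)
    (fun z => z - c) y _ _ (is_derive_pos_part2 _) h1)).
  by rewrite mulr1.
apply: (is_derive_eq (is_derive1Z 2 (is_derive1D
  (is_derive1B (is_derive_pos_part2 x) (is_derive1Z 2 (d 2^-1 x))) (d 1 x)))).
by rewrite /dstep; ring.
Qed.

Lemma continuous_dstep : continuous dstep.
Proof.
have cs c y : (fun z : R => pos_part (z - c)) z @[z --> y] --> pos_part (y - c).
  apply: (continuous_cvg _ (@continuous_pos_part (y - c))).
  by apply: cvgB; [exact: cvg_id|exact: cvg_cst].
move=> x; apply: cvgM; first exact: cvg_cst.
apply: cvgD; last exact: cs.
apply: cvgB; first exact: continuous_pos_part.
by apply: cvgM; [exact: cvg_cst|exact: cs].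
Qed.

Lemma step_le0 x : x <= 0 -> step x = 0.
Proof.
rewrite /step; have [[-> h1]|[-> h1]] := pos_partP x;
have [[-> h2]|[-> h2]] := pos_partP (x - 2^-1);
have [[-> h3]|[-> h3]] := pos_partP (x - 1) => h; nra.
Qed.

Lemma step_ge1 x : 1 <= x -> step x = 1.
Proof.
rewrite /step; have [[-> h1]|[-> h1]] := pos_partP x;
have [[-> h2]|[-> h2]] := pos_partP (x - 2^-1);
have [[-> h3]|[-> h3]] := pos_partP (x - 1) => h; nra.
Qed.

Lemma step_01 x : 0 <= step x <= 1.
Proof.
rewrite /step; have [[-> h1]|[-> h1]] := pos_partP x;
have [[-> h2]|[-> h2]] := pos_partP (x - 2^-1);
have [[-> h3]|[-> h3]] := pos_partP (x - 1); apply/andP; split; nra.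
Qed.

Lemma dstep_out x : x <= 0 \/ 1 <= x -> dstep x = 0.
Proof.
rewrite /dstep; have [[-> h1]|[-> h1]] := pos_partP x;
have [[-> h2]|[-> h2]] := pos_partP (x - 2^-1);
have [[-> h3]|[-> h3]] := pos_partP (x - 1) => -[h|h]; lra.
Qed.

Lemma dstep_bound x : `|dstep x| <= 2.
Proof.
rewrite /dstep ler_norml; have [[-> h1]|[-> h1]] := pos_partP x;
have [[-> h2]|[-> h2]] := pos_partP (x - 2^-1);
have [[-> h3]|[-> h3]] := pos_partP (x - 1); apply/andP; split; lra.
Qed.

Lemma dstep_le x : `|dstep x| <= 2 * \1_`[(0 : R), 1] x.
Proof.
rewrite indicE; have [h|h] := boolP (x \in `[(0 : R), 1]%classic).
  by rewrite mulr1 dstep_bound.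
rewrite mulr0 normr_le0; apply/eqP; apply: dstep_out.
move: h; rewrite notin_setE /= in_itv /= => /negP; rewrite negb_and -!ltNge.
by move=> /orP[/ltW ?|/ltW ?]; [left|right].
Qed.

Lemma integrable_dstep : integrableT dstep.
Proof.
apply: (dominated_integrable _ (integrableTZ 2 (integrable_indic_itv 0 1 true false))).
  by apply: continuous_measurable_fun; exact: continuous_dstep.
exact: dstep_le.
Qed.

Lemma Rintegral_dstep : \int[mu]_x dstep x = 1.
Proof.
rewrite (Rintegral_primitive (l1 := 0) (l2 := 1) continuous_dstep integrable_dstep
  is_derive_step) ?subr0//.
- by apply: cvg_near_cst; apply: nearW => n; rewrite step_ge1// ler1n.
- by apply: cvg_near_cst; apply: nearW => n; rewrite step_le0// oppr_le0.
Qed.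

End SmoothStep.

(** * A continuous function is a primitive of its weak derivative *)

Section WeakDerivative.
Context {R : realType}.
Local Notation mu := (@lebesgue_measure R).
Local Notation integrableT f := (mu.-integrable setT (EFin \o f)).
Implicit Types (x y a b c : R).

Context (u u1 : R -> R).
Hypotheses (cu : continuous u) (mu1 : measurable_fun setT u1)
  (u1i : integrableT (fun x => u1 x ^+ 2)) (wu : weak_derivative u u1).

Let N (n : nat) : R := n.+1%:R.

Let is_derive_scaled_step c (n : nat) x :
  is_derive x 1 (fun y => step (N n * (y - c))) (N n * dstep (N n * (x - c))).
Proof.
have h : is_derive x 1 (fun y : R => N n * (y - c)) (N n).
  apply: (is_derive_eq (is_derive1Z (N n) (is_derive1B (is_derive_id x 1) (is_derive1C c x)))).
  by rewrite subr0 mulr1.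
by apply: (is_derive_eq (@is_derive1_comp R step _ x _ _ (is_derive_step _) h)); rewrite mulrC.
Qed.

Let continuous_scaled_dstep c (n : nat) :
  continuous (fun x => N n * dstep (N n * (x - c))).
Proof.
move=> x; apply: cvgM; first exact: cvg_cst.
apply: (continuous_cvg _ (@continuous_dstep R (N n * (x - c)))).
by apply: cvgM; [exact: cvg_cst|apply: cvgB; [exact: cvg_id|exact: cvg_cst]].
Qed.

Let integrable_scaled c (n : nat) :
  integrableT (fun x => u x * (N n * dstep (N n * (x - c)))) /\
  \int[mu]_x (u x * (N n * dstep (N n * (x - c)))) =
  \int[mu]_s (u (c + (N n)^-1 * s) * dstep s).
Proof.
have N0 : 0 < N n by [].
have [B uB] : exists B, forall x, c <= x <= c + 1 -> `|u x| <= B.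
  have cc1 : c <= c + 1 by rewrite lerDl.
  have cun : {within `[c, c + 1], continuous (fun x => `|u x|)}.
    by apply: continuous_subspaceT => x; apply: cvg_norm; exact: cu.
  have [m _ mP] := EVT_max cc1 cun.
  by exists `|u m| => x xI; apply: mP; rewrite in_itv.
pose G x := u x * (N n * dstep (N n * (x - c))).
have cG : continuous G.
  by move=> x; apply: cvgM; [exact: cu|exact: continuous_scaled_dstep].
have Gi : integrableT G.
  apply: (dominated_integrable _ (integrableTZ (`|B| * (N n * 2))
     (integrable_indic_itv c (c + 1) true false))).
    exact: continuous_measurable_fun.
  move=> x; rewrite indicE; have [h|h] := boolP (x \in `[c, c + 1]%classic).
    rewrite mulr1 /G (normrM (u x)) (normrM (N n)) (gtr0_norm N0); apply: ler_pM => //.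
    - by rewrite mulr_ge0 ?(ltW N0).
    - apply: (le_trans (uB _ _)); last exact: ler_norm.
      by move: h; rewrite inE /= in_itv.
    - by apply: ler_wpM2l; [exact: ltW|exact: dstep_bound].
  rewrite mulr0 normr_le0 /G dstep_out ?mulr0//.
  move: h; rewrite notin_setE /= in_itv /= => /negP; rewrite negb_and -!ltNge.
  move=> /orP[h|h]; [left|right].
    by rewrite pmulr_rle0// subr_le0 ltW.
  rewrite (@le_trans _ _ (N n * 1))//; first by rewrite mulr1 ler1n.
  by rewrite ler_wpM2l ?(ltW N0)// lerBrDl ltW.
split=> //; have Ni0 : 0 < (N n)^-1 by rewrite invr_gt0.
rewrite -/(G _) (Rintegral_affine c Ni0 cG Gi); apply: eq_Rintegral => s _.
rewrite /G; have -> : N n * (c + (N n)^-1 * s - c) = s.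
  by field; rewrite gt_eqF.
by field; rewrite gt_eqF.
Qed.

(** The unit mass of the rescaled hats concentrates at c, from the right. *)
Let cvg_scaled c :
  \int[mu]_x (u x * (N n * dstep (N n * (x - c)))) @[n --> \oo] --> u c.
Proof.
have [B uB] : exists B, forall x, c <= x <= c + 1 -> `|u x| <= B.
  have cc1 : c <= c + 1 by rewrite lerDl.
  have cun : {within `[c, c + 1], continuous (fun x => `|u x|)}.
    by apply: continuous_subspaceT => x; apply: cvg_norm; exact: cu.
  have [m _ mP] := EVT_max cc1 cun.
  by exists `|u m| => x xI; apply: mP; rewrite in_itv.
rewrite (_ : (fun n => _) = (fun n => \int[mu]_s (u (c + (N n)^-1 * s) * dstep s))); last first.
  by apply/funext => n; have [_] := integrable_scaled c n.
have -> : u c = \int[mu]_s (u c * dstep s).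
  by rewrite RintegralZl//; [rewrite Rintegral_dstep mulr1|exact: integrable_dstep].
apply: (@dominated_cvg_Rintegral R (fun n s => u (c + (N n)^-1 * s) * dstep s) _
  (fun s => `|B| * (2 * \1_`[(0 : R), 1] s))).
- move=> n; apply: continuous_measurable_fun => s.
  apply: cvgM; last exact: continuous_dstep.
  apply: (continuous_cvg _ (@cu (c + (N n)^-1 * s))).
  apply: cvgD; first exact: cvg_cst.
  by apply: cvgM; [exact: cvg_cst|exact: cvg_id].
- move=> s; apply: cvgM; last exact: cvg_cst.
  apply: (continuous_cvg _ (@cu c)); rewrite -{2}[c]addr0 -(mul0r s).
  apply: cvgD; first exact: cvg_cst.
  by apply: cvgM; [exact: cvg_invS|exact: cvg_cst].
- by apply: integrableTZ; apply: integrableTZ; exact: (integrable_indic_itv 0 1 true false).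
- move=> n s; rewrite normrM; have [s01|s01] := boolP (0 <= s <= 1); last first.
    rewrite dstep_out ?normr0 ?mulr0 ?mulr_ge0//.
    move: s01; rewrite negb_and -!ltNge.
    by move=> /orP[/ltW ?|/ltW ?]; [left|right].
  apply: ler_pM => //; last exact: dstep_le.
  have /andP[s0 s1] := s01; apply: (le_trans (uB _ _)); last exact: ler_norm.
  rewrite lerDl mulr_ge0 ?invr_ge0//= lerD2l.
  apply: (@le_trans _ _ (1 * s)); last by rewrite mul1r.
  by apply: ler_wpM2r => //; rewrite invf_le1 ?ler1n ?ltr0Sn.
Qed.

(** On the segment, |u1| <= 1 + u1^2. *)
Lemma integrable_seg a b : mu.-integrable `[a, b] (EFin \o u1).
Proof.
apply/integrable_mkcond => //.
have := @dominated_integrable R (u1 \_ `[a, b])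
  (fun x => \1_`[a, b] x + u1 x ^+ 2).
rewrite -restrict_EFin; apply.
- exact/(measurable_restrictT _ _).1/measurable_funTS.
- by apply: integrableTD => //; exact: (integrable_indic_itv a b true false).
- move=> x; rewrite patchE indicE; case: ifPn => h.
    have := sqr_ge0 (1 - `|u1 x|); rewrite sqrrB real_normK ?num_real// expr1n mul1r.
    by have := normr_ge0 (u1 x); rewrite /=; lra.
  by rewrite normr0 add0r sqr_ge0.
Qed.

Lemma weak_derivative_primitive a b : a <= b ->
  u b - u a = \int[mu]_(x in `[a, b]) u1 x.
Proof.
rewrite le_eqVlt => /predU1P[->|ab].
  by rewrite subrr set_itv1 Rintegral_set1.
(* Test functions tending to the indicator of ]a, b], whose derivatives are approximate identities
   at a and, with a minus sign, at b. *)
pose phi n x := step (N n * (x - a)) - step (N n * (x - b)).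
have dphi n x : is_derive x 1 (phi n)
    (N n * dstep (N n * (x - a)) - N n * dstep (N n * (x - b))).
  exact: is_derive1B.
have phi_out n x : x <= a \/ b + 1 <= x -> phi n x = 0.
  have N0 : 0 < N n by [].
  move=> [xa|bx]; rewrite /phi.
    rewrite !step_le0 ?subrr// pmulr_rle0// subr_le0//.
    exact: le_trans (ltW ab).
  rewrite !step_ge1 ?subrr//.
    rewrite (@le_trans _ _ (N n * 1))//; first by rewrite mulr1 ler1n.
    by rewrite ler_wpM2l ?(ltW N0)// lerBrDl.
  rewrite (@le_trans _ _ (N n * 1))//; first by rewrite mulr1 ler1n.
  by rewrite ler_wpM2l ?(ltW N0)// lerBrDl; lra.
have phi_le n x : `|phi n x| <= \1_`[a, b + 1] x.
  rewrite indicE; have [h|h] := boolP (x \in `[a, b + 1]%classic).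
    rewrite /phi /= ler_norml.
    have := step_01 (N n * (x - a)); have := step_01 (N n * (x - b)).
    by move=> /andP[? ?] /andP[? ?]; apply/andP; split; lra.
  rewrite /= normr_le0; apply/eqP/phi_out.
  move: h; rewrite notin_setE /= in_itv /= => /negP; rewrite negb_and -!ltNge.
  by move=> /orP[/ltW ?|/ltW ?]; [left|right].
have dphiE n : derive1 (phi n) =
    (fun x => N n * dstep (N n * (x - a)) - N n * dstep (N n * (x - b))).
  by apply/funext => x; exact: is_derive1E (dphi n x).
have test n : test_function (phi n).
  split.
  - by move=> x; case: (dphi n x).
  - by rewrite dphiE => x; apply: cvgB; exact: continuous_scaled_dstep.
  - exists (`|a| + `|b| + 1) => x xM; apply: phi_out.
    have [x0|x0] := leP 0 x.
      right; rewrite (ger0_norm x0) in xM.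
      by have := ler_norm b; have := normr_ge0 a; lra.
    left; rewrite (ltr0_norm x0) in xM.
    by have := ler_norm (- a); rewrite normrN; have := normr_ge0 b; lra.
have lhs : \int[mu]_x (u x * derive1 (phi n) x) @[n --> \oo] --> u a - u b.
  rewrite (_ : (fun n => _) = (fun n => \int[mu]_x (u x * (N n * dstep (N n * (x - a)))) -
     \int[mu]_x (u x * (N n * dstep (N n * (x - b)))))); last first.
    apply/funext => n; have [i1 _] := integrable_scaled a n.
    have [i2 _] := integrable_scaled b n.
    by rewrite -RintegralB//; apply: eq_Rintegral => x _; rewrite dphiE mulrBr.
  by apply: cvgB; exact: cvg_scaled.
have cphi n : continuous (phi n).
  by move=> x; exact: is_derive1_continuous (dphi n x).
have rhs : \int[mu]_x (u1 x * phi n x) @[n --> \oo] --> \int[mu]_x (u1 x * \1_`]a, b] x).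
  apply: (@dominated_cvg_Rintegral R (fun n x => u1 x * phi n x) _
    (fun x => \1_`[a, b + 1] x + u1 x ^+ 2)).
  - by move=> n; apply: measurable_funM => //; exact: continuous_measurable_fun.
  - move=> x; apply: cvgM; first exact: cvg_cst.
    have step1 c : c < x -> \forall n \near \oo, step (N n * (x - c)) = 1.
      move=> cx; apply: filterS (@nbhs_infty_ger R (x - c)^-1) => n hn.
      rewrite step_ge1// -ler_pdivrMr ?subr_gt0// div1r (le_trans hn)//.
      by rewrite ler_nat.
    have step0 c : x <= c -> \forall n \near \oo, step (N n * (x - c)) = 0.
      move=> xc; apply: nearW => n; rewrite step_le0//.
      by rewrite pmulr_rle0 ?subr_le0// ltr0Sn.
    apply: cvg_near_cst; rewrite indicE.
    have [xa|ax] := leP x a.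
      rewrite memNset; last by rewrite /= in_itv /= ltNge xa.
      near=> n; rewrite /phi.
      rewrite (near (step0 _ xa) n)// (near (step0 _ (le_trans xa (ltW ab))) n)//.
      by rewrite subrr.
    have [xb|bx] := leP x b.
      rewrite mem_set; last by rewrite /= in_itv /= ax.
      near=> n; rewrite /phi (near (step1 _ ax) n)// (near (step0 _ xb) n)//.
      by rewrite subr0.
    rewrite memNset; last by rewrite /= in_itv /= leNgt bx andbF.
    by near=> n; rewrite /phi (near (step1 _ ax) n)// (near (step1 _ bx) n)// subrr.
  - by apply: integrableTD => //; exact: (integrable_indic_itv a (b + 1) true false).
  - move=> n x; rewrite normrM; apply: (le_trans (ler_wpM2l (normr_ge0 _) (phi_le n x))).
    rewrite indicE; case: (x \in _) => /=; last by rewrite mulr0 add0r sqr_ge0.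
    have := sqr_ge0 (1 - `|u1 x|); rewrite sqrrB real_normK ?num_real// expr1n mul1r.
    by have := normr_ge0 (u1 x); rewrite mulr1; lra.
have rhs' : \int[mu]_x (u x * derive1 (phi n) x) @[n --> \oo] -->
    - \int[mu]_x (u1 x * \1_`]a, b] x).
  rewrite (_ : (fun n => _) = (fun n => - \int[mu]_x (u1 x * phi n x))).
    exact: cvgN.
  by apply/funext => n; exact: wu.
have -> : \int[mu]_(x in `[a, b]) u1 x = \int[mu]_x (u1 x * \1_`]a, b] x).
  rewrite -Rintegral_itv_obnd_cbnd; last first.
    by apply: integrableS (integrable_seg a b) => //; exact: subset_itv_oc_cc.
  rewrite Rintegral_mkcond; apply: eq_Rintegral => x _.
  by rewrite patchE indicE; case: ifPn => _; rewrite ?mulr1 ?mulr0.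
have E := cvg_unique (@Rhausdorff R) lhs rhs'.
by rewrite -[RHS]opprK -E opprB.
Unshelve. all: by end_near. Qed.

End WeakDerivative.

(** * Integrability on segments *)

Section IntegrableOn.
Context {R : realType}.
Local Notation mu := (@lebesgue_measure R).
Implicit Types (f g : R -> R) (a b c : R).

Lemma integrable_segD f g a b : mu.-integrable `[a, b] (EFin \o f) ->
  mu.-integrable `[a, b] (EFin \o g) ->
  mu.-integrable `[a, b] (EFin \o (fun x => f x + g x)).
Proof. by move=> fi gi; apply: (integrableD _ fi gi). Qed.

Lemma integrable_segZ c f a b : mu.-integrable `[a, b] (EFin \o f) ->
  mu.-integrable `[a, b] (EFin \o (fun x => c * f x)).
Proof. by move=> fi; apply: (integrableZl _ c fi). Qed.

Lemma integrable_seg_cst c a b : mu.-integrable `[a, b] (EFin \o (fun _ : R => c)).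
Proof.
apply: continuous_compact_integrable; first exact: segment_compact.
by apply: continuous_subspaceT => x; exact: cvg_cst.
Qed.

End IntegrableOn.

(** * The Slobodeckij seminorm and means over intervals *)

Section Slobodeckij.
Context {R : realType}.
Local Notation mu := (@lebesgue_measure R).
Local Notation integrableT f := (mu.-integrable setT (EFin \o f)).
Implicit Types (x y a b c : R).

Context (g : R -> R) (s : R).
Hypotheses (mg : measurable_fun setT g) (gi : integrableT (fun x => g x ^+ 2)).
Hypothesis gs : (slobodeckij s g < +oo)%E.
Hypothesis s0 : 0 < s.

Definition mean (f : R -> R) a b : R := (\int[mu]_(x in `[a, b]) f x) / (b - a).

Let measure_seg a b : a < b -> fine (mu `[a, b]) = b - a.
Proof. by move=> ab; rewrite lebesgue_measure_itv /= lte_fin ab -EFinD. Qed.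

Let integrable_g2 a b : mu.-integrable `[a, b] (EFin \o (fun x => g x ^+ 2)).
Proof. exact: (integrableS measurableT _ _ gi). Qed.

Let integrable_sqrB a b c : mu.-integrable `[a, b] (EFin \o (fun y => (c - g y) ^+ 2)).
Proof.
have ig := integrable_seg mg gi a b.
have := integrable_segD (integrable_segD (integrable_seg_cst (c ^+ 2) a b)
  (integrable_segZ (- (2 * c)) ig)) (integrable_g2 a b).
by congr (mu.-integrable _ (EFin \o _)); apply/funext => y; ring.
Qed.

(* The mean minimizes the quadratic deviation. *)
Lemma mean_sqr_le a b c : a < b ->
  (((b - a) * (c - mean g a b) ^+ 2)%:E <= \int[mu]_(y in `[a, b]) ((c - g y) ^+ 2)%:E)%E.
Proof.
move=> ab; have ig := integrable_seg mg gi a b.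
have fi : (\int[mu]_(y in `[a, b]) ((c - g y) ^+ 2)%:E)%E \is a fin_num.
  by apply: integrable_fin_num => //; exact: integrable_sqrB.
rewrite -[leRHS](fineK fi) lee_fin -/(Rintegral mu `[a, b] (fun y => (c - g y) ^+ 2)).
set d := c - mean g a b.
have i1 : mu.-integrable `[a, b] (EFin \o (fun y => (- (2 * d)) * g y)).
  exact: integrable_segZ.
have i2 : mu.-integrable `[a, b]
    (EFin \o (fun y => (2 * d * c - d ^+ 2) + (- (2 * d)) * g y)).
  exact: (integrable_segD (integrable_seg_cst _ a b) i1).
apply: (@le_trans _ _ (\int[mu]_(y in `[a, b]) ((2 * d * c - d ^+ 2) + (- (2 * d)) * g y))).
  rewrite RintegralD//; last exact: integrable_seg_cst.
  rewrite RintegralZl// Rintegral_cst// measure_seg//.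
  have -> : \int[mu]_(x in `[a, b]) g x = (b - a) * mean g a b.
    by rewrite /mean; field; rewrite subr_eq0 gt_eqF.
  by rewrite /d le_eqVlt; apply/orP; left; apply/eqP; ring.
apply: le_Rintegral => // y _; rewrite -subr_ge0.
have -> : (c - g y) ^+ 2 - (2 * d * c - d ^+ 2 + - (2 * d) * g y) = (c - g y - d) ^+ 2.
  by ring.
exact: sqr_ge0.
Qed.

Let K (z : R * R) : \bar R :=
  (`|g z.1 - g z.2| ^+ 2 / `|z.1 - z.2| `^ (1 + 2 * s))%:E.

Let mK : measurable_fun setT K.
Proof.
have mB : measurable_fun setT (fun z : R * R => `|g z.1 - g z.2|).
  apply: measurableT_comp => //; apply: measurable_funB.
    by apply: measurableT_comp => //; exact: measurable_fst.
  by apply: measurableT_comp => //; exact: measurable_snd.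
have mD : measurable_fun setT (fun z : R * R => `|z.1 - z.2| `^ (- (1 + 2 * s))).
  apply: (measurableT_comp (measurable_powR _)); apply: measurableT_comp => //.
  by apply: measurable_funB; [exact: measurable_fst|exact: measurable_snd].
apply/measurable_EFinP; apply: measurable_funM; first exact: measurable_funX.
by under eq_fun do rewrite -powRN.
Qed.

Let K0 z : (0 <= K z)%E.
Proof. by rewrite lee_fin divr_ge0 ?powR_ge0// exprn_ge0. Qed.

Let sl : R := fine (slobodeckij s g).

(** Two applications of [mean_sqr_le], in y and then in x, bound the left-hand side by the integral
    of |g(x) - g(y)|^2 over the product of the intervals, where |x - y| is at most x1 - x0. *)
Lemma mean_diff_le x0 x1 y0 y1 : x0 < x1 -> y0 < y1 -> x0 <= y0 -> y1 <= x1 ->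
  (y1 - y0) * (x1 - x0) * (mean g x0 x1 - mean g y0 y1) ^+ 2 <=
  (x1 - x0) `^ (1 + 2 * s) * sl.
Proof.
move=> x01 y01 xy0 yx1; set l := x1 - x0; set m := y1 - y0.
have l0 : 0 < l by rewrite subr_gt0.
have m0 : 0 < m by rewrite subr_gt0.
set E := l `^ (1 + 2 * s).
have E0 : 0 < E by exact: powR_gt0.
have Kge x y : x0 <= x <= x1 -> x0 <= y <= x1 ->
    ((E^-1 * (g x - g y) ^+ 2)%:E <= K (x, y))%E.
  move=> /andP[xa xb] /andP[ya yb]; rewrite lee_fin /K /= real_normK ?num_real// mulrC.
  (* On the diagonal both sides are 0. *)
  have [->|xy] := eqVneq x y; first by rewrite !subrr expr0n !mul0r.
  rewrite ler_wpM2l ?sqr_ge0// lef_pV2 ?posrE//; last first.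
    by rewrite powR_gt0// normr_gt0 subr_eq0.
  apply: ge0_ler_powR.
  - by rewrite addr_ge0// mulr_ge0// ltW.
  - by rewrite nnegrE.
  - by rewrite nnegrE ltW.
  - by rewrite ler_norml /l; apply/andP; split; lra.
have mJ : measurable_fun `[y0, y1] g by exact: measurable_funTS.
have inner x : x0 <= x <= x1 ->
    ((E^-1 * (m * (g x - mean g y0 y1) ^+ 2))%:E <= \int[mu]_y K (x, y))%E.
  move=> xI; have mKx : measurable_fun setT (fun y => K (x, y)).
    exact: (measurableT_comp mK (measurable_pair1 x)).
  apply: (@le_trans _ _ (\int[mu]_(y in `[y0, y1]) K (x, y))%E); last first.
    exact: ge0_subset_integral.
  apply: (@le_trans _ _ (\int[mu]_(y in `[y0, y1]) (E^-1 * (g x - g y) ^+ 2)%:E)%E).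
    under eq_integral do rewrite EFinM.
    rewrite ge0_integralZl//; last 3 first.
    - apply/measurable_EFinP; apply: measurable_funX; exact: measurable_funB.
    - by move=> y _; rewrite lee_fin sqr_ge0.
    - by rewrite lee_fin invr_ge0 ltW.
    rewrite EFinM lee_wpmul2l ?lee_fin ?invr_ge0 ?(ltW E0)//.
    exact: mean_sqr_le.
  apply: ge0_le_integral => //.
  - by move=> y _; rewrite lee_fin mulr_ge0 ?sqr_ge0// invr_ge0 ltW.
  - apply/measurable_EFinP; apply: measurable_funM => //.
    apply: measurable_funX; exact: measurable_funB.
  - exact: measurable_funTS.
  - move=> y /=; rewrite in_itv/= => /andP[ya yb]; apply: Kge => //.
    by rewrite (le_trans xy0 ya) (le_trans yb yx1).
have slE : sl%:E = (\int[mu]_x \int[mu]_y K (x, y))%E.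
  have fs : slobodeckij s g \is a fin_num.
    rewrite ge0_fin_numE; first exact: gs.
    by apply: integral_ge0 => x _; apply: integral_ge0 => y _; exact: (K0 (x, y)).
  by rewrite /sl fineK.
have mF : measurable_fun setT (fun x => \int[mu]_y K (x, y))%E.
  exact: (@measurable_fun_fubini_tonelli_F _ _ _ _ _ mu K mK K0).
have F0 x : (0 <= \int[mu]_y K (x, y))%E.
  by apply: integral_ge0 => y _; exact: K0.
have : ((E^-1 * m * (l * (mean g y0 y1 - mean g x0 x1) ^+ 2))%:E <= sl%:E)%E.
  rewrite slE; apply: (@le_trans _ _ (\int[mu]_(x in `[x0, x1]) \int[mu]_y K (x, y))%E); last first.
    exact: ge0_subset_integral.
  apply: (@le_trans _ _ (\int[mu]_(x in `[x0, x1])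
      (E^-1 * m * (mean g y0 y1 - g x) ^+ 2)%:E)%E).
    under eq_integral do rewrite EFinM.
    rewrite ge0_integralZl//; last 3 first.
    - apply/measurable_EFinP; apply: measurable_funX; apply: measurable_funB => //.
      exact: measurable_funTS.
    - by move=> y _; rewrite lee_fin sqr_ge0.
    - by rewrite lee_fin mulr_ge0 ?invr_ge0 ?(ltW E0) ?(ltW m0).
    rewrite EFinM lee_wpmul2l ?lee_fin ?mulr_ge0 ?invr_ge0 ?(ltW E0) ?(ltW m0)//.
    exact: mean_sqr_le.
  apply: ge0_le_integral => //.
  - move=> x _; rewrite lee_fin; apply: mulr_ge0; last exact: sqr_ge0.
    by rewrite mulr_ge0 ?invr_ge0 ?(ltW E0) ?(ltW m0).
  - apply/measurable_EFinP; apply: measurable_funM => //.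
    by apply: measurable_funX; apply: measurable_funB => //; exact: measurable_funTS.
  - exact: measurable_funTS.
  - move=> x /=; rewrite in_itv/= => xI; apply: le_trans (inner x xI).
    by rewrite lee_fin le_eqVlt; apply/orP; left; apply/eqP; ring.
rewrite lee_fin => /(ler_wpM2l (ltW E0)); apply: le_trans.
by rewrite le_eqVlt; apply/orP; left; apply/eqP; field; rewrite gt_eqF.
Qed.

Lemma slobodeckij_ge0 : 0 <= sl.
Proof.
apply: fine_ge0; apply: integral_ge0 => x _; apply: integral_ge0 => y _.
exact: (K0 (x, y)).
Qed.

End Slobodeckij.

(** * From slopes over nested intervals to a Hölder continuous derivative *)

Section Campanato.
Context {R : realType}.
Implicit Types (x y a b h : R).

Definition slope (u : R -> R) x y : R := (u y - u x) / (y - x).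

Context (u : R -> R) (al C0 : R).
Hypotheses (al0 : 0 < al) (C00 : 0 <= C0).
Hypothesis uC : forall x0 x1 y0 y1, x0 <= y0 -> y0 < y1 -> y1 <= x1 ->
  (x1 - x0) / 2 <= y1 - y0 ->
  `|slope u y0 y1 - slope u x0 x1| <= C0 * (x1 - x0) `^ al.

Let th : R := 2^-1 `^ al.

Let th1 : 0 < 1 - th.
Proof.
rewrite subr_gt0 -[ltRHS](_ : 1 `^ al = 1 :> R); last by rewrite powR1.
by apply: gt0_ltr_powR; rewrite ?nnegrE ?invf_lt1 ?ltr1n.
Qed.

(** The sum of the geometric series of the C0 th^j. *)
Let C1 : R := C0 / (1 - th).

Let C10 : 0 <= C1. Proof. by rewrite divr_ge0// ltW. Qed.

Let C1E : C1 * th + C0 = C1.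
Proof. by rewrite /C1; field; rewrite gt_eqF. Qed.

(** The outer interval is halved, with the inner one kept inside, until their lengths are
    comparable. Each halving costs C0 times a power of the current length, and these costs form a
    geometric series. *)
Lemma slope_chain x0 x1 y0 y1 : x0 <= y0 -> y0 < y1 -> y1 <= x1 ->
  `|slope u y0 y1 - slope u x0 x1| <= C1 * (x1 - x0) `^ al.
Proof.
move=> xy y01 yx.
have d0 : 0 < y1 - y0 by rewrite subr_gt0.
have : exists n : nat, (x1 - x0) <= 2 ^+ n * (y1 - y0).
  exists (Num.truncn ((x1 - x0) / (y1 - y0))).+1.
  rewrite -ler_pdivrMr//; apply: (le_trans (ltW (truncnS_gt _))).
  by rewrite -natrX ler_nat ltnW// ltn_expl.
move=> [n]; elim: n x0 x1 xy yx => [|n ih] x0 x1 xy yx hn.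
  apply: (le_trans (uC xy y01 yx _)); first by rewrite expr0 mul1r in hn; lra.
  rewrite ler_wpM2r ?powR_ge0// -C1E lerDr mulr_ge0// powR_ge0//.
have [half|half] := leP ((x1 - x0) / 2) (y1 - y0).
  apply: (le_trans (uC xy y01 yx half)).
  by rewrite ler_wpM2r ?powR_ge0// -C1E lerDr mulr_ge0// powR_ge0.
have step z0 z1 : z1 - z0 = (x1 - x0) / 2 -> x0 <= z0 -> z1 <= x1 -> z0 <= y0 -> y1 <= z1 ->
    `|slope u y0 y1 - slope u x0 x1| <= C1 * (x1 - x0) `^ al.
  move=> zE xz zx zy yz.
  have z01 : z0 < z1 by lra.
  have e1 := ih z0 z1 zy yz.
  have e2 := uC xz z01 zx; rewrite zE lexx in e2.
  have {}e1 := e1 _; rewrite zE powRM ?invr_ge0// in e1; last by lra.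
  have hz : (x1 - x0) / 2 <= 2 ^+ n * (y1 - y0).
    by rewrite exprS in hn; lra.
  have := ler_normD (slope u y0 y1 - slope u z0 z1) (slope u z0 z1 - slope u x0 x1).
  rewrite addrA subrK => /le_trans; apply.
  apply: (le_trans (lerD (e1 hz) (e2 isT))).
  by rewrite -{2}C1E le_eqVlt; apply/orP; left; apply/eqP; rewrite /th; ring.
(* Either the half-length interval starting at y0 fits, or the right half of [x0, x1] contains
   [y0, y1]. *)
have [h|h] := leP (y0 + (x1 - x0) / 2) x1.
  by apply: (step y0 (y0 + (x1 - x0) / 2)) => //; lra.
by apply: (step (x0 + (x1 - x0) / 2) x1) => //; lra.
Qed.

Let quot x h : R := h^-1 * (u (h + x) - u x).

Let quot_slope x h : h != 0 ->
  exists y0 y1, [/\ quot x h = slope u y0 y1, y0 < y1, x - `|h| <= y0, y1 <= x + `|h| &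
    (0 < h -> y0 = x)] /\ (h < 0 -> y1 = x).
Proof.
move=> h0; have [hp|hn|hE] := ltgtP 0 h; last by rewrite hE eqxx in h0.
  exists x, (h + x); rewrite /quot /slope gtr0_norm//; split; last by lra.
  by split; [rewrite addrK mulrC|lra|lra|lra|].
exists (h + x), x; rewrite /quot /slope ltr0_norm//; split=> //.
split; [|lra|lra|lra|lra].
by rewrite (_ : x - (h + x) = - h); [field|ring].
Qed.

(** The quotients with |h| <= d are slopes over subintervals of [x - d, x + d], hence all close to
    the slope over that interval: a Cauchy criterion. *)
Let quot_cvg x : cvg (quot x h @[h --> 0^']).
Proof.
apply/cauchy_cvgP/cauchyP => /= e e0.
pose K := 4 * (C1 + 1); have K0 : 0 < K by rewrite mulr_gt0// ltr_wpDl.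
pose d := (e / K) `^ al^-1 / 2.
have d0 : 0 < d by rewrite divr_gt0// powR_gt0// divr_gt0.
have dE : 2 * C1 * (2 * d) `^ al < e.
  have -> : 2 * d = (e / K) `^ al^-1 by rewrite /d; field.
  rewrite -powRrM mulVf ?gt_eqF// powRr1 ?divr_ge0 ?ltW//.
  rewrite mulrA ltr_pdivrMr// mulrC ltr_pM2l// /K.
  by have := C10; lra.
exists (quot x d).
suff : \forall h \near (0 : R)^', ball (quot x d) e (quot x h) by [].
near=> h.
have h0 : h != 0 by near: h; exact: nbhs_dnbhs_neq.
have hd : `|h| <= d by near: h; exact: dnbhs0_le d0.
have close k : k != 0 -> `|k| <= d ->
    `|quot x k - slope u (x - d) (x + d)| <= C1 * (2 * d) `^ al.
  move=> k0 kd; have [y0 [y1 [[-> y01 xy yx _] _]]] := quot_slope x k0.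
  rewrite (_ : 2 * d = (x + d) - (x - d)); last by ring.
  by apply: slope_chain => //; lra.
rewrite -ball_normE /=.
have := ler_distD (slope u (x - d) (x + d)) (quot x d) (quot x h).
move=> /le_lt_trans; apply; apply: le_lt_trans dE.
rewrite (distrC (slope _ _ _)).
have dd : d != 0 by rewrite gt_eqF.
have dd' : `|d| <= d by rewrite (ger0_norm (ltW d0)).
have e1 := close d dd dd'; have e2 := close h h0 hd.
have -> : 2 * C1 * (2 * d) `^ al = C1 * (2 * d) `^ al + C1 * (2 * d) `^ al by ring.
exact: lerD.
Unshelve. all: by end_near. Qed.

Lemma campanato_derivable x : derivable u x 1.
Proof.
rewrite /derivable [X in cvg (X @ _)](_ : _ = quot x)//.
by apply/funext => h; rewrite /quot /= scaler1.
Qed.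

Lemma campanato_derive_slope x x0 x1 : x0 < x1 -> x = x0 \/ x = x1 ->
  `|derive1 u x - slope u x0 x1| <= C1 * (x1 - x0) `^ al.
Proof.
move=> x01 xE.
have hl : quot x h @[h --> 0^'] --> derive1 u x by exact: quot_cvg.
(* The sign makes the increments point from x into [x0, x1]. *)
pose t (n : nat) : R := (if x == x0 then 1 else -1) * (x1 - x0) * n.+1%:R^-1.
have xd : x1 - x0 != 0 by rewrite gt_eqF// subr_gt0.
have t0 n : t n != 0.
  by rewrite !mulf_neq0// ?invr_eq0//; case: ifP => _; rewrite ?oppr_eq0.
have tl : t n @[n --> \oo] --> (0 : R).
  rewrite -(mulr0 ((if x == x0 then 1 else -1) * (x1 - x0))).
  by apply: cvgM; [exact: cvg_cst|exact: cvg_invS].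
have {}hl : quot x (t n) @[n --> \oo] --> derive1 u x.
  by move/cvgr_dnbhsP: hl; apply; split.
have hl2 : `|quot x (t n) - slope u x0 x1| @[n --> \oo] -->
    `|derive1 u x - slope u x0 x1|.
  by apply: cvg_norm; apply: cvgB => //; exact: cvg_cst.
apply: cvgr_to_le hl2 _; apply: nearW => n.
have [y0 [y1 [[-> y01 xy yx yp] yn]]] := quot_slope x (t0 n).
have tn : `|t n| <= x1 - x0.
  rewrite /t !normrM [`|if _ then _ else _|](_ : _ = 1); last first.
    by case: ifP; rewrite ?normrN normr1.
  rewrite mul1r gtr0_norm ?subr_gt0// normfV normr_nat.
  by rewrite ler_piMr ?invf_le1 ?ler1n// subr_ge0 ltW.
apply: slope_chain => //.
  case: xE => xE.
    rewrite (yp _) ?xE// /t xE eqxx mul1r mulr_gt0 ?subr_gt0 ?invr_gt0//.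
  by rewrite (le_trans _ xy)// xE; lra.
case: xE => xE.
  by rewrite (le_trans yx)// xE; lra.
rewrite (yn _) ?xE// /t ifF; last by rewrite xE gt_eqF.
by rewrite mulN1r mulNr oppr_lt0 mulr_gt0 ?subr_gt0 ?invr_gt0.
Qed.

(** Both derivatives are compared with the slope over the interval between the two points; hence the
    factor 2. *)
Lemma campanato_holder : holder_fun al (2 * C1) (derive1 u).
Proof.
have main x y : x < y -> `|derive1 u x - derive1 u y| <= 2 * C1 * (y - x) `^ al.
  move=> xy.
  have h1 := @campanato_derive_slope x x y xy (or_introl erefl).
  have h2 := @campanato_derive_slope y x y xy (or_intror erefl).
  have := ler_distD (slope u x y) (derive1 u x) (derive1 u y).
  by rewrite (distrC (slope _ _ _)); lra.
move=> x y; have [xy|yx|->] := ltgtP x y.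
- by rewrite (ltr0_norm (x := x - y)) ?subr_lt0// opprB; exact: main.
- by rewrite distrC (gtr0_norm (x := x - y)) ?subr_gt0//; exact: main.
- by rewrite !subrr !normr0 powR0 ?gt_eqF// mulr0.
Qed.

End Campanato.

(** * Boundedness of square integrable Hölder functions *)

Section SquareIntegrableHolder.
Context {R : realType}.
Local Notation mu := (@lebesgue_measure R).
Local Notation integrableT f := (mu.-integrable setT (EFin \o f)).

(** A large value at x persists, up to |K|, on [x, x + 1] and would make the integral of w^2
    large. *)
Lemma holder_sqr_integrable_bounded (a K : R) (w : R -> R) : 0 < a ->
  holder_fun a K w -> integrableT (fun s => w s ^+ 2) ->
  exists M, forall x, `|w x| <= M.
Proof.
move=> a0 wK wi; exists (`|K| + (1 + \int[mu]_s w s ^+ 2)) => x.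
set A := \int[mu]_s _.
have A0 : 0 <= A by apply: Rintegral_ge0 => s _; exact: sqr_ge0.
have [h|h] := leP `|w x| `|K|; first by rewrite (le_trans h)// lerDl addr_ge0.
set d := `|w x| - `|K|; have d0 : 0 < d by rewrite subr_gt0.
suff : d ^+ 2 <= A by rewrite /d; nra.
have cw := holder_continuous a0 wK.
have mw : measurable_fun setT (fun s => w s ^+ 2).
  by apply: measurable_funX; exact: continuous_measurable_fun.
have -> : d ^+ 2 = \int[mu]_s (d ^+ 2 * \1_`[x, x + 1] s).
  rewrite RintegralZl//; last exact: (integrable_indic_itv x (x + 1) true false).
  rewrite /Rintegral integral_indic// setIT [X in fine X](_ : _ = 1%E) ?mulr1//.
  transitivity (mu `[x, x + 1]%classic) => //.
  by rewrite lebesgue_measure_itv /= lte_fin ltrDl ltr01 -EFinD addrAC subrr add0r.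
apply: le_Rintegral => //.
  by apply: integrableTZ; exact: (integrable_indic_itv x (x + 1) true false).
move=> s _; rewrite indicE; have [sI|sI] := boolP (s \in _); last first.
  by rewrite mulr0 sqr_ge0.
rewrite mulr1 -(real_normK (num_real (w s))) ler_sqr ?nnegrE ?(ltW d0)//.
move: sI; rewrite inE /= in_itv /= => /andP[s0 s1].
have : `|w x - w s| <= `|K|.
  apply: (le_trans (wK x s)); apply: (@le_trans _ _ (`|K| * `|x - s| `^ a)).
    by rewrite ler_wpM2r ?powR_ge0// ler_norm.
  rewrite ler_piMr// -[leRHS](_ : 1 `^ a = 1 :> R); last by rewrite powR1.
  apply: ge0_ler_powR; rewrite ?nnegrE ?(ltW a0)//.
  by rewrite distrC ger0_norm ?subr_ge0//; lra.
have := ler_normD (w x - w s) (w s); rewrite subrK /d; lra.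
Qed.

Lemma bounded_lipschitz_holder (a L M : R) (w : R -> R) : 0 < a < 1 ->
  (forall x, `|w x| <= M) -> lipschitz_fun L w -> exists K, holder_fun a K w.
Proof.
move=> /andP[a0 a1] wM wL; exists (2 * M + `|L|) => x y.
have M0 : 0 <= M by apply: le_trans (wM 0).
have [h|h] := leP `|x - y| 1.
  have [->|xy] := eqVneq x y.
    by rewrite !subrr normr0 mulr_ge0 ?powR_ge0// addr_ge0// mulr_ge0.
  apply: (le_trans (wL x y)); apply: (@le_trans _ _ (`|L| * `|x - y| `^ a)).
    apply: (@le_trans _ _ (`|L| * `|x - y|)); first by rewrite ler_wpM2r// ler_norm.
    rewrite ler_wpM2l// ger1_powR ?(ltW a1)// h andbT normr_gt0 subr_eq0//.
  by rewrite ler_wpM2r ?powR_ge0// lerDr mulr_ge0.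
apply: (@le_trans _ _ (2 * M)).
  apply: (le_trans (ler_normB _ _)); rewrite mulr_natl mulr2n.
  exact: lerD.
apply: (@le_trans _ _ ((2 * M + `|L|) * 1)); first by rewrite mulr1 lerDl.
rewrite ler_wpM2l ?addr_ge0 ?mulr_ge0//.
rewrite -[leLHS](_ : 1 `^ a = 1 :> R); last by rewrite powR1.
apply: ge0_ler_powR; rewrite ?nnegrE ?(ltW a0) ?(ltW h)//.
Qed.

End SquareIntegrableHolder.

(** * Regularity of functions in H^r *)

Section SobolevRegularity.
Context {R : realType}.
Local Notation mu := (@lebesgue_measure R).
Local Notation integrableT f := (mu.-integrable setT (EFin \o f)).
Implicit Types u w : R -> R.

Lemma Lfun2_measurable w : w \in Lfun mu 2%:E -> measurable_fun setT w.
Proof. by rewrite inE => /andP[]; rewrite inE. Qed.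

(** At every Lebesgue point of u1 the primitive is differentiable with derivative u1. This carries
    square integrability from u1 over to [derive1 u]. *)
Lemma primitive_derive_ae u u1 : measurable_fun setT u1 -> integrableT (fun s => u1 s ^+ 2) ->
  (forall a b, a <= b -> u b - u a = \int[mu]_(x in `[a, b]) u1 x) ->
  {ae mu, forall x, derive1 u x = u1 x}.
Proof.
move=> mu1 u1i uE.
have iseg a b : mu.-integrable `[a, b] (EFin \o u1) by exact: integrable_seg.
have li : locally_integrable [set: R] u1.
  split => // [|K _ cK]; first exact: openT.
  have [M [_ KM]] := compact_bounded cK.
  have Ksub : K `<=` `[- (M + 1), M + 1].
    move=> s Ks /=; have := KM (M + 1) _ _ Ks; rewrite ltrDl => /(_ ltr01) /=.
    by rewrite in_itv /= ler_norml.
  have /integrableP[_] := iseg (- (M + 1)) (M + 1).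
  apply: le_lt_trans; apply: ge0_subset_integral => //.
  - exact: compact_measurable.
  - apply/measurable_EFinP; apply: measurableT_comp => //.
    exact: measurable_funTS.
apply: (@filterS _ _ (ae_filter_ringOfSetsType mu)) (lebesgue_differentiation li) => x xl.
have [] := @FTC1_lebesgue_pt _ u1 (BLeft (x - 1)) x (x + 1) _ (iseg _ _) _ xl.
- by rewrite ltrDl.
- by rewrite /Order.lt /= ltrBlDr ltrDl.
set F := (fun y => _) => dF FE.
have hF : is_derive x 1 F (u1 x) by rewrite -FE; exact: is_derive1_derive1.
apply: is_derive1E.
have := is_derive1D hF (is_derive1C (u (x - 1)) x); rewrite addr0.
apply: near_eq_is_derive; apply/norm_nearP; exists 1 => // y.
by rewrite ltr_norml => /andP[xy _]; rewrite /F -uE ?subrK//; lra.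
Qed.

Lemma sqr_integrable_ae u u1 : measurable_fun setT u1 -> measurable_fun setT u ->
  integrableT (fun s => u1 s ^+ 2) -> {ae mu, forall x, u x = u1 x} ->
  integrableT (fun s => u s ^+ 2).
Proof.
move=> m1 m0 /integrableP[mi fi] aeE; apply/integrableP; split.
  by apply/measurable_EFinP; exact: measurable_funX.
apply: le_lt_trans fi; rewrite le_eqVlt; apply/orP; left; apply/eqP.
apply: ae_eq_integral => //.
- by apply: measurableT_comp => //; apply/measurable_EFinP; exact: measurable_funX.
- exact: measurableT_comp.
- by apply: (@filterS _ _ (ae_filter_ringOfSetsType mu)) aeE => x /= -> _.
Qed.

(** The slope of u over an interval is the mean of its weak derivative, so the Slobodeckij bound for
    means is the hypothesis of the Campanato argument. Boundedness then comes from square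
    integrability. *)
Theorem sobolev_regular (r : R) u : 3 / 2 < r < 2 -> sobolev r u ->
  [/\ regular_curve (r - 3 / 2) u, density (r - 3 / 2) u &
      density (r - 3 / 2) (derive1 u)].
Proof.
move=> /andP[r1 r2] [cu [u1 [lu lu1 wd sl]]].
pose a := r - 3 / 2; have a0 : 0 < a by rewrite /a; lra.
have a1 : a < 1 by rewrite /a; lra.
have mu1 := Lfun2_measurable lu1; have mu0 := Lfun2_measurable lu.
have u1i := Lfun2_integrable_sqr lu1; have ui := Lfun2_integrable_sqr lu.
have uE c d : c <= d -> u d - u c = \int[mu]_(x in `[c, d]) u1 x.
  exact: weak_derivative_primitive.
pose S := fine (slobodeckij (r - 1) u1); have S0 : 0 <= S by exact: slobodeckij_ge0.
have slopeE x y : x < y -> slope u x y = mean u1 x y.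
  by move=> xy; rewrite /slope /mean uE ?ltW.
(* The exponent 1 + 2 (r - 1) equals 2 + 2 a, and two powers of the length cancel; the factor 2
   under the root stems from y1 - y0 being at least half of x1 - x0. *)
have uC x0 x1 y0 y1 : x0 <= y0 -> y0 < y1 -> y1 <= x1 ->
  (x1 - x0) / 2 <= y1 - y0 ->
  `|slope u y0 y1 - slope u x0 x1| <= Num.sqrt (2 * S) * (x1 - x0) `^ a.
  move=> xy y01 yx half; have x01 : x0 < x1 by lra.
  rewrite !slopeE// distrC.
  have := mean_diff_le mu1 u1i sl _ x01 y01 xy yx.
  have rs : 0 < r - 1 by lra.
  move=> /(_ rs); set m := mean u1 x0 x1 - _; rewrite -/S.
  set d := x1 - x0 in half *; have d0 : 0 < d by rewrite subr_gt0.
  have dE : d `^ (1 + 2 * (r - 1)) = d ^+ 2 * (d `^ a) ^+ 2.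
    rewrite -!powR_mulrn ?powR_ge0 ?ltW// -powRrM -powRD; first by congr (_ `^ _); rewrite /a; lra.
    by apply/implyP => _; rewrite gt_eqF.
  rewrite dE => h.
  rewrite -(ler_sqr (x := `|m|)) ?nnegrE ?mulr_ge0 ?powR_ge0 ?sqrtr_ge0//.
  rewrite real_normK ?num_real// exprMn sqr_sqrtr ?mulr_ge0//.
  have d2 : 0 < d ^+ 2 by rewrite exprn_gt0.
  rewrite -(ler_pM2l d2); have := sqr_ge0 m => m0.
  apply: (@le_trans _ _ (2 * ((y1 - y0) * d * m ^+ 2))).
    have hd : d ^+ 2 <= 2 * (y1 - y0) * d by rewrite expr2 ler_wpM2r ?(ltW d0)//; lra.
    by have := ler_wpM2r m0 hd; lra.
  by rewrite (_ : d ^+ 2 * (2 * S * _) = 2 * (d ^+ 2 * (d `^ a) ^+ 2 * S)) ?ler_wpM2l//; ring.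
have C0 : 0 <= Num.sqrt (2 * S) by exact: sqrtr_ge0.
have du x := campanato_derivable a0 C0 uC x.
have u'H := campanato_holder a0 C0 uC.
have cu' := holder_continuous a0 u'H.
have u'i : integrableT (fun s => derive1 u s ^+ 2).
  apply: (sqr_integrable_ae mu1) => //; first exact: continuous_measurable_fun.
  exact: primitive_derive_ae.
have [L u'L] := holder_sqr_integrable_bounded a0 u'H u'i.
have uL := derive_bounded_lipschitz du u'L.
have uH1 : holder_fun 1 L u by move=> x y; rewrite powRr1//; exact: uL.
have [M uM] := holder_sqr_integrable_bounded ltr01 uH1 ui.
have a01 : 0 < a < 1 by rewrite a0.
have [K uK] := bounded_lipschitz_holder a01 uM uL.
have u'K : exists K, holder_fun a K (derive1 u) by eexists; exact: u'H.
by split; (split; [exact: du || eexists; eassumption | eexists; eassumption | assumption]).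
Qed.

Lemma regular_curveD (a c : R) u : regular_curve a u -> regular_curve a (fun x => c + u x).
Proof.
move=> [du [L uL] [K uK]].
have dE : derive1 (fun x => c + u x) = derive1 u.
  apply/funext => x; apply: is_derive1E; rewrite -[derive1 u x]add0r.
  exact: is_derive1D (is_derive1C c x) (is_derive1_derive1 (du x)).
rewrite /regular_curve dE; split; [|by exists L|by exists K].
by move=> x; apply: derivableD => //; exact: derivable_cst.
Qed.

End SobolevRegularity.

(** * Boundary values as limits *)

Section Traces.
Context {R : realType}.
Implicit Types (D O : set (plane R)) (G : plane R -> R) (z : plane R) (d e l : R).

Lemma closure_normP D z : closure D z <->
  forall d, 0 < d -> exists2 z', D z' & `|z' - z| < d.
Proof.
split=> [Dz d d0|h B /norm_nearP[d d0 dB]].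
  have [] := Dz [set z' | `|z' - z| < d]; first by apply/norm_nearP; exists d.
  by move=> z' [Dz' zz']; exists z'.
by have [z' Dz' zz'] := h d d0; exists z'; split=> //; exact: dB.
Qed.

(** [trace] is a [lim], which says something only if the limit exists; this predicate states the
    convergence itself. *)
Definition has_trace D G z l := forall e, 0 < e -> exists2 d, 0 < d &
  forall z', D z' -> `|z' - z| < d -> `|G z' - l| < e.

Lemma has_trace_trace D G z l : closure D z -> has_trace D G z l -> trace D G z = l.
Proof.
move=> Dz GL; have pF := within_nbhs_proper Dz.
apply/cvg_lim => //; apply/cvgrPdist_lt => e /GL[d d0 dG].
rewrite near_withinE; apply/norm_nearP; exists d => // z' zz' Dz'.
by rewrite distrC; exact: dG.
Qed.

Lemma has_trace_unique D G z l l' : closure D z ->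
  has_trace D G z l -> has_trace D G z l' -> l = l'.
Proof. by move=> Dz /(has_trace_trace Dz) <- /(has_trace_trace Dz) <-. Qed.

Lemma unif_continuous_trace D G z : closure D z -> unif_continuous_on D G ->
  has_trace D G z (trace D G z).
Proof.
move=> Dz /unif_continuous_onP ucG; have pF := within_nbhs_proper Dz.
have : cvg (G x @[x --> within D (nbhs z)]).
  apply/cauchy_cvgP/cauchyP => /= e /ucG[d d0 dG].
  have d20 : 0 < d / 2 by rewrite divr_gt0.
  have [z0 Dz0 zz0] := (closure_normP D z).1 Dz _ d20.
  exists (G z0).
  suff : \forall z' \near within D (nbhs z), ball (G z0) e (G z') by [].
  rewrite near_withinE; apply/norm_nearP; exists (d / 2) => // z' zz' Dz'.
  rewrite -ball_normE /=; apply: dG => //.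
  have := ler_distD z z0 z'; rewrite (distrC z z'); lra.
move=> /cvgrPdist_lt h e /h; rewrite near_withinE => /norm_nearP[d d0 dG].
by exists d => // z' Dz' zz'; rewrite distrC; exact: dG.
Qed.

Lemma trace_congr D G G' z : (forall z', D z' -> G z' = G' z') ->
  trace D G z = trace D G' z.
Proof.
move=> GG'; rewrite /trace; congr lim; apply/funext => A; apply/propext.
have inc (G1 G2 : plane R -> R) : (forall z', D z' -> G1 z' = G2 z') ->
    nbhs z [set x | D x -> A (G1 x)] -> nbhs z [set x | D x -> A (G2 x)].
  by move=> GE; apply: filterS => z' h Dz'; rewrite -GE//; exact: h.
by split; apply: inc => // z' Dz'; rewrite GG'.
Qed.

Lemma has_trace_congr D G G' z l : (forall z', D z' -> G z' = G' z') ->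
  has_trace D G z l -> has_trace D G' z l.
Proof.
move=> GG' h e /h[d d0 dG]; exists d => // z' Dz' zz'.
by rewrite -GG'//; exact: dG.
Qed.

Lemma has_trace_near D D' G z l d : 0 < d ->
  (forall z', D' z' -> `|z' - z| < d -> D z') ->
  has_trace D G z l -> has_trace D' G z l.
Proof.
move=> d0 DD' h e /h[d' d'0 dG]; exists (Num.min d d'); first by rewrite lt_min d0.
move=> z' Dz'; rewrite lt_min => /andP[h1 h2]; apply: dG => //; exact: DD'.
Qed.

Lemma has_traceU D D' G z l : has_trace D G z l -> has_trace D' G z l ->
  has_trace (D `|` D') G z l.
Proof.
move=> h h' e e0; have [d d0 dG] := h e e0; have [d' d'0 dG'] := h' e e0.
exists (Num.min d d') => [|z' Dz']; first by rewrite lt_min d0.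
rewrite lt_min => /andP[h1 h2].
by case: Dz' => Dz'; [exact: dG|exact: dG'].
Qed.

Lemma has_traceD D G G' z l l' : has_trace D G z l -> has_trace D G' z l' ->
  has_trace D (fun z' => G z' + G' z') z (l + l').
Proof.
move=> h h' e e0; have e20 : 0 < e / 2 by rewrite divr_gt0.
have [d d0 dG] := h _ e20; have [d' d'0 dG'] := h' _ e20.
exists (Num.min d d') => [|z' Dz']; first by rewrite lt_min d0.
rewrite lt_min => /andP[h1 h2]; have e1 := dG _ Dz' h1; have e2 := dG' _ Dz' h2.
have -> : G z' + G' z' - (l + l') = (G z' - l) + (G' z' - l') by ring.
apply: (le_lt_trans (ler_normD _ _)); lra.
Qed.

Lemma has_traceZ D G z l (c : R) : has_trace D G z l ->
  has_trace D (fun z' => c * G z') z (c * l).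
Proof.
move=> h e e0; have c0 : 0 < `|c| + 1 by rewrite ltr_wpDl.
have [d d0 dG] := h (e / (`|c| + 1)) (divr_gt0 e0 c0).
exists d => // z' Dz' zz'; rewrite -mulrBr normrM.
have := dG _ Dz' zz'; rewrite ltr_pdivlMr// => /le_lt_trans; apply.
by rewrite mulrC ler_wpM2l// lerDl.
Qed.

Lemma has_trace_continuous D G z : {for z, continuous G} -> has_trace D G z (G z).
Proof.
move=> /cvgrPdist_lt cG e /cG /norm_nearP[d d0 dG].
by exists d => // z' _ zz'; rewrite distrC; exact: dG.
Qed.

Lemma has_trace_vertical D G z l (s : R) : `|s| <= 1 ->
  (\forall n \near \oo, D (z.1, z.2 + s * n.+1%:R^-1)) -> has_trace D G z l ->
  G (z.1, z.2 + s * n.+1%:R^-1) @[n --> \oo] --> l.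
Proof.
move=> s1 Dn GL; apply/cvgrPdist_lt => e /GL[d d0 dG].
have /cvgrPdist_lt/(_ d d0) hd := @cvg_invS R.
near=> n; rewrite distrC; apply: dG; first by near: n.
rewrite norm_plane /= subrr normr0 (addrC z.2) addrK gt_max d0 normrM.
have : `|0 - (n.+1%:R : R)^-1| < d by near: n.
rewrite sub0r normrN; apply: le_lt_trans.
by rewrite ler_piMl.
Unshelve. all: by end_near. Qed.

Lemma trace_interior O G z : open O -> O z -> {for z, continuous G} -> trace O G z = G z.
Proof.
move=> oO Oz cG; apply: has_trace_trace; last exact: has_trace_continuous.
exact: subset_closure.
Qed.

(** The trace at z' is approximated by a value of G at a point of O that is close to z' and still
    close to z. *)
Lemma continuous_trace O G : (forall z, closure O z) ->
  (forall z, exists l, has_trace O G z l) -> continuous (trace O G).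
Proof.
move=> dO hO.
have ht z : has_trace O G z (trace O G z).
  by have [l hl] := hO z; rewrite (has_trace_trace (dO z) hl).
move=> z; apply/cvgrPdist_lt => e e0; have e20 : 0 < e / 2 by rewrite divr_gt0.
have [d d0 dG] := ht z _ e20.
suff : \forall z' \near z, `|trace O G z - trace O G z'| < e by [].
apply/norm_nearP; exists d => // z' zz'.
have [d' d'0 dG'] := ht z' _ e20.
have m0 : 0 < Num.min d' (d - `|z' - z|) by rewrite lt_min d'0 subr_gt0.
have [y Oy] := (closure_normP O z').1 (dO z') _ m0.
rewrite lt_min => /andP[yz' yz].
have e1 := dG' _ Oy yz'.
have e2 : `|G y - trace O G z| < e / 2.
  by apply: dG => //; apply: (le_lt_trans (ler_distD z' _ _)); lra.
apply: (le_lt_trans (ler_distD (G y) _ _)); rewrite [ltRHS]splitr.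
by apply: ltrD; rewrite // distrC.
Qed.

End Traces.

(** * The three layers, their closures and common boundaries *)

Section Domains.
Context {R : realType}.
Implicit Types (z : plane R) (F : R -> R).

Lemma near_above F z : continuous F -> above F z -> \forall z' \near z, above F z'.
Proof.
move=> cF /= zF; have e0 : 0 < (z.2 - F z.1) / 2 by rewrite divr_gt0// subr_gt0.
have /cvgrPdist_lt/(_ _ e0)/norm_nearP[d d0 dF] := cF z.1.
have m0 : 0 < Num.min d ((z.2 - F z.1) / 2) by rewrite lt_min d0.
apply/norm_nearP; exists (Num.min d ((z.2 - F z.1) / 2)) => // z'.
rewrite norm_plane lt_min !gt_max /= => /andP[/andP[h1 _] /andP[_ h2]].
have := dF _ h1; move: h2; rewrite !ltr_norml /above /=.
by move=> /andP[? ?] /andP[? ?]; lra.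
Qed.

Lemma open_above F : continuous F -> open (above F).
Proof. by move=> cF; rewrite openE => z zF; exact: near_above. Qed.

Lemma below_mirror F : below F = mirror @^-1` above (fun x => - F x).
Proof. by apply/seteqP; split => z; rewrite /= above_mirror. Qed.

Lemma continuous_mirror : continuous (@mirror R).
Proof.
move=> z; apply/cvgrPdist_lt => e e0.
suff : \forall z' \near z, `|mirror z - mirror z'| < e by [].
by apply/norm_nearP; exists e => // z'; rewrite mirrorB distrC.
Qed.

Lemma open_below F : continuous F -> open (below F).
Proof.
move=> cF; rewrite below_mirror; apply: open_comp; last first.
  by apply: open_above => x; apply: cvgN; exact: cF.
by move=> z _; exact: continuous_mirror.
Qed.

Lemma closure_above F : continuous F -> closure (above F) = [set z | F z.1 <= z.2].
Proof.
move=> cF; apply/seteqP; split => z /=.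
  move=> zF; rewrite leNgt; apply/negP => /(open_near (open_below cF))/zF[z'].
  by rewrite /above /below /= => -[/lt_trans h /h]; rewrite ltxx.
move=> zF; apply/closure_normP => d d0; exists (z.1, z.2 + d / 2).
  by rewrite /above /=; lra.
rewrite norm_plane /= subrr normr0 (addrC z.2) addrK gt_max d0 gtr0_norm; lra.
Qed.

Lemma closure_below F : continuous F -> closure (below F) = [set z | z.2 <= F z.1].
Proof.
move=> cF; apply/seteqP; split => z /=.
  move=> zF; rewrite leNgt; apply/negP => /(open_near (open_above cF))/zF[z'].
  by rewrite /above /below /= => -[/lt_trans h /h]; rewrite ltxx.
move=> zF; apply/closure_normP => d d0; exists (z.1, z.2 - d / 2).
  by rewrite /below /=; lra.
rewrite norm_plane /= subrr normr0 (addrC z.2) addrK normrN gt_max d0 gtr0_norm; lra.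
Qed.

Context (F1 F2 : R -> R).
Hypotheses (cF1 : continuous F1) (cF2 : continuous F2).

Lemma betweenE : between F1 F2 = below F1 `&` above F2.
Proof.
rewrite /between closureU (closure_above cF1) (closure_below cF2).
apply/seteqP; split => z; rewrite /above /below /= not_orE !ltNge.
  by move=> [/negP ? /negP ?].
by move=> [/negP ? /negP ?].
Qed.

Lemma open_between : open (between F1 F2).
Proof.
by rewrite betweenE; apply: openI; [exact: open_below|exact: open_above].
Qed.

Hypothesis F21 : forall x, F2 x < F1 x.

Lemma closure_between : closure (between F1 F2) = [set z | F2 z.1 <= z.2 <= F1 z.1].
Proof.
rewrite betweenE; apply/seteqP; split => z /=.
  move=> /closureI[]; rewrite closure_below// closure_above// /=.
  by move=> -> ->.
move=> /andP[z2 z1]; apply/closure_normP => d d0; have h := F21 z.1.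
have [e0 [ed eF]] : 0 < Num.min d ((F1 z.1 - F2 z.1) / 2) / 2 /\
    (Num.min d ((F1 z.1 - F2 z.1) / 2) <= d /\ Num.min d ((F1 z.1 - F2 z.1) / 2) <= (F1 z.1 - F2 z.1) / 2).
  by rewrite !ge_min !lexx orbT divr_gt0// lt_min d0 divr_gt0// subr_gt0.
move: e0 ed eF; set e := Num.min _ _ => e0 ed eF.
have [zm|zm] := leP (z.2 + e / 2) (F1 z.1 - e / 2).
  exists (z.1, z.2 + e / 2); first by rewrite /below /above /=; split; lra.
  by rewrite norm_plane /= subrr normr0 (addrC z.2) addrK gt_max d0 gtr0_norm//; lra.
exists (z.1, z.2 - e / 2); first by rewrite /below /above /=; split; lra.
by rewrite norm_plane /= subrr normr0 (addrC z.2) addrK normrN gt_max d0 gtr0_norm//; lra.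
Qed.

Lemma boundary_above_between z :
  (boundary (above F1) `&` boundary (between F1 F2)) z <-> z.2 = F1 z.1.
Proof.
rewrite /boundary closure_above// closure_between//.
rewrite ((interior_id _).1 (open_above cF1)) ((interior_id _).1 open_between) betweenE.
rewrite /above /below /=; split=> [[[h1 h2] _]|zF].
  by apply/eqP; rewrite eq_le h1 andbT leNgt; exact/negP.
have := F21 z.1; rewrite zF lexx ltxx => h; rewrite (ltW h).
by split; split=> // -[].
Qed.

Lemma boundary_between_below z :
  (boundary (between F1 F2) `&` boundary (below F2)) z <-> z.2 = F2 z.1.
Proof.
rewrite /boundary closure_below// closure_between//.
rewrite ((interior_id _).1 (open_below cF2)) ((interior_id _).1 open_between) betweenE.
rewrite /above /below /=; split=> [[_ [h1 h2]]|zF].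
  by apply/eqP; rewrite eq_le h1 /= leNgt; exact/negP.
have := F21 z.1; rewrite zF lexx ltxx => h; rewrite (ltW h).
by split; split=> // -[].
Qed.

Lemma dense_off_curves z : closure (above F1 `|` between F1 F2 `|` below F2) z.
Proof.
rewrite !closureU closure_above// closure_between// closure_below//=.
have [h|h] := leP (F1 z.1) z.2; first by left; left.
have [h'|h'] := leP z.2 (F2 z.1); first by right.
by left; right; rewrite (ltW h) (ltW h').
Qed.

End Domains.

(** * Functions with the regularity and decay of a velocity component *)

Section Tame.
Context {R : realType}.
Implicit Types (D : set (plane R)) (G : plane R -> R) (F w : R -> R) (z : plane R).
Implicit Types (a p q : R).

Definition tame D G : Prop :=
  [/\ BUC D G, Cinfty D G &
      forall e, 0 < e -> exists M, forall z, D z -> M < `|z| -> `|G z| < e].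

Definition one_sided F D : Prop := D `<=` above F \/ D `<=` below F.

Lemma holder_unif_continuous D G a (C : R) : 0 < a -> 0 <= C ->
  (forall z z', D z -> D z' -> `|G z - G z'| <= C * `|z - z'| `^ a) ->
  unif_continuous_on D G.
Proof.
move=> a0 C0 h; apply/unif_continuous_onP => e e0.
have C1 : 0 < C + 1 by rewrite ltr_wpDl.
have e1 : 0 < e / (C + 1) by rewrite divr_gt0.
exists ((e / (C + 1)) `^ a^-1); first by rewrite powR_gt0.
move=> z z' Dz Dz' zz'; apply: (le_lt_trans (h _ _ Dz Dz')).
have : `|z - z'| `^ a < e / (C + 1).
  rewrite [ltRHS](_ : _ = ((e / (C + 1)) `^ a^-1) `^ a); last first.
    by rewrite -powRrM mulVf ?gt_eqF// powRr1// ltW.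
  have mono (t u : R) : 0 <= t -> t < u -> t `^ a < u `^ a.
    by move=> t0 tu; apply: gt0_ltr_powR => //; rewrite nnegrE// (le_trans t0)// ltW.
  by apply: mono; [exact: normr_ge0|exact: zz'].
rewrite ltr_pdivlMr// => /(le_lt_trans _); apply.
by rewrite mulrC ler_wpM2l ?powR_ge0// lerDl.
Qed.

Lemma bounded_onP D G : [bounded G z | z in D] <-> exists M, forall z, D z -> `|G z| <= M.
Proof.
split=> [[M [_ hM]]|[M hM]].
  by exists (M + 1); apply: (hM (M + 1)); rewrite ltrDl.
by exists M; split; [exact: num_real|move=> N MN z /hM /le_trans; apply; exact: ltW].
Qed.

Lemma unif_continuous_on_lin D G G' (c d : R) : unif_continuous_on D G ->
  unif_continuous_on D G' -> unif_continuous_on D (fun z => c * G z + d * G' z).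
Proof.
move=> /unif_continuous_onP hG /unif_continuous_onP hG'; apply/unif_continuous_onP => e e0.
pose K := `|c| + `|d| + 1; have K0 : 0 < K by rewrite ltr_wpDl// addr_ge0.
have eK : 0 < e / K by rewrite divr_gt0.
have [r r0 rG] := hG _ eK; have [r' r'0 rG'] := hG' _ eK.
exists (Num.min r r'); first by rewrite lt_min r0.
move=> z z' Dz Dz'; rewrite lt_min => /andP[h1 h2].
have e1 := ltW (rG _ _ Dz Dz' h1); have e2 := ltW (rG' _ _ Dz Dz' h2).
have -> : c * G z + d * G' z - (c * G z' + d * G' z') =
  c * (G z - G z') + d * (G' z - G' z') by ring.
apply: (le_lt_trans (ler_normD _ _)); rewrite !normrM.
apply: (@le_lt_trans _ _ (`|c| * (e / K) + `|d| * (e / K))).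
  by apply: lerD; apply: ler_wpM2l.
by rewrite -mulrDl mulrCA -[ltRHS]mulr1 ltr_pM2l// ltr_pdivrMr// mul1r ltrDl.
Qed.

Lemma BUC_lin D G G' (c d : R) : BUC D G -> BUC D G' ->
  BUC D (fun z => c * G z + d * G' z).
Proof.
move=> [/bounded_onP[M GM] uG] [/bounded_onP[M' GM'] uG']; split; last first.
  exact: unif_continuous_on_lin.
apply/bounded_onP; exists (`|c| * M + `|d| * M') => z Dz.
apply: (le_trans (ler_normD _ _)); rewrite !normrM.
by apply: lerD; apply: ler_wpM2l => //; [exact: GM|exact: GM'].
Qed.

Lemma tame_lin D G G' (c d : R) : open D -> tame D G -> tame D G' ->
  tame D (fun z => c * G z + d * G' z).
Proof.
move=> oD [bG CG vG] [bG' CG' vG']; split; first exact: BUC_lin.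
  by move=> n; exact: Cn_lin.
move=> e e0; pose K := `|c| + `|d| + 1; have K0 : 0 < K by rewrite ltr_wpDl// addr_ge0.
have eK : 0 < e / K by rewrite divr_gt0.
have [M GM] := vG _ eK; have [M' GM'] := vG' _ eK.
exists (Num.max M M') => z Dz; rewrite gt_max => /andP[h1 h2].
apply: (le_lt_trans (ler_normD _ _)); rewrite !normrM.
have e1 := ltW (GM _ Dz h1); have e2 := ltW (GM' _ Dz h2).
apply: (@le_lt_trans _ _ (`|c| * (e / K) + `|d| * (e / K))).
  by apply: lerD; apply: ler_wpM2l.
by rewrite -mulrDl mulrCA -[ltRHS]mulr1 ltr_pM2l// ltr_pdivrMr// mul1r ltrDl.
Qed.

Lemma BUC_sub D D' G : D' `<=` D -> BUC D G -> BUC D' G.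
Proof.
move=> DD' [/bounded_onP[M GM] /unif_continuous_onP uG]; split.
  by apply/bounded_onP; exists M => z /DD'; exact: GM.
apply/unif_continuous_onP => e /uG[d d0 h]; exists d => // z z' /DD' Dz /DD'; exact: h.
Qed.

Lemma density_mul a w v : 0 < a -> density a w -> (exists M, forall x, `|v x| <= M) ->
  (exists K, holder_fun a K v) -> density a (fun s => w s * v s).
Proof.
move=> a0 [[M wM] [K wK] wi] [M' vM] [K' vK].
have M0 : 0 <= M by apply: le_trans (wM 0).
have M0' : 0 <= M' by apply: le_trans (vM 0).
have cw := holder_continuous a0 wK; have cv := holder_continuous a0 vK.
split.
- by exists (M * M') => x; rewrite normrM; apply: ler_pM.
- exists (M * K' + K * M') => x y.
  have -> : w x * v x - w y * v y = w x * (v x - v y) + (w x - w y) * v y by ring.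
  apply: (le_trans (ler_normD _ _)); rewrite !normrM.
  rewrite (_ : (_ + _) * _ = M * (K' * `|x - y| `^ a) + K * `|x - y| `^ a * M'); last by ring.
  by apply: lerD; apply: ler_pM.
- apply: (@dominated_integrable _ _ (fun s => M' ^+ 2 * w s ^+ 2)).
  + apply: measurable_funX; apply: continuous_measurable_fun => x.
    by apply: cvgM; [exact: cw|exact: cv].
  + exact: integrableTZ.
  + move=> x; rewrite ger0_norm ?sqr_ge0// exprMn mulrC ler_wpM2r ?sqr_ge0//.
    by rewrite -(real_normK (num_real (v x))) ler_sqr ?nnegrE.
Qed.

Section Layer.
Context (a : R) (F w : R -> R) (a01 : 0 < a < 1).
Hypotheses (rF : regular_curve a F) (dw : density a w).

Let a0 : 0 < a. Proof. by case/andP: a01. Qed.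

Lemma cauchy_bounded_below p q :
  exists B, forall z, below F z -> `|cauchy_int p q 1 F w z| <= B.
Proof.
have [B BP] := cauchy_bounded_above p (- q) a01 (regular_curveN rF) dw.
exists B => z zF; rewrite cauchy_int_mirror; apply: BP.
by rewrite above_mirror.
Qed.

Lemma cauchy_vanishes_below p q e : 0 < e ->
  exists r, forall z, below F z -> r < `|z| -> `|cauchy_int p q 1 F w z| < e.
Proof.
move=> /(cauchy_vanishes_above p (- q) a01 (regular_curveN rF) dw)[r rP].
exists r => z zF rz; rewrite cauchy_int_mirror; apply: rP; last by rewrite norm_mirror.
by rewrite above_mirror.
Qed.

Lemma one_sided_off_curve D : one_sided F D -> D `<=` off_curve F.
Proof.
by move=> [] DF z /DF; [exact: above_off_curve|exact: below_off_curve].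
Qed.

Lemma tame_cauchy D p q : open D -> one_sided F D -> tame D (cauchy_int p q 1 F w).
Proof.
move=> oD sD; have [L FL] := regular_curve_lipschitz rF.
have [dF _ _] := rF; have [_ _ wi] := dw; have cw := density_continuous a0 dw.
split=> [|n|e e0].
- case: sD => DF.
    have [C C0 CP] := cauchy_holder_above p q a01 rF dw.
    have [B BP] := cauchy_bounded_above p q a01 rF dw.
    apply: (BUC_sub DF); split; last exact: holder_unif_continuous CP.
    by apply/bounded_onP; exists B.
  have [C C0 CP] := cauchy_holder_below p q a01 rF dw.
  have [B BP] := cauchy_bounded_below p q.
  apply: (BUC_sub DF); split; last exact: holder_unif_continuous CP.
  by apply/bounded_onP; exists B.
- by apply: (Cn_cauchy dF FL cw wi) => //; exact: one_sided_off_curve.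
- case: sD => DF.
    have [r rP] := cauchy_vanishes_above p q a01 rF dw e0.
    by exists r => z /DF; exact: rP.
  have [r rP] := cauchy_vanishes_below p q e0.
  by exists r => z /DF; exact: rP.
Qed.

End Layer.

Section Potential.
Context (a : R) (F f f' : R -> R) (a01 : 0 < a < 1).
Hypotheses (rF : regular_curve a F) (df : density a f) (df' : density a f').
Hypothesis ff' : forall x : R, is_derive x 1 f (f' x).

Let a0 : 0 < a. Proof. by case/andP: a01. Qed.

(* By parts, the gradient of pot p q is the pair of integrals with density f'
   and parameters (p, q), (q, - p). *)
Definition pot p q z := cauchy_int p q 1 F f z +
  cauchy_int q (- p) 1 F (fun s => f s * derive1 F s) z.

Lemma density_mul_derive : density a (fun s => f s * derive1 F s).
Proof. by case: rF => _ F'L F'K; exact: density_mul. Qed.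

Lemma tame_pot D p q : open D -> one_sided F D -> tame D (pot p q).
Proof.
move=> oD sD; have := tame_lin 1 1 oD (tame_cauchy a01 rF df p q oD sD)
  (tame_cauchy a01 rF density_mul_derive q (- p) oD sD).
by congr tame; apply/funext => z; rewrite /pot !mul1r.
Qed.

Let by_parts p q z : off_curve F z ->
  cauchy_int p q 1 F f' z = - 1%:R * cauchy_int p q 2 F f z -
    1%:R * cauchy_int q (- p) 2 F (fun s => f s * derive1 F s) z.
Proof.
move=> zF; have [dF [L F'L] [K F'K]] := rF.
have FL := derive_bounded_lipschitz dF F'L.
have [[M fM] _ fi] := df; have [_ _ f'i] := df'.
have [_ _ gi] := density_mul_derive.
have cf := density_continuous a0 df; have cg := density_continuous a0 density_mul_derive.
rewrite (cauchy_by_parts dF FL (holder_continuous a0 F'K) F'L p q ff'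
  (density_continuous a0 df') fM f'i zF).
have i1 := integrable_cauchy dF FL cf fi p q 1 zF.
have i2 := integrable_cauchy dF FL cg gi q (- p) 1 zF.
rewrite !mul1r mulN1r -opprD /cauchy_int -RintegralD//; congr (- _).
by apply: eq_Rintegral => s _; ring.
Qed.

Lemma is_derive_pot_dx p q z : off_curve F z ->
  is_derive z (1, 0) (pot p q) (cauchy_int p q 1 F f' z).
Proof.
move=> zF; rewrite by_parts// -mulNr; have [L FL] := regular_curve_lipschitz rF.
have [dF _ _] := rF; have [_ _ fi] := df; have [_ _ gi] := density_mul_derive.
have cf := density_continuous a0 df; have cg := density_continuous a0 density_mul_derive.
apply: is_deriveD.
  exact: (is_derive_cauchy_dx dF FL cf fi).
exact: (is_derive_cauchy_dx dF FL cg gi).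
Qed.

Lemma is_derive_pot_dy p q z : off_curve F z ->
  is_derive z (0, 1) (pot p q) (cauchy_int q (- p) 1 F f' z).
Proof.
move=> zF; rewrite by_parts// -mulNr; have [L FL] := regular_curve_lipschitz rF.
have [dF _ _] := rF; have [_ _ fi] := df; have [_ _ gi] := density_mul_derive.
have cf := density_continuous a0 df; have cg := density_continuous a0 density_mul_derive.
apply: is_deriveD.
  exact: (is_derive_cauchy_dy dF FL cf fi).
exact: (is_derive_cauchy_dy dF FL cg gi).
Qed.

(** Write b for F'(x). By the Plemelj formula the two integrals contribute q + p b and b (q b - p),
    with sum q (1 + b^2), which cancels the denominator. *)
Lemma pot_jump p q x :
  pot p q (x, F x + n.+1%:R^-1) - pot p q (x, F x - n.+1%:R^-1) @[n --> \oo] -->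
  - (2 * pi) * f x * q.
Proof.
have [dF [L F'L] [K F'K]] := rF; have FL := derive_bounded_lipschitz dF F'L.
have cf := density_continuous a0 df; have cg := density_continuous a0 density_mul_derive.
have [[M fM] _ fi] := df; have [[N gN] _ gi] := density_mul_derive.
have h1 := @cauchy_jump _ _ _ _ _ dF FL cf fM fi p q x.
have h2 := @cauchy_jump _ _ _ _ _ dF FL cg gN gi q (- p) x.
have := cvgD h1 h2; rewrite (_ : _ + _ = - (2 * pi) * f x * q); last first.
  by field; rewrite gt_eqF// ltr_pwDl// sqr_ge0.
move=> /(_ (eventually_filter)) h; apply: (cvg_trans _ h); apply: near_eq_cvg; apply: nearW => n; rewrite !fctE /pot; ring.
Qed.

End Potential.

End Tame.

(** * Jumps along vertical sequences *)

Section JumpLimits.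
Context {R : realType}.
Implicit Types (D : set (plane R)) (G : plane R -> R) (z : plane R) (l : R).

(** One sequence on each side is enough to determine the difference of traces of functions that are
    uniformly continuous on both sides ([trace_jump]). *)
Definition jump_lim G z l :=
  G (z.1, z.2 + n.+1%:R^-1) - G (z.1, z.2 - n.+1%:R^-1) @[n --> \oo] --> l.

Lemma jump_lim_lin G G' z l l' (c d : R) : jump_lim G z l -> jump_lim G' z l' ->
  jump_lim (fun z => c * G z + d * G' z) z (c * l + d * l').
Proof.
move=> h h'.
have := cvgD (cvgM (cvg_cst c) h) (cvgM (cvg_cst d) h').
do 5 move=> /(_ eventually_filter).
move=> {}h; apply: (cvg_trans _ h); apply: near_eq_cvg.
by apply: nearW => n; rewrite !fctE /=; ring.
Qed.

Lemma jump_lim_continuous G z : {for z, continuous G} -> jump_lim G z 0.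
Proof.
move=> cG; have ht := @has_trace_continuous R setT G z cG.
have s1 : `|1| <= 1 :> R by rewrite normr1.
have s2 : `|- 1| <= 1 :> R by rewrite normrN normr1.
have hT (s : R) : \forall n \near \oo, [set: plane R] (z.1, z.2 + s * n.+1%:R^-1).
  exact: nearW.
have h1 := @has_trace_vertical R setT G z _ 1 s1 (hT 1) ht.
have h2 := @has_trace_vertical R setT G z _ (- 1) s2 (hT (- 1)) ht.
have := cvgB h1 h2; rewrite subrr => /(_ eventually_filter) h.
apply: (cvg_trans _ h); apply: near_eq_cvg; apply: nearW => n.
by rewrite !fctE mul1r mulN1r.
Qed.

Lemma trace_jump D D' G z l : closure D z -> closure D' z ->
  (\forall n \near \oo, D (z.1, z.2 + n.+1%:R^-1)) ->
  (\forall n \near \oo, D' (z.1, z.2 - n.+1%:R^-1)) ->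
  unif_continuous_on D G -> unif_continuous_on D' G -> jump_lim G z l ->
  trace D G z - trace D' G z = l.
Proof.
move=> Dz D'z Dn D'n uD uD' hl.
have s1 : `|1| <= 1 :> R by rewrite normr1.
have s2 : `|- 1| <= 1 :> R by rewrite normrN normr1.
have h1 : G (z.1, z.2 + n.+1%:R^-1) @[n --> \oo] --> trace D G z.
  under eq_fun do rewrite -[X in _ + X]mul1r.
  apply: (has_trace_vertical s1) (unif_continuous_trace Dz uD).
  by apply: filterS Dn => n; rewrite mul1r.
have h2 : G (z.1, z.2 - n.+1%:R^-1) @[n --> \oo] --> trace D' G z.
  under eq_fun do rewrite -[X in _ + X]mulN1r.
  apply: (has_trace_vertical s2) (unif_continuous_trace D'z uD').
  by apply: filterS D'n => n; rewrite mulN1r.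
have /(_ eventually_filter) h := cvgB h1 h2.
exact: (@cvg_unique _ (@Rhausdorff R) _ _ _ _ h hl).
Qed.

End JumpLimits.

(** * The velocity field, its potential and the pressure *)

Section Velocity.
Context {R : realType}.
Context (a : R) (F1 F2 f1 f2 w1 w2 : R -> R) (A B : R) (a01 : 0 < a < 1).
Hypotheses (rF1 : regular_curve a F1) (df1 : density a f1) (dw1 : density a w1)
  (fw1 : forall x : R, is_derive x 1 f1 (w1 x)).
Hypotheses (rF2 : regular_curve a F2) (df2 : density a f2) (dw2 : density a w2)
  (fw2 : forall x : R, is_derive x 1 f2 (w2 x)).
Implicit Types (D : set (plane R)) (z : plane R).

Definition potential p q z := A * pot F1 f1 p q z + B * pot F2 f2 p q z.

Definition field p q z :=
  A * cauchy_int p q 1 F1 w1 z + B * cauchy_int p q 1 F2 w2 z.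

(** The parameters (0, 1) and (1, 0) select the imaginary and the real part of 1 / Z, which are the
    components of the kernel. *)
Definition velocity z : plane R := (field 0 1 z, field 1 0 z).

Lemma tame_field D p q : open D -> one_sided F1 D -> one_sided F2 D ->
  tame D (field p q).
Proof. by move=> oD h1 h2; apply: tame_lin => //; exact: (tame_cauchy a01). Qed.

Lemma tame_potential D p q : open D -> one_sided F1 D -> one_sided F2 D ->
  tame D (potential p q).
Proof. by move=> oD h1 h2; apply: tame_lin => //; exact: (tame_pot a01). Qed.

Lemma is_derive_potential_dx p q z : off_curve F1 z -> off_curve F2 z ->
  is_derive z (1, 0) (potential p q) (field p q z).
Proof.
move=> z1 z2; apply: is_deriveD; apply: is_deriveZ.
  exact: (is_derive_pot_dx a01 rF1 df1 dw1 fw1).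
exact: (is_derive_pot_dx a01 rF2 df2 dw2 fw2).
Qed.

Lemma is_derive_potential_dy p q z : off_curve F1 z -> off_curve F2 z ->
  is_derive z (0, 1) (potential p q) (field q (- p) z).
Proof.
move=> z1 z2; apply: is_deriveD; apply: is_deriveZ.
  exact: (is_derive_pot_dy a01 rF1 df1 dw1 fw1).
exact: (is_derive_pot_dy a01 rF2 df2 dw2 fw2).
Qed.

(** Passing from (p, q) to (q, -p) and differentiating in y both multiply by i, so the result is i^2
    = -1 times the derivative in x. For (0, 1) this says that the velocity is divergence free. *)
Lemma field_harmonic p q z : off_curve F1 z -> off_curve F2 z -> exists d,
  is_derive z (1, 0) (field p q) d /\ is_derive z (0, 1) (field q (- p)) (- d).
Proof.
move=> z1 z2; have a0 : 0 < a by case/andP: a01.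
have [L1 F1L] := regular_curve_lipschitz rF1; have [L2 F2L] := regular_curve_lipschitz rF2.
have [[dF1 _ _] [dF2 _ _]] := (rF1, rF2); have [[_ _ i1] [_ _ i2]] := (dw1, dw2).
have c1 := density_continuous a0 dw1; have c2 := density_continuous a0 dw2.
exists (A * (- 1%:R * cauchy_int p q 2 F1 w1 z) + B * (- 1%:R * cauchy_int p q 2 F2 w2 z)).
split.
  apply: is_deriveD; apply: is_deriveZ.
    exact: (is_derive_cauchy_dx dF1 F1L c1 i1).
  exact: (is_derive_cauchy_dx dF2 F2L c2 i2).
have -> : - (A * (- 1%:R * cauchy_int p q 2 F1 w1 z) +
    B * (- 1%:R * cauchy_int p q 2 F2 w2 z)) =
    A * (- 1%:R * cauchy_int (- p) (- q) 2 F1 w1 z) +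
    B * (- 1%:R * cauchy_int (- p) (- q) 2 F2 w2 z).
  rewrite -(mulN1r p) -(mulN1r q) -(cauchyZ dF1 F1L c1 i1)// -(cauchyZ dF2 F2L c2 i2)//.
  by ring.
apply: is_deriveD; apply: is_deriveZ.
  exact: (is_derive_cauchy_dy dF1 F1L c1 i1).
exact: (is_derive_cauchy_dy dF2 F2L c2 i2).
Qed.

Context (k mu g : R).
Hypotheses (k0 : k != 0) (mu0 : mu != 0).

(** Darcy's law integrated. The factors 1 give it the shape c G + d G' of the lemmas on linear
    combinations. *)
Definition pressure rho C z :=
  - (mu / k) * potential 0 1 z + 1 * (- (rho * g) * z.2 + C * 1).

Lemma unif_continuous_on_snd D : unif_continuous_on D (fun z => z.2).
Proof.
apply/unif_continuous_onP => e e0; exists e => // z z' _ _.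
by apply: le_lt_trans; rewrite [leRHS]norm_plane le_max lexx orbT.
Qed.

Lemma unif_continuous_on_cst D (c : R) : unif_continuous_on D (fun=> c).
Proof.
by apply/unif_continuous_onP => e e0; exists 1 => // z z' _ _ _; rewrite subrr normr0.
Qed.

Lemma unif_continuous_on_congr D (G G' : plane R -> R) :
  (forall z, D z -> G z = G' z) -> unif_continuous_on D G -> unif_continuous_on D G'.
Proof.
move=> GG' /unif_continuous_onP uG; apply/unif_continuous_onP => e /uG[d d0 h].
by exists d => // z z' Dz Dz'; rewrite -!GG'//; exact: h.
Qed.

Lemma is_derive_pressure_dx rho C z : off_curve F1 z -> off_curve F2 z ->
  is_derive z (1, 0) (pressure rho C) (- (mu / k) * field 0 1 z).
Proof.
move=> z1 z2; rewrite -[X in is_derive _ _ _ X]addr0.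
apply: is_deriveD; first by apply: is_deriveZ; exact: is_derive_potential_dx.
apply/is_derive_dx => /=; exact: is_derive1C.
Qed.

Lemma is_derive_pressure_dy rho C z : off_curve F1 z -> off_curve F2 z ->
  is_derive z (0, 1) (pressure rho C) (- (mu / k) * field 1 0 z - rho * g).
Proof.
move=> z1 z2; apply: is_deriveD.
  by apply: is_deriveZ; have := is_derive_potential_dy 0 1 z1 z2; rewrite oppr0.
apply/is_derive_dy => /=.
have := is_derive1Z 1 (is_derive1D (is_derive1Z (- (rho * g)) (is_derive_id z.2 1))
  (is_derive1C (C * 1) z.2)).
by rewrite (_ : 1 * (- (rho * g) * 1 + 0) = - (rho * g))//; ring.
Qed.

Lemma layer_velocity D rho C : open D -> one_sided F1 D -> one_sided F2 D ->
  layer k mu g rho D velocity (pressure rho C).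
Proof.
move=> oD h1 h2.
have D1 z : D z -> off_curve F1 z by exact: one_sided_off_curve.
have D2 z : D z -> off_curve F2 z by exact: one_sided_off_curve.
have [bV1 CV1 vV1] := tame_field 0 1 oD h1 h2.
have [bV2 CV2 vV2] := tame_field 1 0 oD h1 h2.
have [bP CP _] := tame_potential 0 1 oD h1 h2.
have px z : D z -> dx (pressure rho C) z = - (mu / k) * field 0 1 z.
  by move=> Dz; have [_] := is_derive_pressure_dx rho C (D1 z Dz) (D2 z Dz).
have py z : D z -> dy (pressure rho C) z = - (mu / k) * field 1 0 z - rho * g.
  by move=> Dz; have [_] := is_derive_pressure_dy rho C (D1 z Dz) (D2 z Dz).
have Cp n : Cn D n (pressure rho C).
  apply: (Cn_lin _ _ oD (CP n)); apply: Cn_lin => //; [exact: Cn_snd|exact: Cn_cst].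
have up : unif_continuous_on D (pressure rho C).
  apply: unif_continuous_on_lin; first by case: bP.
  apply: unif_continuous_on_lin; first exact: unif_continuous_on_snd.
  exact: unif_continuous_on_cst.
split.
- by split; split.
- split=> //; split=> //; split; first exact: up.
  split=> [z Dz||].
  + have [dpx _] := is_derive_pressure_dx rho C (D1 z Dz) (D2 z Dz).
    by have [dpy _] := is_derive_pressure_dy rho C (D1 z Dz) (D2 z Dz).
  + split=> //; apply: (@unif_continuous_on_congr _ (fun z => - (mu / k) * field 0 1 z + 0 * 0)).
      by move=> z Dz; rewrite px// mul0r addr0.
    by apply: unif_continuous_on_lin; [case: bV1|exact: unif_continuous_on_cst].
  + split=> //.
    apply: (@unif_continuous_on_congr _ (fun z => - (mu / k) * field 1 0 z + 1 * (- (rho * g)))).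
      by move=> z Dz; rewrite py// mul1r.
    by apply: unif_continuous_on_lin; [case: bV2|exact: unif_continuous_on_cst].
- move=> z Dz; rewrite /grad px// py//; apply/pair_eqP => /=.
  by apply/andP; split; apply/eqP => /=; rewrite /GRing.scale /=; field; rewrite k0.
- move=> z Dz; have [d [[_ ex] [_ ey]]] := field_harmonic 0 1 (D1 z Dz) (D2 z Dz).
  rewrite oppr0 in ey.
  by rewrite /divergence (_ : dx _ z = d)// (_ : dy _ z = - d)// subrr.
- move=> e e0; have [M1 h1'] := vV1 _ e0; have [M2 h2'] := vV2 _ e0.
  exists (Num.max M1 M2) => z Dz; rewrite gt_max => /andP[zM1 zM2].
  by rewrite norm_plane gt_max h1'// h2'.
Qed.

End Velocity.

(** * Transmission conditions *)

Section Transmission.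
Context {R : realType}.
Context (a : R) (F1 F2 f1 f2 w1 w2 : R -> R) (A B : R) (a01 : 0 < a < 1).
Hypotheses (rF1 : regular_curve a F1) (df1 : density a f1) (dw1 : density a w1).
Hypotheses (rF2 : regular_curve a F2) (df2 : density a f2) (dw2 : density a w2).
Implicit Types (D : set (plane R)) (z : plane R).

Lemma jump_lim_cauchy F w p q z : regular_curve a F -> density a w -> z.2 = F z.1 ->
  jump_lim (cauchy_int p q 1 F w) z
    (- (2 * pi) * w z.1 * (q + p * derive1 F z.1) / (1 + derive1 F z.1 ^+ 2)).
Proof.
move=> rF dw zF; have [L FL] := regular_curve_lipschitz rF.
have a0 : 0 < a by case/andP: a01.
have [dF _ _] := rF; have [[M wM] _ wi] := dw; have cw := density_continuous a0 dw.
rewrite /jump_lim zF; exact: (@cauchy_jump _ _ _ _ _ dF FL cw wM wi).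
Qed.

Lemma jump_lim_cauchy0 F w p q z : regular_curve a F -> density a w -> z.2 != F z.1 ->
  jump_lim (cauchy_int p q 1 F w) z 0.
Proof.
move=> rF dw zF; have [L FL] := regular_curve_lipschitz rF.
have a0 : 0 < a by case/andP: a01.
have [dF _ _] := rF; have [_ _ wi] := dw; have cw := density_continuous a0 dw.
by apply: jump_lim_continuous; exact: (continuous_cauchy dF FL cw wi).
Qed.

Lemma jump_lim_pot F f p q z : regular_curve a F -> density a f -> z.2 = F z.1 ->
  jump_lim (pot F f p q) z (- (2 * pi) * f z.1 * q).
Proof.
move=> rF df zF; rewrite /jump_lim zF; exact: (pot_jump a01 rF df).
Qed.

Lemma jump_lim_pot0 F f p q z : regular_curve a F -> density a f -> z.2 != F z.1 ->
  jump_lim (pot F f p q) z 0.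
Proof.
move=> rF df zF; have a0 : 0 < a by case/andP: a01.
have dg := density_mul_derive a01 rF df.
have := @jump_lim_lin _ _ _ _ _ _ 1 1 (jump_lim_cauchy0 p q rF df zF) (jump_lim_cauchy0 q (- p) rF dg zF).
rewrite !mulr0 addr0; congr (jump_lim _ _ _).
by apply/funext => z'; rewrite /pot !mul1r.
Qed.

Context (k mu g : R).

Local Notation velocity := (velocity F1 F2 w1 w2 A B).
Local Notation pressure := (pressure F1 F2 f1 f2 A B k mu g).
Local Notation field := (field F1 F2 w1 w2 A B).
Local Notation potential := (potential F1 F2 f1 f2 A B).

(** The velocity jumps by j (1, phi'), a tangent vector, hence orthogonal to the normal. The last
    hypothesis balances the jump of the potential against the hydrostatic terms. *)
Lemma transmission_velocity phi D D' rho rho' C C' z j jp :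
  open D -> open D' -> one_sided F1 D -> one_sided F2 D ->
  one_sided F1 D' -> one_sided F2 D' -> closure D z -> closure D' z ->
  (\forall n \near \oo, D (z.1, z.2 + n.+1%:R^-1)) ->
  (\forall n \near \oo, D' (z.1, z.2 - n.+1%:R^-1)) ->
  jump_lim (field 0 1) z j -> jump_lim (field 1 0) z (j * derive1 phi z.1) ->
  jump_lim (potential 0 1) z jp ->
  (mu / k) * jp = (rho' - rho) * g * z.2 + (C - C') ->
  trace D (pressure rho C) z = trace D' (pressure rho' C') z /\
  dot (trace2 D velocity z) (normal phi z.1) =
  dot (trace2 D' velocity z) (normal phi z.1).
Proof.
move=> oD oD' D1 D2 D1' D2' Dz D'z Dn D'n j1 j2 j3 jE.
have uf p q E : open E -> one_sided F1 E -> one_sided F2 E -> unif_continuous_on E (field p q).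
  move=> oE E1 E2.
  by have [[_ u] _ _] := tame_field A B a01 rF1 dw1 rF2 dw2 p q oE E1 E2.
have up E : open E -> one_sided F1 E -> one_sided F2 E -> unif_continuous_on E (potential 0 1).
  move=> oE E1 E2.
  by have [[_ u] _ _] := tame_potential A B a01 rF1 df1 rF2 df2 0 1 oE E1 E2.
have t1 := trace_jump Dz D'z Dn D'n (uf 0 1 _ oD D1 D2) (uf 0 1 _ oD' D1' D2') j1.
have t2 := trace_jump Dz D'z Dn D'n (uf 1 0 _ oD D1 D2) (uf 1 0 _ oD' D1' D2') j2.
have t3 := trace_jump Dz D'z Dn D'n (up _ oD D1 D2) (up _ oD' D1' D2') j3.
have pT E r c : closure E z -> unif_continuous_on E (potential 0 1) ->
    trace E (pressure r c) z = - (mu / k) * trace E (potential 0 1) z + 1 * (- (r * g) * z.2 + c * 1).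
  move=> Ez uE; apply: has_trace_trace => //; apply: has_traceD; apply: has_traceZ.
    exact: unif_continuous_trace.
  apply: has_traceD; first by apply: has_traceZ; apply: has_trace_continuous; exact: cvg_snd.
  by move=> e e0; exists 1 => // z' _ _; rewrite subrr normr0.
split.
  rewrite (pT D)//; last exact: up. rewrite (pT D')//; last exact: up.
  apply/eqP; rewrite -subr_eq0; apply/eqP.
  move: jE; rewrite -t3; set x1 := trace _ _ _; set x2 := trace _ _ _ => jE.
  have -> : - (mu / k) * x1 + 1 * (- (rho * g) * z.2 + C * 1) -
    (- (mu / k) * x2 + 1 * (- (rho' * g) * z.2 + C' * 1)) =
    - ((mu / k) * (x1 - x2)) + ((rho' - rho) * g * z.2 + (C - C')) by ring.
  by rewrite jE addNr.
rewrite /dot /trace2 /normal /= /GRing.scale /=.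
rewrite -[fst \o velocity]/(field 0 1) -[snd \o velocity]/(field 1 0).
have -> : trace D (field 0 1) z = trace D' (field 0 1) z + j by rewrite -t1 addrC subrK.
have -> : trace D (field 1 0) z = trace D' (field 1 0) z + j * derive1 phi z.1.
  by rewrite -t2 addrC subrK.
set x := trace D' _ z; set y := trace D' _ z; set s := _^-1; move: x y s (derive1 phi z.1) => x y s b.
by ring.
Qed.

End Transmission.

(** * Existence of a solution *)

Section Existence.
Context {R : realType}.
Context (a : R) (f h : R -> R) (c : R) (a01 : 0 < a < 1).
Hypotheses (rf : regular_curve a f) (df : density a f) (df' : density a (derive1 f)).
Hypotheses (rh : regular_curve a h) (dh : density a h) (dh' : density a (derive1 h)).
Context (k mu g rho1 rho2 rho3 : R).
Hypotheses (k0 : k != 0) (mu0 : mu != 0).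

Let cf x := c + f x.
Hypothesis hcf : forall x, h x < cf x.

Let rcf : regular_curve a cf. Proof. exact: regular_curveD. Qed.
Let ccf : continuous cf. Proof. exact: regular_curve_continuous rcf. Qed.
Let ch : continuous h. Proof. exact: regular_curve_continuous rh. Qed.

Lemma derive1_shift : derive1 cf = derive1 f.
Proof.
apply/funext => x; apply: is_derive1E; rewrite -[derive1 f x]add0r.
have [dF _ _] := rf.
exact: is_derive1D (is_derive1C c x) (is_derive1_derive1 (dF x)).
Qed.

Definition muskat_velocity : plane R -> plane R :=
  velocity cf h (derive1 f) (derive1 h)
    (k * g * (rho1 - rho2) / (2 * mu) / pi) (k * g * (rho2 - rho3) / (2 * mu) / pi).

Definition muskat_pressure (rho C : R) : plane R -> R :=
  pressure cf h f h
    (k * g * (rho1 - rho2) / (2 * mu) / pi) (k * g * (rho2 - rho3) / (2 * mu) / pi)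
    k mu g rho C.

Lemma one_sided_above : one_sided cf (above cf) /\ one_sided h (above cf).
Proof. by split; left => // z; apply: lt_trans. Qed.

Lemma one_sided_below : one_sided cf (below h) /\ one_sided h (below h).
Proof. by split; right => // z /lt_trans; apply. Qed.

Lemma one_sided_between : one_sided cf (between cf h) /\ one_sided h (between cf h).
Proof. by rewrite betweenE//; split; [right|left] => z []. Qed.

Lemma near_between_upper z : z.2 = cf z.1 ->
  \forall n \near \oo, between cf h (z.1, z.2 - n.+1%:R^-1).
Proof.
move=> zE; have e0 : 0 < cf z.1 - h z.1 by rewrite subr_gt0.
have /cvgrPdist_lt/(_ _ e0) := @cvg_invS R; apply: filterS => n.
have n0 : 0 < (n.+1%:R : R)^-1 by rewrite invr_gt0.
rewrite sub0r normrN gtr0_norm// betweenE// => nh; rewrite /below /above /setI /= zE.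
by move: nh; set t := _^-1 in n0 *; split; lra.
Qed.

Lemma near_between_lower z : z.2 = h z.1 ->
  \forall n \near \oo, between cf h (z.1, z.2 + n.+1%:R^-1).
Proof.
move=> zE; have e0 : 0 < cf z.1 - h z.1 by rewrite subr_gt0.
have /cvgrPdist_lt/(_ _ e0) := @cvg_invS R; apply: filterS => n.
have n0 : 0 < (n.+1%:R : R)^-1 by rewrite invr_gt0.
rewrite sub0r normrN gtr0_norm// betweenE// => nh; rewrite /below /above /setI /= zE.
by move: nh; set t := _^-1 in n0 *; split; lra.
Qed.

(** On the upper curve the potential jumps by a multiple of f while the hydrostatic term involves
    the height c + f; the extra constant in the top pressure compensates c. *)
Theorem muskat_exists C : muskat_solution k mu g rho1 rho2 rho3 cf h
  muskat_velocity muskat_velocity muskat_velocity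
  (muskat_pressure rho1 (C + (rho1 - rho2) * g * c))
  (muskat_pressure rho2 C) (muskat_pressure rho3 C).
Proof.
have [s11 s12] := one_sided_above; have [s21 s22] := one_sided_between.
have [s31 s32] := one_sided_below.
have oD1 := open_above ccf; have oD2 := open_between ccf ch; have oD3 := open_below ch.
have [df0 _ _] := rf; have [dh0 _ _] := rh.
have ff' x : is_derive (x : R) 1 f (derive1 f x) by exact: is_derive1_derive1.
have hh' x : is_derive (x : R) 1 h (derive1 h x) by exact: is_derive1_derive1.
have n0 x : 0 < (x.+1%:R : R)^-1 by rewrite invr_gt0.
have q0 (F : R -> R) x : 1 + derive1 F x ^+ 2 != 0.
  by rewrite gt_eqF// ltr_pwDl// sqr_ge0.
have pi0 : pi != 0 :> R by rewrite gt_eqF// pi_gt0.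
split.
- exact: (layer_velocity _ _ a01 rcf df df' ff' rh dh dh' hh').
- exact: (layer_velocity _ _ a01 rcf df df' ff' rh dh dh' hh').
- exact: (layer_velocity _ _ a01 rcf df df' ff' rh dh dh' hh').
- move=> z /(boundary_above_between ccf ch hcf) zE.
  have zh : z.2 != h z.1 by rewrite zE gt_eqF.
  apply: (transmission_velocity a01 rcf df df' rh dh dh' oD1 oD2 s11 s12 s21 s22) => //.
  + by rewrite closure_above//= zE.
  + by rewrite closure_between//= zE lexx ltW.
  + by apply: nearW => n; rewrite /above /= zE ltrDl.
  + exact: near_between_upper.
  + by apply: jump_lim_lin; [exact: (jump_lim_cauchy a01)|exact: (jump_lim_cauchy0 a01)].
  + rewrite (_ : _ * derive1 cf z.1 = k * g * (rho1 - rho2) / (2 * mu) / pi *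
      (- (2 * pi) * derive1 f z.1 * (0 + 1 * derive1 cf z.1) / (1 + derive1 cf z.1 ^+ 2)) +
      k * g * (rho2 - rho3) / (2 * mu) / pi * 0); last first.
      by move: (pi : R) pi0 => P P0; field; rewrite ?q0 ?mu0 ?P0.
    by apply: jump_lim_lin; [exact: (jump_lim_cauchy a01)|exact: (jump_lim_cauchy0 a01)].
  + by apply: jump_lim_lin; [exact: (jump_lim_pot a01)|exact: (jump_lim_pot0 a01)].
  + by rewrite zE /cf; move: (pi : R) pi0 => P P0; field; rewrite ?mu0 ?P0 ?k0.
- move=> z /(boundary_between_below ccf ch hcf) zE.
  have zh : z.2 != cf z.1 by rewrite zE lt_eqF.
  apply: (transmission_velocity a01 rcf df df' rh dh dh' oD2 oD3 s21 s22 s31 s32) => //.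
  + by rewrite closure_between//= zE lexx ltW.
  + by rewrite closure_below//= zE.
  + exact: near_between_lower.
  + by apply: nearW => n; rewrite /below /= zE gtrBl.
  + by apply: jump_lim_lin; [exact: (jump_lim_cauchy0 a01)|exact: (jump_lim_cauchy a01)].
  + rewrite (_ : _ * derive1 h z.1 = k * g * (rho1 - rho2) / (2 * mu) / pi * 0 +
      k * g * (rho2 - rho3) / (2 * mu) / pi *
      (- (2 * pi) * derive1 h z.1 * (0 + 1 * derive1 h z.1) / (1 + derive1 h z.1 ^+ 2))); last first.
      by move: (pi : R) pi0 => P P0; field; rewrite ?q0 ?mu0 ?P0.
    by apply: jump_lim_lin; [exact: (jump_lim_cauchy0 a01)|exact: (jump_lim_cauchy a01)].
  + by apply: jump_lim_lin; [exact: (jump_lim_pot0 a01)|exact: (jump_lim_pot a01)].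
  + by rewrite zE; move: (pi : R) pi0 => P P0; field; rewrite ?mu0 ?P0 ?k0.
Qed.

End Existence.

(** * One-sided derivatives and conditions at a maximum *)

Section SideDerivatives.
Context {R : realType}.
Implicit Types (m : R -> R) (y d e t : R).

(** For s = 1 and s = -1 the right and the left derivative, both taken with respect to increasing
    y. *)
Definition side_derive (s : R) m y d := forall e, 0 < e -> exists2 r, 0 < r &
  forall t, 0 < t < r -> `|m (y + s * t) - m y - d * (s * t)| <= e * t.

Lemma side_deriveD s m m' y d d' : side_derive s m y d -> side_derive s m' y d' ->
  side_derive s (fun y => m y + m' y) y (d + d').
Proof.
move=> h h' e e0; have e20 : 0 < e / 2 by rewrite divr_gt0.
have [r r0 hr] := h _ e20; have [r' r'0 hr'] := h' _ e20.
exists (Num.min r r'); first by rewrite lt_min r0.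
move=> t /andP[t0]; rewrite lt_min => /andP[tr tr'].
have h1 := hr t; have h2 := hr' t; rewrite t0 tr in h1; rewrite t0 tr' in h2.
have -> : m (y + s * t) + m' (y + s * t) - (m y + m' y) - (d + d') * (s * t) =
  (m (y + s * t) - m y - d * (s * t)) + (m' (y + s * t) - m' y - d' * (s * t)) by ring.
apply: (le_trans (ler_normD _ _)); rewrite [e in leRHS]splitr mulrDl.
by apply: lerD; [exact: h1|exact: h2].
Qed.

Lemma side_deriveZ s m y d (c : R) : side_derive s m y d ->
  side_derive s (fun y => c * m y) y (c * d).
Proof.
move=> h e e0; have c0 : 0 < `|c| + 1 by rewrite ltr_wpDl.
have [r r0 hr] := h _ (divr_gt0 e0 c0); exists r => // t tr.
have -> : c * m (y + s * t) - c * m y - c * d * (s * t) =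
  c * (m (y + s * t) - m y - d * (s * t)) by ring.
have t0 : 0 <= t by case/andP: tr => /ltW.
rewrite normrM; apply: (le_trans (ler_wpM2l (normr_ge0 c) (hr t tr))).
rewrite mulrA ler_wpM2r// mulrA ler_pdivrMr// mulrC ler_wpM2l ?(ltW e0)//.
by rewrite lerDl.
Qed.

(** The mean value inequality for x -> m(y + s x) - d s x, whose derivative is at most e in absolute
    value on ]0, r[. *)
Lemma side_derive_limit s m dm y d : `|s| = 1 -> {for y, continuous m} ->
  (forall e, 0 < e -> exists2 r, 0 < r & forall t, 0 < t < r ->
     is_derive (y + s * t) 1 m (dm (y + s * t)) /\ `|dm (y + s * t) - d| <= e) ->
  side_derive s m y d.
Proof.
move=> s1 cm h e e0; have [r r0 hr] := h e e0; exists r => // t /andP[t0 tr].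
pose n (x : R) := m (y + s * x) - d * (s * x).
have dn (x : R) : 0 < x < r -> is_derive x 1 n (s * (dm (y + s * x) - d)).
  move=> /hr[hd _].
  have hl : is_derive x 1 (fun x : R => y + s * x) s.
    have := is_derive1D (is_derive1C y x) (is_derive1Z s (is_derive_id x 1)).
    by rewrite add0r mulr1.
  have hc : is_derive x 1 (fun x : R => m (y + s * x)) (s * dm (y + s * x)).
    by have := @is_derive1_comp _ m (fun x : R => y + s * x) x _ _ hd hl; rewrite mulrC.
  have hl' : is_derive x 1 (fun x : R => d * (s * x)) (d * s).
    by have := is_derive1Z d (is_derive1Z s (is_derive_id x 1)); rewrite mulr1.
  have := is_derive1B hc hl'.
  by rewrite (_ : s * (_ - d) = s * dm (y + s * x) - d * s)//; ring.
have cn : {for 0, continuous n}.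
  have cl : {for (0 : R), continuous (fun x : R => y + s * x)}.
    by apply: cvgD; [exact: cvg_cst|apply: cvgM; [exact: cvg_cst|exact: cvg_id]].
  apply: cvgB; last first.
    by apply: cvgM; [exact: cvg_cst|apply: cvgM; [exact: cvg_cst|exact: cvg_id]].
  by apply: (continuous_cvg _ _ cl); rewrite mulr0 addr0.
have := @ler_MVT_dom _ n (fun x => e * x) (fun x => s * (dm (y + s * x) - d)) (fun=> e) 0 t (ltW t0).
rewrite /n !mulr0 addr0 !subr0 [X in `|X|](_ : _ = m (y + s * t) - m y - d * (s * t)); last by ring.
apply.
- apply: continuous_in_subspaceT => x; rewrite inE /= in_itv /= => /andP[x0 xt].
  move: x0; rewrite le_eqVlt => /predU1P[<-//|x0].
  have xr : 0 < x < r by rewrite x0 (le_lt_trans xt).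
  exact: (is_derive1_continuous (dn x xr)).
- apply: continuous_in_subspaceT => x _.
  by apply: cvgM; [exact: cvg_cst|exact: cvg_id].
- move=> x /andP[x0 xt]; apply: dn; rewrite x0; exact: lt_trans tr.
- by move=> x _; have := is_derive1Z e (is_derive_id x 1); rewrite mulr1.
- move=> x /andP[x0 xt]; rewrite normrM s1 mul1r.
  by have /hr[] : 0 < x < r by rewrite x0 (lt_trans xt).
Qed.

Lemma side_derive_is_derive m y d : side_derive 1 m y d -> side_derive (- 1) m y d ->
  is_derive y 1 m d.
Proof.
move=> h1 h2.
have hc : (fun h : R => h^-1 *: (m (h + y) - m y)) h @[h --> 0^'] --> d.
  apply/cvgrPdist_le => e e0; have [r1 r10 hr1] := h1 e e0; have [r2 r20 hr2] := h2 e e0.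
  have r0 : 0 < Num.min r1 r2 by rewrite lt_min r10.
  near=> h.
  have h0 : h != 0 by near: h; exact: nbhs_dnbhs_neq.
  have hr : `|h| < Num.min r1 r2 by near: h; exact: dnbhs0_lt.
  move: hr; rewrite lt_min => /andP[hr hr'].
  rewrite -(ler_pM2l (_ : 0 < `|h|)) ?normr_gt0// -normrM.
  rewrite [X in `|X|](_ : _ = - (m (h + y) - m y - d * h)); last first.
    by rewrite /GRing.scale /=; field.
  rewrite normrN [leRHS]mulrC.
  have [hp|hn|hE] := ltgtP 0 h; last by rewrite hE eqxx in h0.
    rewrite (gtr0_norm hp) in hr *.
    by have := hr1 h; rewrite mul1r (addrC y); apply; rewrite hp.
  rewrite (ltr0_norm hn) in hr' *.
  by have := hr2 (- h); rewrite mulN1r opprK (addrC y); apply; rewrite oppr_gt0 hn.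
have dm : derivable m y 1.
  rewrite /derivable [X in cvg (X @ _)](_ : _ = fun h : R => h^-1 *: (m (h + y) - m y)).
    by apply/cvg_ex; exists d.
  by apply/funext => h; rewrite /= scaler1.
have := is_derive1_derive1 dm; rewrite (_ : derive1 m y = d)//.
exact/cvg_lim.
Unshelve. all: by end_near. Qed.

Lemma is_derive_side s m y d : `|s| = 1 -> is_derive y 1 m d -> side_derive s m y d.
Proof.
move=> s1 hm; have s0 : s != 0 by rewrite -normr_eq0 s1 oner_eq0.
have hc : cvg (h^-1 *: (m (h + y) - m y) @[h --> 0^']).
  have [] := hm; rewrite /derivable [X in cvg (X @ _)](_ : _ = fun h : R => h^-1 *: (m (h + y) - m y))//.
  by apply/funext => h; rewrite /= scaler1.
have {}hc : h^-1 *: (m (h + y) - m y) @[h --> 0^'] --> d.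
  by rewrite -(is_derive1E hm); exact: hc.
move=> e e0; have /cvgrPdist_le/(_ e e0) := hc.
rewrite near_withinE => /norm_nearP[r r0 hr]; exists r => // t /andP[t0 tr].
have st0 : s * t != 0 by rewrite mulf_neq0// gt_eqF.
have st : `|s * t| = t by rewrite normrM s1 mul1r gtr0_norm.
have E : `|m (y + s * t) - m y - d * (s * t)| =
    `|s * t| * `|d - (s * t)^-1 *: (m (s * t + y) - m y)|.
  rewrite -normrM -[LHS]normrN; congr `|_|.
  by rewrite /GRing.scale /= (addrC y); field; rewrite s0 gt_eqF.
by rewrite E st (mulrC e) ler_pM2l//; apply: (hr (s * t)); rewrite ?subr0 ?st.
Qed.

Lemma side_max m y (dp dm r : R) : 0 < r -> (forall t, `|t| < r -> m (y + t) <= m y) ->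
  side_derive 1 m y dp -> side_derive (- 1) m y dm -> dp <= 0 <= dm.
Proof.
move=> r0 hm hp hn; apply/andP; split; rewrite leNgt; apply/negP => d0.
  have e0 : 0 < dp / 2 by rewrite divr_gt0.
  have [r' r'0 hr] := hp _ e0; pose t := Num.min r r' / 2.
  have [t0 [tr tr']] : 0 < t /\ (t < r /\ t < r').
    have : 0 < Num.min r r' by rewrite lt_min r0.
    have : Num.min r r' <= r by rewrite ge_min lexx.
    have : Num.min r r' <= r' by rewrite ge_min lexx orbT.
    by rewrite /t; set u := Num.min _ _; split; [|split]; lra.
  have := hr t; rewrite t0 tr' mul1r => /(_ isT); have := hm t; rewrite (gtr0_norm t0) => /(_ tr).
  rewrite ler_norml => h1 /andP[h2 _].
  have : 0 < dp / 2 * t by rewrite mulr_gt0.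
  lra.
have e0 : 0 < - dm / 2 by rewrite divr_gt0// oppr_gt0.
have [r' r'0 hr] := hn _ e0; pose t := Num.min r r' / 2.
have [t0 [tr tr']] : 0 < t /\ (t < r /\ t < r').
  have : 0 < Num.min r r' by rewrite lt_min r0.
  have : Num.min r r' <= r by rewrite ge_min lexx.
  have : Num.min r r' <= r' by rewrite ge_min lexx orbT.
  by rewrite /t; set u := Num.min _ _; split; [|split]; lra.
have := hr t; rewrite t0 tr' mulN1r => /(_ isT).
have := hm (- t); rewrite normrN (gtr0_norm t0) => /(_ tr).
rewrite ler_norml => h1 /andP[h2 _].
have : 0 < - dm / 2 * t by rewrite mulr_gt0.
lra.
Qed.

(** At the maximum the first derivative vanishes. Were m2 positive, m(y + T) - m(y) would differ
    from (m2 / 2) T^2 by at most half of it for small T > 0, hence be positive. *)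
Lemma second_derivative_max m m1 (m2 y r : R) : 0 < r ->
  (forall t, `|t| < r -> m (y + t) <= m y) ->
  (forall x : R, `|x - y| < r -> is_derive x 1 m (m1 x)) ->
  is_derive y 1 m1 m2 -> m2 <= 0.
Proof.
move=> r0 hm dm dm1; have dy : is_derive y 1 m (m1 y) by apply: dm; rewrite subrr normr0.
have s1 : `|1| = 1 :> R by rewrite normr1.
have s2 : `|- 1| = 1 :> R by rewrite normrN normr1.
have m1y : m1 y = 0.
  have := side_max r0 hm (is_derive_side s1 dy) (is_derive_side s2 dy).
  by move=> h; apply/eqP; rewrite eq_le.
rewrite leNgt; apply/negP => m20; have e0 : 0 < m2 / 2 by rewrite divr_gt0.
have [r' r'0 hr] := is_derive_side s1 dm1 e0; pose T := Num.min r r' / 2.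
have [T0 [Tr Tr']] : 0 < T /\ (T < r /\ T < r').
  have : 0 < Num.min r r' by rewrite lt_min r0.
  have : Num.min r r' <= r by rewrite ge_min lexx.
  have : Num.min r r' <= r' by rewrite ge_min lexx orbT.
  by rewrite /T; set u := Num.min _ _; split; [|split]; lra.
have dq (b x : R) : is_derive x 1 (fun x => b * (x - y) ^+ 2) (b * 2 * (x - y)).
  have dl : is_derive x 1 (fun x : R => x - y) 1.
    by have := is_derive1B (is_derive_id x 1) (is_derive1C y x); rewrite subr0.
  have := is_derive1Z b (is_derive1M dl dl).
  by rewrite (_ : b * _ = b * 2 * (x - y))//; ring.
pose f (x : R) := m x - m2 / 2 * (x - y) ^+ 2.
pose df x := m1 x - m2 / 2 * 2 * (x - y).
have df' (x : R) : y <= x <= y + T -> is_derive x 1 f (df x).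
  move=> /andP[yx xT]; have xr : `|x - y| < r by rewrite ger0_norm ?subr_ge0//; lra.
  exact: is_derive1B (dm x xr) (dq (m2 / 2) x).
have yT : y <= y + T by rewrite lerDl ltW.
have := @ler_MVT_dom _ f (fun x => m2 / 4 * (x - y) ^+ 2) df (fun x => m2 / 4 * 2 * (x - y)) y (y + T) yT.
rewrite /f subrr expr0n /= !mulr0 !subr0 (addrC y) addrK => h.
have {h} : `|m (T + y) - m2 / 2 * T ^+ 2 - m y| <= m2 / 4 * T ^+ 2.
  apply: h.
  - apply: continuous_in_subspaceT => x; rewrite inE /= in_itv /= (addrC T) => xI.
    exact: (is_derive1_continuous (df' x xI)).
  - apply: continuous_in_subspaceT => x _; exact: (is_derive1_continuous (dq _ x)).
  - by move=> x /andP[x0 xt]; apply: df'; rewrite (ltW x0) addrC ltW.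
  - move=> x /andP[x0 xt]; have := hr (x - y).
    rewrite mul1r (_ : y + (x - y) = x) ?m1y ?subr0 /df; last by ring.
    have xr : 0 < x - y < r' by rewrite subr_gt0 x0; lra.
    by move=> /(_ xr); rewrite (_ : m2 / 2 * 2 = m2) 1?(_ : m2 / 4 * 2 = m2 / 2)//; field.
have := hm T; rewrite (gtr0_norm T0) (addrC y) => /(_ Tr) h1; rewrite ler_norml => /andP[h2 _].
have : 0 < m2 / 4 * T ^+ 2 by rewrite mulr_gt0 ?divr_gt0 ?exprn_gt0.
lra.
Qed.

End SideDerivatives.

(** * Tangential derivative of boundary values *)

Section Tangential.
Context {R : realType}.
Implicit Types (z : plane R) (x e s : R).

Definition side s (phi : R -> R) : set (plane R) := [set z | 0 < s * (z.2 - phi z.1)].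

Context (s L r0 : R) (phi Psi1 P : R -> R) (Psi Psix Psiy : plane R -> R) (x0 g1 g2 : R).
Hypotheses (s1 : s = 1 \/ s = - 1) (phiL : lipschitz_fun L phi) (r00 : 0 < r0).
Hypothesis dPsi : forall z, side s phi z -> `|z - (x0, phi x0)| < r0 ->
  is_derive z (1, 0) Psi (Psix z) /\ is_derive z (0, 1) Psi (Psiy z).
Hypotheses (t1 : has_trace (side s phi) Psix (x0, phi x0) g1)
  (t2 : has_trace (side s phi) Psiy (x0, phi x0) g2).
Hypothesis tP : forall x, has_trace (side s phi) Psi (x, phi x) (P x).

Let ss : s * s = 1. Proof. by case: s1 => ->; ring. Qed.
Let sn : `|s| = 1. Proof. by case: s1 => ->; rewrite ?normrN normr1. Qed.

(* The endpoints are joined by a vertical, a horizontal and a vertical segment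
   that stay on the given side of the curve. *)
Lemma tangential_estimate e : 0 < e -> exists2 d, 0 < d & forall x, `|x - x0| < d ->
  `|P x - P x0 - g1 * (x - x0) - g2 * (phi x - phi x0)| <= e * `|x - x0|.
Proof.
(* K is the length of the path in units of |x - x0|: 1 for the horizontal segment, L' and 2 L' for
   the vertical ones. *)
move=> e0; pose L' := `|L| ; pose K := 1 + 3 * L'; have L0 : 0 <= L' by exact: normr_ge0.
have phiL' x y : `|phi x - phi y| <= L' * `|x - y|.
  by apply: (le_trans (phiL x y)); rewrite ler_wpM2r// ler_norm.
have K0 : 0 < K by rewrite ltr_pwDl// mulr_ge0.
have e'0 : 0 < e / K by rewrite divr_gt0.
have [d1 d10 h1] := t1 e'0; have [d2 d20 h2] := t2 e'0.
pose d := Num.min r0 (Num.min d1 d2).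
have d0 : 0 < d by rewrite !lt_min r00 d10.
have K2 : 0 < 2 * K + 2 by apply: addr_gt0 => //; apply: mulr_gt0.
exists (d / (2 * K + 2)) => [|x xd]; first exact: divr_gt0.
set D := `|x - x0| in xd *; have D0 : 0 <= D by exact: normr_ge0.
have Dd : D * K < d / 2.
  move: xd; rewrite ltr_pdivlMr//; move: D0 d0 K0; nra.
pose E z := Psi z - g1 * z.1 - g2 * z.2.
have near z : side s phi z -> `|z.1 - x0| < d -> `|z.2 - phi x0| < d ->
    [/\ is_derive z (1, 0) E (Psix z - g1), is_derive z (0, 1) E (Psiy z - g2),
        `|Psix z - g1| <= e / K & `|Psiy z - g2| <= e / K].
  move=> zs zx zy.
  have zd : `|z - (x0, phi x0)| < d by rewrite norm_plane gt_max zx.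
  move: (zd); rewrite !lt_min => /andP[z0 /andP[z1 z2]].
  have [ax ay] := dPsi zs z0; split; [| |exact/ltW/h1|exact/ltW/h2].
    apply/is_derive_dx; move/is_derive_dx: ax => ax.
    have := is_derive1B (is_derive1B ax (is_derive1Z g1 (is_derive_id z.1 1)))
      (is_derive1C (g2 * z.2) z.1).
    by rewrite subr0 mulr1.
  apply/is_derive_dy; move/is_derive_dy: ay => ay.
  have := is_derive1B (is_derive1B ay (is_derive1C (g1 * z.1) z.2))
    (is_derive1Z g2 (is_derive_id z.2 1)).
  by rewrite subr0 mulr1.
have path t : 0 < t -> t < d / 2 ->
    `|E (x, phi x + s * t) - E (x0, phi x0 + s * t)| <= e * D.
  (* The level of the horizontal segment: for |y - x0| <= D the graph varies by at most L' D, so H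
     stays at least t away from it on the given side. *)
  move=> t0 td; pose H := phi x0 + s * (t + L' * D).
  have sH y : s * (H - phi y) = s * (phi x0 - phi y) + t + L' * D.
    by rewrite /H; have := ss; move=> S; rewrite -[t in RHS]mul1r -[L' * D in RHS]mul1r -S; ring.
  have sB y : - (L' * `|y - x0|) <= s * (phi x0 - phi y).
    have : `|s * (phi x0 - phi y)| <= L' * `|y - x0|.
      by rewrite normrM sn mul1r distrC phiL'.
    by rewrite ler_norml => /andP[].
  have HE : `|H - phi x0| = t + L' * D.
    by rewrite /H addrC addKr normrM sn mul1r ger0_norm// addr_ge0 ?mulr_ge0// ltW.
  have LD : L' * D * 3 + D < d / 2 by move: Dd; rewrite /K; lra.
  have LD0 : 0 <= L' * D by rewrite mulr_ge0.
  have p1 : `|E (x0, phi x0 + s * t) - E (x0, H)| <= e / K * (L' * D).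
    have HH : `|phi x0 + s * t - H| = L' * D.
      rewrite /H (_ : _ - _ = - (s * (L' * D))); last by ring.
      by rewrite normrN normrM sn mul1r ger0_norm.
    have hy y : `|y - H| <= L' * D ->
        is_derive (y : R) 1 (fun y => E (x0, y)) (Psiy (x0, y) - g2) /\ `|Psiy (x0, y) - g2| <= e / K.
      move=> yH; have sy : `|s * (y - H)| <= L' * D by rewrite normrM sn mul1r.
      have [] := near (x0, y).
      - rewrite /side /= (_ : _ * _ = s * (y - H) + s * (H - phi x0)); last by ring.
        rewrite sH subrr mulr0 add0r; move: sy; rewrite ler_norml => /andP[sy _]; lra.
      - by rewrite subrr normr0.
      - have := ler_distD H y (phi x0); rewrite HE /=; lra.
      - by move=> _ /is_derive_dy.
    rewrite -HH; apply: (@ler_MVT_ball _ (fun y => E (x0, y)) (fun y => Psiy (x0, y) - g2));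
      by rewrite HH => y /hy[].
  have p2 : `|E (x, H) - E (x0, H)| <= e / K * D.
    have hy y : `|y - x0| <= D ->
        is_derive (y : R) 1 (fun y => E (y, H)) (Psix (y, H) - g1) /\ `|Psix (y, H) - g1| <= e / K.
      move=> yD; have [] := near (y, H).
      - rewrite /side /= sH; have := sB y; have := ler_wpM2l L0 yD; lra.
      - rewrite /=; lra.
      - rewrite /= HE; lra.
      - by move=> /is_derive_dx.
    apply: (@ler_MVT_ball _ (fun y => E (y, H)) (fun y => Psix (y, H) - g1));
      by move=> y /hy[].
  have p3 : `|E (x, phi x + s * t) - E (x, H)| <= e / K * (2 * (L' * D)).
    have HH : `|phi x + s * t - H| = s * (phi x0 - phi x) + L' * D.
      have -> : phi x + s * t - H = - (s * (s * (phi x0 - phi x) + L' * D)).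
        transitivity (- (s * s * (phi x0 - phi x)) - s * (L' * D)); last by ring.
        by rewrite ss /H; ring.
      by rewrite normrN normrM sn mul1r ger0_norm//; have := sB x; rewrite -/D; lra.
    have HH2 : `|phi x + s * t - H| <= 2 * (L' * D).
      have : `|s * (phi x0 - phi x)| <= L' * D by rewrite normrM sn mul1r distrC phiL'.
      by rewrite HH ler_norml => /andP[_]; lra.
    have hy y : `|y - H| <= `|phi x + s * t - H| ->
        is_derive (y : R) 1 (fun y => E (x, y)) (Psiy (x, y) - g2) /\ `|Psiy (x, y) - g2| <= e / K.
      move=> yH; have sy : `|s * (y - H)| <= `|phi x + s * t - H| by rewrite normrM sn mul1r.
      have [] := near (x, y).
      - rewrite /side /= (_ : _ * _ = s * (y - H) + s * (H - phi x)); last by ring.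
        rewrite sH; move: sy; rewrite ler_norml HH => /andP[sy _]; lra.
      - rewrite /= -/D; lra.
      - have := ler_distD H y (phi x0); rewrite HE /=; lra.
      - by move=> _ /is_derive_dy.
    apply: (@le_trans _ _ (e / K * `|phi x + s * t - H|)); last by rewrite ler_wpM2l// ltW.
    apply: (@ler_MVT_ball _ (fun y => E (x, y)) (fun y => Psiy (x, y) - g2));
      by move=> y /hy[].
  have -> : e * D = e / K * D + e / K * (L' * D) + e / K * (2 * (L' * D)).
    by rewrite /K; field; rewrite -/L' -/K gt_eqF.
  have -> : E (x, phi x + s * t) - E (x0, phi x0 + s * t) =
    (E (x, H) - E (x0, H)) - (E (x0, phi x0 + s * t) - E (x0, H)) +
    (E (x, phi x + s * t) - E (x, H)) by ring.
  apply: (le_trans (ler_normD _ _)); apply: lerD => //.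
  by apply: (le_trans (ler_normB _ _)); apply: lerD.
(* The path starts and ends at distance t from the curve; for small t the values of Psi there are
   within eta / 2 of the traces. *)
apply/ler_addgt0Pl => eta eta0; have eta20 : 0 < eta / 2 by rewrite divr_gt0.
have [r1 r10 hr1] := tP x eta20; have [r2 r20 hr2] := tP x0 eta20.
pose t := Num.min (Num.min r1 r2) (d / 2) / 2.
have [t0 [tr1 [tr2 td]]] : 0 < t /\ (t < r1 /\ (t < r2 /\ t < d / 2)).
  have : 0 < Num.min (Num.min r1 r2) (d / 2) by rewrite !lt_min r10 r20 divr_gt0.
  have : Num.min (Num.min r1 r2) (d / 2) <= r1 by rewrite !ge_min lexx.
  have : Num.min (Num.min r1 r2) (d / 2) <= r2 by rewrite !ge_min lexx orbT.
  have : Num.min (Num.min r1 r2) (d / 2) <= d / 2 by rewrite !ge_min lexx orbT.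
  by rewrite /t; set u := Num.min _ (d / 2) => *; do 3 (split; first lra); lra.
have onside y : side s phi (y, phi y + s * t).
  by rewrite /side /= (addrC (phi y)) addrK mulrA ss mul1r.
have dist y : `|(y, phi y + s * t) - (y, phi y)| = t.
  rewrite norm_plane /= subrr normr0 (addrC (phi y)) addrK normrM sn mul1r.
  by rewrite gtr0_norm// max_r// ltW.
have e1 := hr1 _ (onside x); rewrite dist in e1.
have e2 := hr2 _ (onside x0); rewrite dist in e2.
have e3 := path t t0 td; move: e3.
have -> : E (x, phi x + s * t) - E (x0, phi x0 + s * t) =
  (P x - P x0 - g1 * (x - x0) - g2 * (phi x - phi x0)) +
  ((Psi (x, phi x + s * t) - P x) - (Psi (x0, phi x0 + s * t) - P x0)).
  by rewrite /E /=; ring.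
set u := _ - g2 * _; set v := _ - (_ - P x0) => e3.
have hv : `|v| <= eta.
  apply: (le_trans (ler_normB _ _)); rewrite [leRHS]splitr.
  by apply: lerD; apply: ltW; [exact: e1|exact: e2].
have -> : u = (u + v) - v by rewrite addrK.
by apply: (le_trans (ler_normB _ _)); rewrite addrC; exact: lerD.
Qed.

(** The estimate says that P - g2 phi has derivative g1 at x0. *)
Lemma tangential_derive a : is_derive x0 1 phi a -> is_derive x0 1 P (g1 + g2 * a).
Proof.
move=> dphi.
have hside (q : R) : `|q| = 1 -> side_derive q (fun x => P x + - g2 * phi x) x0 g1.
  move=> q1 e /tangential_estimate[d d0 hd]; exists d => // t /andP[t0 td].
  have qt : `|x0 + q * t - x0| = t by rewrite addrC addKr normrM q1 mul1r gtr0_norm.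
  have := hd (x0 + q * t); rewrite qt => /(_ td).
  by congr (`|_| <= _); ring.
have q1 : `|1| = 1 :> R by rewrite normr1.
have q2 : `|- 1| = 1 :> R by rewrite normrN normr1.
have := side_derive_is_derive (hside _ q1) (hside _ q2) => h.
have := is_derive1D h (is_derive1Z g2 dphi).
rewrite (_ : (fun y => _) = P)//; apply/funext => y; ring.
Qed.

End Tangential.

(** * Laplacian and kinks at a local maximum *)

Section LocalMaximum.
Context {R : realType}.
Implicit Types (G : plane R -> R) (z : plane R) (c d r s : R).

(** A pointwise Laplacian: first partial derivatives near z, each differentiable at z in its own
    direction. *)
Definition laplacian_at G z c := exists (Gx Gy : plane R -> R) (a b : R),
  [/\ exists2 r, 0 < r & forall z', `|z' - z| < r ->
        is_derive z' (1, 0) G (Gx z') /\ is_derive z' (0, 1) G (Gy z'),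
      is_derive z (1, 0) Gx a, is_derive z (0, 1) Gy b & a + b = c].

(** d is the jump, upper minus lower, of the vertical derivative at z. At a local maximum it cannot
    be positive. *)
Definition kinked G z d := exists dm dp,
  [/\ side_derive 1 (fun y => G (z.1, y)) z.2 dp,
      side_derive (- 1) (fun y => G (z.1, y)) z.2 dm & dp - dm = d].

Lemma laplacian_at_lin G G' z c c' (k k' : R) : laplacian_at G z c -> laplacian_at G' z c' ->
  laplacian_at (fun z => k * G z + k' * G' z) z (k * c + k' * c').
Proof.
move=> [Gx [Gy [a [b [[r r0 hr] ha hb <-]]]]] [Gx' [Gy' [a' [b' [[r' r'0 hr'] ha' hb' <-]]]]].
exists (fun z => k * Gx z + k' * Gx' z), (fun z => k * Gy z + k' * Gy' z).
exists (k * a + k' * a'), (k * b + k' * b'); split; last by ring.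
- exists (Num.min r r'); first by rewrite lt_min r0.
  move=> z'; rewrite lt_min => /andP[/hr[h1 h2] /hr'[h1' h2']].
  by split; apply: is_deriveD; apply: is_deriveZ.
- by apply: is_deriveD; apply: is_deriveZ.
- by apply: is_deriveD; apply: is_deriveZ.
Qed.

Lemma kinked_lin G G' z d d' (k k' : R) : kinked G z d -> kinked G' z d' ->
  kinked (fun z => k * G z + k' * G' z) z (k * d + k' * d').
Proof.
move=> [dm [dp [hp hm <-]]] [dm' [dp' [hp' hm' <-]]].
exists (k * dm + k' * dm'), (k * dp + k' * dp'); split; last by ring.
- by apply: side_deriveD; apply: side_deriveZ.
- by apply: side_deriveD; apply: side_deriveZ.
Qed.

Lemma laplacian_atD G G' z c c' : laplacian_at G z c -> laplacian_at G' z c' ->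
  laplacian_at (fun z => G z + G' z) z (c + c').
Proof.
move=> h h'; have := laplacian_at_lin 1 1 h h'; rewrite !mul1r.
by congr (laplacian_at _ _ _); apply/funext => y; rewrite !mul1r.
Qed.

Lemma kinkedD G G' z d d' : kinked G z d -> kinked G' z d' ->
  kinked (fun z => G z + G' z) z (d + d').
Proof.
move=> h h'; have := kinked_lin 1 1 h h'; rewrite !mul1r.
by congr (kinked _ _ _); apply/funext => y; rewrite !mul1r.
Qed.

Definition up (e : R) z : plane R := (z.1, z.2 + e).

Lemma is_derive_up_dx G e z d : is_derive (up e z) (1, 0) G d ->
  is_derive z (1, 0) (G \o up e) d.
Proof. by move/is_derive_dx => h; apply/is_derive_dx. Qed.

Lemma is_derive_up_dy G e z d : is_derive (up e z) (0, 1) G d ->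
  is_derive z (0, 1) (G \o up e) d.
Proof.
move/is_derive_dy => h; apply/is_derive_dy.
have hl : is_derive z.2 1 (fun y : R => y + e) 1.
  by have := is_derive1D (is_derive_id z.2 1) (is_derive1C e z.2); rewrite addr0.
have := @is_derive1_comp _ (fun y => G (z.1, y)) (fun y : R => y + e) z.2 _ _ h hl.
by rewrite mulr1.
Qed.

Lemma upB e z z' : `|up e z - up e z'| = `|z - z'|.
Proof.
rewrite !norm_plane /up /=.
by have -> : z.2 + e - (z'.2 + e) = z.2 - z'.2 by ring.
Qed.

Lemma laplacian_at_up G e z c : laplacian_at G (up e z) c ->
  laplacian_at (G \o up e) z c.
Proof.
move=> [Gx [Gy [a [b [[r r0 hr] ha hb <-]]]]].
exists (Gx \o up e), (Gy \o up e), a, b; split => //.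
- exists r => // z' zz'.
  have [|h1 h2] := hr (up e z'); first by rewrite upB.
  by split; [exact: is_derive_up_dx|exact: is_derive_up_dy].
- exact: is_derive_up_dx.
- exact: is_derive_up_dy.
Qed.

Lemma side_derive_shift s (m : R -> R) e y d : side_derive s m (y + e) d ->
  side_derive s (fun y => m (y + e)) y d.
Proof.
move=> h x /h[r r0 hr]; exists r => // t /hr.
by rewrite (addrAC y).
Qed.

Lemma kinked_up G e z d : kinked G (up e z) d -> kinked (G \o up e) z d.
Proof.
move=> [dm [dp [hp hm <-]]]; exists dm, dp; split => //.
- exact: (@side_derive_shift _ (fun y => G (z.1, y))).
- exact: (@side_derive_shift _ (fun y => G (z.1, y))).
Qed.

Lemma kinked_derive G z d : is_derive z (0, 1) G d -> kinked G z 0.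
Proof.
move=> /is_derive_dy h; exists d, d; split; last by rewrite subrr.
- by apply: is_derive_side => //; rewrite normr1.
- by apply: is_derive_side => //; rewrite normrN normr1.
Qed.

Let max_line G z r : (forall z', `|z' - z| < r -> G z' <= G z) ->
  (forall t, `|t| < r -> G (z.1 + t, z.2) <= G (z.1, z.2)) /\
  (forall t, `|t| < r -> G (z.1, z.2 + t) <= G (z.1, z.2)).
Proof.
move=> hm; rewrite -surjective_pairing; split=> t tr; apply: hm.
  by rewrite norm_plane /= addrC addKr subrr normr0 gt_max tr (le_lt_trans _ tr).
by rewrite norm_plane /= (addrC z.2) addrK subrr normr0 gt_max tr (le_lt_trans _ tr).
Qed.

Lemma kinked_max G z r d : 0 < r -> (forall z', `|z' - z| < r -> G z' <= G z) ->
  kinked G z d -> d <= 0.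
Proof.
move=> r0 /max_line[_ hm] [dm [dp [hp hn <-]]].
by have /andP[] := side_max r0 hm hp hn; lra.
Qed.

Lemma laplacian_max G z r c : 0 < r -> (forall z', `|z' - z| < r -> G z' <= G z) ->
  laplacian_at G z c -> c <= 0.
Proof.
move=> r0 hm [Gx [Gy [a [b [[r' r'0 hr] ha hb <-]]]]].
have m0 : 0 < Num.min r r' by rewrite lt_min r0.
have [hx hy] := max_line hm.
have hx' t : `|t| < Num.min r r' -> G (z.1 + t, z.2) <= G (z.1, z.2).
  by rewrite lt_min => /andP[/hx].
have hy' t : `|t| < Num.min r r' -> G (z.1, z.2 + t) <= G (z.1, z.2).
  by rewrite lt_min => /andP[/hy].
have dx' (x : R) : `|x - z.1| < Num.min r r' ->
    is_derive x 1 (fun x => G (x, z.2)) (Gx (x, z.2)).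
  rewrite lt_min => /andP[_ xr]; have [|] := hr (x, z.2).
    by rewrite norm_plane /= subrr normr0 gt_max xr.
  by move=> /is_derive_dx.
have dy' (y : R) : `|y - z.2| < Num.min r r' ->
    is_derive y 1 (fun y => G (z.1, y)) (Gy (z.1, y)).
  rewrite lt_min => /andP[_ yr]; have [|] := hr (z.1, y).
    by rewrite norm_plane /= subrr normr0 gt_max r'0 yr.
  by move=> _ /is_derive_dy.
move/is_derive_dx: ha => ha; move/is_derive_dy: hb => hb.
have a0 := @second_derivative_max _ (fun x => G (x, z.2)) (fun x => Gx (x, z.2)) a z.1 _ m0 hx' dx' ha.
have b0 := @second_derivative_max _ (fun y => G (z.1, y)) (fun y => Gy (z.1, y)) b z.2 _ m0 hy' dy' hb.
by rewrite -(addr0 0); apply: lerD.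
Qed.

Definition sqr_norm z : R := z.1 ^+ 2 + z.2 ^+ 2.

Lemma is_derive_sqr_norm z : is_derive z (1, 0) sqr_norm (2 * z.1) /\
  is_derive z (0, 1) sqr_norm (2 * z.2).
Proof.
have sq (x : R) : is_derive x 1 (fun x : R => x ^+ 2) (2 * x).
  have := is_derive1M (is_derive_id x 1) (is_derive_id x 1).
  by rewrite (_ : 1 * _ + _ = 2 * x)//; ring.
split.
  apply/is_derive_dx; have := is_derive1D (sq z.1) (is_derive1C (z.2 ^+ 2) z.1).
  by rewrite addr0.
apply/is_derive_dy; have := is_derive1D (is_derive1C (z.1 ^+ 2) z.2) (sq z.2).
by rewrite add0r.
Qed.

Lemma laplacian_at_sqr_norm z : laplacian_at sqr_norm z 4.
Proof.
exists (fun z => 2 * z.1), (fun z => 2 * z.2), 2, 2; split; last by ring.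
- by exists 1 => // z' _; exact: is_derive_sqr_norm.
- by apply/is_derive_dx; have := is_derive1Z 2 (is_derive_id z.1 1); rewrite mulr1.
- by apply/is_derive_dy; have := is_derive1Z 2 (is_derive_id z.2 1); rewrite mulr1.
Qed.

Lemma kinked_sqr_norm z : kinked sqr_norm z 0.
Proof. by have [_ h] := is_derive_sqr_norm z; exact: kinked_derive h. Qed.

End LocalMaximum.

(** * The density of the barrier *)

Section Weight.
Context {R : realType}.
Local Notation mu := (@lebesgue_measure R).
Local Notation integrableT f := (mu.-integrable setT (EFin \o f)).
Implicit Types (s a : R).

Lemma lipschitz_density (a M L : R) (w w' : R -> R) : 0 < a < 1 ->
  (forall s : R, is_derive s 1 w (w' s)) -> (forall s, `|w s| <= M) ->
  (forall s, `|w' s| <= L) -> integrableT (fun s => w s ^+ 2) -> density a w.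
Proof.
move=> a01 dw wM w'L wi; split=> //; first by exists M.
apply: (bounded_lipschitz_holder a01 wM (L := L)).
apply: derive_bounded_lipschitz => s; first exact: (@ex_derive _ _ _ _ _ _ _ (dw s)).
by rewrite (is_derive1E (dw s)).
Qed.

Context (N : R) (N0 : 0 < N).

Let q s := s ^+ 2 + N ^+ 2.
Let q0 s : 0 < q s. Proof. by rewrite ltr_wpDl ?sqr_ge0 ?exprn_gt0. Qed.
Let qn s : q s != 0. Proof. by rewrite gt_eqF. Qed.

(** The gradient of the barrier is that of the logarithmic potential with density [weight1], which
    is positive for |s| < N. Being the derivative of a decaying function, this density has total
    mass zero, which allows a bounded potential. *)
Definition weight s := s * (s ^+ 2 + N ^+ 2)^-1.
Definition weight1 s := (N ^+ 2 - s ^+ 2) * ((s ^+ 2 + N ^+ 2) ^+ 2)^-1.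
Let weight2 s := (2 * s ^+ 3 - 6 * N ^+ 2 * s) * ((s ^+ 2 + N ^+ 2) ^+ 3)^-1.

Let dsq s : is_derive s 1 (fun s : R => s ^+ 2) (2 * s).
Proof.
have := is_derive1M (is_derive_id s 1) (is_derive_id s 1).
by rewrite (_ : 1 * _ + _ = 2 * s)//; ring.
Qed.

Let dq s : is_derive s 1 q (2 * s).
Proof. by have := is_derive1D (dsq s) (is_derive1C (N ^+ 2) s); rewrite addr0. Qed.

Lemma is_derive_weight s : is_derive s 1 weight (weight1 s).
Proof.
have := is_derive1M (is_derive_id s 1) (is_derive1V (dq s) (qn s)).
rewrite (_ : _ + _ = weight1 s)// /weight1 -/(q s).
have -> : N ^+ 2 = q s - s ^+ 2 by rewrite /q; ring.
by have := qn s; move: (q s) => u u0; field.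
Qed.

Let is_derive_weight1 s : is_derive s 1 weight1 (weight2 s).
Proof.
have q2n : q s * q s != 0 by rewrite mulf_neq0.
have := is_derive1M (is_derive1B (is_derive1C (N ^+ 2) s) (dsq s))
  (is_derive1V (is_derive1M (dq s) (dq s)) q2n).
rewrite (_ : _ * _ + _ = weight2 s)// /weight2 -/(q s).
have -> : N ^+ 2 = q s - s ^+ 2 by rewrite /q; ring.
by have := qn s; move: (q s) => u u0; field.
Qed.

Let sN s : `|s| * N <= q s.
Proof.
by rewrite /q -(real_normK (num_real s)); have := sqr_ge0 (`|s| - N);
  have := sqr_ge0 `|s|; have := sqr_ge0 N; nra.
Qed.

Let q_ge s : N ^+ 2 <= q s.
Proof. by rewrite lerDr sqr_ge0. Qed.

Let num1 s : `|N ^+ 2 - s ^+ 2| <= q s.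
Proof. by rewrite ler_norml /q; have := sqr_ge0 s; have := sqr_ge0 N; lra. Qed.

Lemma weight1_gt0 s : `|s| < N -> 0 < weight1 s.
Proof.
move=> sN'; apply: mulr_gt0; last by rewrite invr_gt0; exact: exprn_gt0 (q0 s).
by rewrite subr_gt0 -(real_normK (num_real s)) ltr_sqr ?nnegrE ?(ltW N0).
Qed.

Let weight_le s : `|weight s| <= N^-1.
Proof.
by rewrite normrM normfV (gtr0_norm (q0 s)) ler_pdivrMr// mulrC ler_pdivlMr.
Qed.

Let weight1_le s : `|weight1 s| <= (q s)^-1.
Proof.
rewrite normrM normfV (gtr0_norm (exprn_gt0 2 (q0 s))) ler_pdivrMr ?exprn_gt0//.
by rewrite expr2 mulrA mulVf// mul1r.
Qed.

Let qV_le s : (q s)^-1 <= (N ^+ 2)^-1.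
Proof. by rewrite lef_pV2 ?posrE ?exprn_gt0. Qed.

Let weight2_le s : `|weight2 s| <= 6 / N * (N ^+ 2)^-1.
Proof.
rewrite normrM normfV (gtr0_norm (exprn_gt0 3 (q0 s))) ler_pdivrMr ?exprn_gt0//.
have -> : 2 * s ^+ 3 - 6 * N ^+ 2 * s = s * (2 * s ^+ 2 - 6 * N ^+ 2) by ring.
have h : `|2 * s ^+ 2 - 6 * N ^+ 2| <= 6 * q s.
  by rewrite ler_norml /q; have := sqr_ge0 s; have := sqr_ge0 N; lra.
rewrite normrM; apply: (le_trans (ler_wpM2l (normr_ge0 s) h)).
have h1 : `|s| <= q s / N by rewrite ler_pdivlMr// sN.
apply: (@le_trans _ _ (q s / N * (6 * q s))).
  by apply: ler_wpM2r h1; apply: mulr_ge0 => //; exact: ltW.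
have -> : q s / N * (6 * q s) = 6 / N * (q s ^+ 2 * 1) by ring.
have -> : 6 / N / N ^+ 2 * q s ^+ 3 = 6 / N * (q s ^+ 2 * ((N ^+ 2)^-1 * q s)).
  by rewrite (exprS _ 2); ring.
apply: ler_wpM2l; first by rewrite divr_ge0// ltW.
apply: ler_wpM2l; first exact: sqr_ge0.
by rewrite mulrC ler_pdivlMr ?exprn_gt0// mul1r.
Qed.

Let integrable_qV : integrableT (fun s => (q s)^-1).
Proof.
have := integrable_poisson 0 N0.
by congr (mu.-integrable _ (EFin \o _)); apply/funext => s; rewrite subr0.
Qed.

Let continuous_of_derive (w w' : R -> R) :
  (forall s : R, is_derive s 1 w (w' s)) -> measurable_fun setT (fun s => w s ^+ 2).
Proof.
move=> h; apply: measurable_funX; apply: continuous_measurable_fun => s.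
exact: is_derive1_continuous (h s).
Qed.

Lemma density_weight a : 0 < a < 1 -> density a weight.
Proof.
move=> a01; apply: (lipschitz_density a01 is_derive_weight weight_le).
  by move=> s; apply: (le_trans (weight1_le s)); exact: qV_le.
apply: (dominated_integrable _ integrable_qV).
  exact: continuous_of_derive is_derive_weight.
move=> s; rewrite ger0_norm ?sqr_ge0// /weight -/(q s) exprMn exprVn.
rewrite ler_pdivrMr ?exprn_gt0// expr2 [leRHS]mulrA mulVf// mul1r.
by rewrite lerDl sqr_ge0.
Qed.

Lemma density_weight1 a : 0 < a < 1 -> density a weight1.
Proof.
move=> a01; apply: (lipschitz_density a01 is_derive_weight1 _ weight2_le).
  by move=> s; apply: (le_trans (weight1_le s)); exact: qV_le.
apply: (dominated_integrable _ (integrableTZ (N ^+ 2)^-1 integrable_qV)).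
  exact: continuous_of_derive is_derive_weight1.
move=> s; rewrite ger0_norm ?sqr_ge0// -(real_normK (num_real _)) expr2.
have h := weight1_le s; apply: ler_pM => //; exact: le_trans (qV_le s).
Qed.

End Weight.

Lemma continuous_vertical (R : realType) (x y : R) :
  {for y, continuous (fun y : R => (x, y) : plane R)}.
Proof.
apply/cvgrPdist_lt => e e0.
suff : \forall y' \near y, `|((x, y) : plane R) - (x, y')| < e by [].
apply/norm_nearP; exists e => // y' yy'.
by rewrite norm_plane /= subrr normr0 distrC gt_max e0.
Qed.

(** * A continuous barrier, harmonic off a curve and kinked on it *)

Section Barrier.
Context {R : realType}.
Context (a N : R) (F : R -> R) (a01 : 0 < a < 1) (N0 : 0 < N).
Hypothesis rF : regular_curve a F.
Implicit Types (z : plane R) (e s : R).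

Let a0 : 0 < a. Proof. by case/andP: a01. Qed.
Let cF : continuous F. Proof. exact: regular_curve_continuous rF. Qed.
Let dw := density_weight N0 a01.
Let dw1 := density_weight1 N0 a01.
Let S := pot F (weight N) 1 0.
Let Sx := cauchy_int 1 0 1 F (weight1 N).
Let Sy := cauchy_int 0 (- 1) 1 F (weight1 N).

Lemma trace_le (O : set (plane R)) (G : plane R -> R) z l (M : R) : closure O z ->
  has_trace O G z l -> (forall z', O z' -> `|G z'| <= M) -> `|l| <= M.
Proof.
move=> Oz ht GM; apply/ler_addgt0Pl => e /ht[d d0 hd].
have [z' Oz' zz'] := (closure_normP O z).1 Oz d d0.
have h1 := hd z' Oz' zz'; have h2 := GM z' Oz'.
by have := ler_distD (G z') l 0; rewrite !subr0 (distrC l); lra.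
Qed.

Lemma off_curveE : off_curve F = above F `|` below F.
Proof.
by apply/seteqP; split => z; rewrite /off_curve /above /below /= neq_lt orbC => /orP.
Qed.

Lemma dense_off_curve z : closure (off_curve F) z.
Proof.
rewrite off_curveE closureU closure_above// closure_below//=.
by have [h|h] := leP (F z.1) z.2; [left|right; exact: ltW].
Qed.

Let oO : open (off_curve F).
Proof. by rewrite off_curveE; apply: openU; [exact: open_above|exact: open_below]. Qed.

Let tame_above G : (forall D, open D -> one_sided F D -> tame D G) ->
  unif_continuous_on (above F) G /\ unif_continuous_on (below F) G.
Proof.
move=> tG; split.
  by have [[]] := tG _ (open_above cF) (or_introl (@subset_refl _ (above F))).
by have [[]] := tG _ (open_below cF) (or_intror (@subset_refl _ (below F))).
Qed.

Let ucS : unif_continuous_on (above F) S /\ unif_continuous_on (below F) S.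
Proof. by apply: tame_above => D oD sD; exact: (tame_pot a01). Qed.

Let ucSy : unif_continuous_on (above F) Sy /\ unif_continuous_on (below F) Sy.
Proof. by apply: tame_above => D oD sD; exact: (tame_cauchy a01). Qed.

Let near_curve z : z.2 = F z.1 ->
  [/\ closure (above F) z, closure (below F) z,
      \forall n \near \oo, above F (z.1, z.2 + n.+1%:R^-1) &
      \forall n \near \oo, below F (z.1, z.2 - n.+1%:R^-1)].
Proof.
move=> zF; have n0 x : 0 < (x.+1%:R : R)^-1 by rewrite invr_gt0.
split; first by rewrite closure_above//= zF.
- by rewrite closure_below//= zF.
- by apply: nearW => n; rewrite /above /= zF ltrDl.
- by apply: nearW => n; rewrite /below /= zF gtrBl.
Qed.

Let continuous_S z : off_curve F z -> {for z, continuous S}.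
Proof.
have [dF _ _] := rF; have [L FL] := regular_curve_lipschitz rF.
have [_ _ wi] := dw; have cw := density_continuous a0 dw.
have dg := density_mul_derive a01 rF dw; have [_ _ gi] := dg.
have cg := density_continuous a0 dg.
move=> zF; apply: cvgD; first exact: (continuous_cauchy dF FL cw wi).
exact: (continuous_cauchy dF FL cg gi).
Qed.

Let has_trace_S z : exists l, has_trace (off_curve F) S z l.
Proof.
have [zF|zF] := eqVneq z.2 (F z.1); last first.
  by exists (S z); apply: has_trace_continuous; exact: continuous_S.
have [h1 h2 h3 h4] := near_curve zF; have [u1 u2] := ucS.
exists (trace (above F) S z); rewrite off_curveE; apply: has_traceU.
  exact: unif_continuous_trace.
have := trace_jump h1 h2 h3 h4 u1 u2 (@jump_lim_pot _ _ a01 F (weight N) 1 0 z rF dw zF).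
rewrite mulr0 => /eqP; rewrite subr_eq0 => /eqP ->.
exact: unif_continuous_trace.
Qed.

(** For q = 0 the jump of [pot] vanishes, so the traces from above and from below agree and give a
    continuous extension across the curve. *)
Definition barrier : plane R -> R := trace (off_curve F) S.

Lemma continuous_barrier : continuous barrier.
Proof. by apply: continuous_trace => z; [exact: dense_off_curve|exact: has_trace_S]. Qed.

Let barrierE z : off_curve F z -> S z = barrier z.
Proof. by move=> zF; rewrite /barrier (trace_interior oO)//; exact: continuous_S. Qed.

Let derive_barrier z : off_curve F z ->
  is_derive z (1, 0) barrier (Sx z) /\ is_derive z (0, 1) barrier (Sy z).
Proof.
move=> zF; split; apply: (is_derive_congr oO zF barrierE).
  exact: (is_derive_pot_dx a01 rF dw dw1 (is_derive_weight N0)).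
exact: (is_derive_pot_dy a01 rF dw dw1 (is_derive_weight N0)).
Qed.

Lemma laplacian_at_barrier z : off_curve F z -> laplacian_at barrier z 0.
Proof.
move=> zF; have [dF _ _] := rF; have [L FL] := regular_curve_lipschitz rF.
have [_ _ wi] := dw1; have cw := density_continuous a0 dw1.
exists Sx, Sy, (- 1%:R * cauchy_int 1 0 2 F (weight1 N) z),
  (- 1%:R * cauchy_int (- 1) (- 0) 2 F (weight1 N) z); split.
- have /norm_nearP[r r0 hr] := open_near oO zF.
  by exists r => // z' /hr; exact: derive_barrier.
- exact: (is_derive_cauchy_dx dF FL cw wi).
- exact: (is_derive_cauchy_dy dF FL cw wi).
- have := cauchyZ dF FL cw wi 1 0 (- 1) 1 zF.
  by rewrite mulr1 mulr0 oppr0 => <-; ring.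
Qed.

Let side_barrier z s D : `|s| = 1 -> closure D z -> unif_continuous_on D Sy ->
  D `<=` off_curve F -> (forall t, 0 < t -> D (z.1, z.2 + s * t)) ->
  side_derive s (fun y => barrier (z.1, y)) z.2 (trace D Sy z).
Proof.
move=> s1 Dz uD DF Dt.
apply: (@side_derive_limit _ s _ (fun y => Sy (z.1, y))) => //.
  apply: (continuous_cvg _ (@continuous_barrier (z.1, z.2))).
  exact: continuous_vertical.
move=> e e0; have [d d0 hd] := unif_continuous_trace Dz uD e0.
exists d => // t /andP[t0 td]; have Dzt := Dt t t0.
split; first by have [_ /is_derive_dy] := derive_barrier (DF _ Dzt).
apply/ltW/hd => //; rewrite norm_plane /= subrr normr0 (addrC z.2) addrK.
by rewrite normrM s1 mul1r gtr0_norm// gt_max d0.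
Qed.

(** The Plemelj formula for the vertical derivative, whose parameters are (0, -1): the jump has the
    sign of [weight1]. *)
Lemma kinked_barrier z : `|z.1| < N -> exists2 d, kinked barrier z d &
  if z.2 == F z.1 then 0 < d else d == 0.
Proof.
move=> zN; have [zF|zF] := eqVneq z.2 (F z.1); last first.
  by exists 0 => //; have [_ h] := derive_barrier zF; exact: kinked_derive h.
have [h1 h2 h3 h4] := near_curve zF; have [u1 u2] := ucSy.
exists (2 * pi * weight1 N z.1 / (1 + derive1 F z.1 ^+ 2)); last first.
  apply: divr_gt0; last by apply: ltr_pwDl => //; exact: sqr_ge0.
  by apply: mulr_gt0; [rewrite mulr_gt0// pi_gt0|exact: weight1_gt0].
exists (trace (below F) Sy z), (trace (above F) Sy z); split.
- apply: side_barrier => //; rewrite ?normr1// ?off_curveE//.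
  by move=> t t0; rewrite /above /= zF mul1r ltrDl.
- apply: side_barrier => //; rewrite ?normrN ?normr1// ?off_curveE//.
  by move=> t t0; rewrite /below /= zF mulN1r gtrBl.
- rewrite (trace_jump h1 h2 h3 h4 u1 u2 (@jump_lim_cauchy _ _ a01 F (weight1 N) 0 (- 1) z rF dw1 zF)).
  by ring.
Qed.

Lemma bounded_barrier : exists B, forall z, `|barrier z| <= B.
Proof.
have [[/bounded_onP[B1 h1] _] _ _] := tame_pot a01 rF dw 1 0 (open_above cF)
  (or_introl (@subset_refl _ (above F))).
have [[/bounded_onP[B2 h2] _] _ _] := tame_pot a01 rF dw 1 0 (open_below cF)
  (or_intror (@subset_refl _ (below F))).
exists (Num.max B1 B2) => z; have [l hl] := has_trace_S z.
rewrite /barrier (has_trace_trace (@dense_off_curve z) hl).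
apply: (trace_le (@dense_off_curve z) hl) => z'; rewrite off_curveE le_max.
by move=> [/h1 ->|/h2 ->]; rewrite ?orbT.
Qed.

End Barrier.

(** * Matching of gradients across an interface *)

Section Interface.
Context {R : realType}.
Context (a : R) (phi : R -> R) (D D' : set (plane R)) (Phi Gx Gy : plane R -> R).
Hypothesis rphi : regular_curve a phi.
Hypothesis loc : forall x, exists2 d, 0 < d & forall z, `|z - (x, phi x)| < d ->
  (side 1 phi z -> D z) /\ (side (- 1) phi z -> D' z).
Hypotheses (clD : forall x, closure D (x, phi x)) (clD' : forall x, closure D' (x, phi x)).
Hypothesis dPhi : forall z, D z \/ D' z ->
  is_derive z (1, 0) Phi (Gx z) /\ is_derive z (0, 1) Phi (Gy z).
Hypothesis uc : forall G, G = Phi \/ G = Gx \/ G = Gy ->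
  unif_continuous_on D G /\ unif_continuous_on D' G.
Hypothesis tr : forall x, trace D Phi (x, phi x) = trace D' Phi (x, phi x).
Hypothesis tn : forall x, let z := (x, phi x) in
  trace D Gy z - derive1 phi x * trace D Gx z =
  trace D' Gy z - derive1 phi x * trace D' Gx z.

Let side_trace G x : G = Phi \/ G = Gx \/ G = Gy ->
  has_trace (side 1 phi) G (x, phi x) (trace D G (x, phi x)) /\
  has_trace (side (- 1) phi) G (x, phi x) (trace D' G (x, phi x)).
Proof.
move=> /uc[u u']; have [d d0 hd] := loc x; split.
  apply: (has_trace_near d0 _ (unif_continuous_trace (@clD x) u)).
  by move=> z' sz' /hd[h _]; exact: h.
apply: (has_trace_near d0 _ (unif_continuous_trace (@clD' x) u')).
by move=> z' sz' /hd[_ h]; exact: h.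
Qed.

(* Equality of the traces of Phi along the curve gives equality of the
   tangential derivatives; with the normal ones, the whole gradient matches. *)
Lemma trace_gradient x : trace D Gy (x, phi x) = trace D' Gy (x, phi x).
Proof.
have [d d0 hd] := loc x; have [dphi _ _] := rphi.
have [L phiL] := regular_curve_lipschitz rphi.
have i0 : Phi = Phi \/ Phi = Gx \/ Phi = Gy by left.
have i1 : Gx = Phi \/ Gx = Gx \/ Gx = Gy by right; left.
have i2 : Gy = Phi \/ Gy = Gx \/ Gy = Gy by right; right.
have [x1 x1'] := side_trace x i1; have [y1 y1'] := side_trace x i2.
have h := @tangential_derive _ 1 L d phi (fun y => trace D Phi (y, phi y)) Phi Gx Gy
  x _ _ (or_introl erefl) phiL d0 _ x1 y1 (fun y => (side_trace y i0).1) _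
  (is_derive1_derive1 (dphi x)).
have h' := @tangential_derive _ (- 1) L d phi (fun y => trace D' Phi (y, phi y)) Phi Gx Gy
  x _ _ (or_intror erefl) phiL d0 _ x1' y1' (fun y => (side_trace y i0).2) _
  (is_derive1_derive1 (dphi x)).
have {}h := h _; have {}h' := h' _.
have e1 := is_derive1E (h (fun z sz zd => dPhi (or_introl ((hd z zd).1 sz)))).
have e2 := is_derive1E (h' (fun z sz zd => dPhi (or_intror ((hd z zd).2 sz)))).
have := tn x; move: e1 e2; rewrite (_ : (fun y => trace D Phi (y, phi y)) =
  (fun y => trace D' Phi (y, phi y))); last by apply/funext => y; exact: tr.
move=> -> /=; set b := derive1 phi x; set gx := trace D Gx _; set gy := trace D Gy _.
set gx' := trace D' Gx _; set gy' := trace D' Gy _ => e1 e2.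
apply/eqP; rewrite -subr_eq0.
have : (1 + b ^+ 2) * (gy - gy') = 0.
  have -> : (1 + b ^+ 2) * (gy - gy') =
    (gy - b * gx) - (gy' - b * gx') + b * ((gx + gy * b) - (gx' + gy' * b)) by ring.
  by rewrite e2 e1 !subrr mulr0 addr0.
by move/eqP; rewrite mulf_eq0 gt_eqF ?ltr_pwDl ?sqr_ge0.
Qed.

(** Near the curve a point of O lies in D or in D', and the traces from the two sides agree. *)
Lemma interface_has_trace (O : set (plane R)) G x : G = Phi \/ G = Gy ->
  (forall z, O z -> z.2 != phi z.1) ->
  has_trace O G (x, phi x) (trace D G (x, phi x)).
Proof.
move=> hG Ooff; have [d d0 hd] := loc x.
have hG' : G = Phi \/ G = Gx \/ G = Gy by case: hG => ->; [left|right; right].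
have [u u'] := uc hG'.
have E : trace D G (x, phi x) = trace D' G (x, phi x).
  by case: hG => ->; [exact: tr|exact: trace_gradient].
have := has_traceU (unif_continuous_trace (@clD x) u) _.
rewrite {1}E => /(_ _ (unif_continuous_trace (@clD' x) u')).
apply: (has_trace_near d0) => z' /Ooff; rewrite neq_lt => /orP[] h /hd[h1 h2].
  by right; apply: h2; rewrite /side /= mulN1r oppr_gt0 subr_lt0.
by left; apply: h1; rewrite /side /= mul1r subr_gt0.
Qed.

End Interface.

(** * Rigidity of the harmonic transmission problem *)

Section Rigidity.
Context {R : realType}.
Context (a : R) (F1 F2 : R -> R) (a01 : 0 < a < 1).
Hypotheses (rF1 : regular_curve a F1) (rF2 : regular_curve a F2).
Hypothesis F21 : forall x, F2 x < F1 x.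
Implicit Types (z : plane R) (x y e t : R).

Let cF1 : continuous F1. Proof. exact: regular_curve_continuous rF1. Qed.
Let cF2 : continuous F2. Proof. exact: regular_curve_continuous rF2. Qed.

Let D1 := above F1.
Let D2 := between F1 F2.
Let D3 := below F2.
Let O := D1 `|` D2 `|` D3.

Context (Phi Gx Gy H : plane R -> R).
Hypothesis dPhi : forall z, O z ->
  is_derive z (1, 0) Phi (Gx z) /\ is_derive z (0, 1) Phi (Gy z).
(** H is the derivative of Gx in x and minus that of Gy in y: Phi is harmonic off the curves. *)
Hypothesis dG : forall z, O z ->
  is_derive z (1, 0) Gx (H z) /\ is_derive z (0, 1) Gy (- H z).
Hypothesis cont : forall z, O z -> {for z, continuous Phi} /\ {for z, continuous Gy}.
Hypothesis uc : forall G, G = Phi \/ G = Gx \/ G = Gy ->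
  [/\ unif_continuous_on D1 G, unif_continuous_on D2 G & unif_continuous_on D3 G].
Hypothesis tr1 : forall x, trace D1 Phi (x, F1 x) = trace D2 Phi (x, F1 x).
Hypothesis tr2 : forall x, trace D2 Phi (x, F2 x) = trace D3 Phi (x, F2 x).
Hypothesis tn1 : forall x, let z := (x, F1 x) in
  trace D1 Gy z - derive1 F1 x * trace D1 Gx z =
  trace D2 Gy z - derive1 F1 x * trace D2 Gx z.
Hypothesis tn2 : forall x, let z := (x, F2 x) in
  trace D2 Gy z - derive1 F2 x * trace D2 Gx z =
  trace D3 Gy z - derive1 F2 x * trace D3 Gx z.
Hypothesis vanish : forall e, 0 < e -> exists M, forall z, O z -> M < `|z| ->
  `|Gx z| < e /\ `|Gy z| < e.

Let OE z : O z <-> z.2 != F1 z.1 /\ z.2 != F2 z.1.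
Proof.
rewrite /O /D1 /D2 /D3 betweenE// /above /below /=; have := F21 z.1.
split.
  move=> [[h|[h h']]|h]; rewrite !neq_lt.
  - by rewrite h (lt_trans _ h) ?orbT.
  - by rewrite h h' orbT.
  - by rewrite h (lt_trans h).
rewrite !neq_lt => -[/orP[h|h] /orP[h'|h']]; [by right|by left; right|by left; left|by left; left].
Qed.

Let oO : open O.
Proof.
apply: openU; last exact: open_below.
by apply: openU; [exact: open_above|exact: open_between].
Qed.

Let dO z : closure O z. Proof. exact: dense_off_curves. Qed.

Let loc1 x : exists2 d, 0 < d & forall z, `|z - (x, F1 x)| < d ->
  (side 1 F1 z -> D1 z) /\ (side (- 1) F1 z -> D2 z).
Proof.
have /norm_nearP[d d0 hd] := @near_above _ F2 (x, F1 x) cF2 (F21 x).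
exists d => // z /hd h2; split; rewrite /side /D1 /D2 /=.
  by rewrite mul1r subr_gt0.
by rewrite mulN1r oppr_gt0 subr_lt0 betweenE.
Qed.

Let loc2 x : exists2 d, 0 < d & forall z, `|z - (x, F2 x)| < d ->
  (side 1 F2 z -> D2 z) /\ (side (- 1) F2 z -> D3 z).
Proof.
have b : below F1 (x, F2 x) by exact: F21.
have /norm_nearP[d d0 hd] := open_near (open_below cF1) b.
exists d => // z /hd h2; split; rewrite /side /D3 /D2 /=.
  by rewrite mul1r subr_gt0 betweenE.
by rewrite mulN1r oppr_gt0 subr_lt0.
Qed.

Let has_trace_O G z : G = Phi \/ G = Gy -> exists l, has_trace O G z l.
Proof.
move=> hG; have hG' : G = Phi \/ G = Gx \/ G = Gy by case: hG => ->; [left|right; right].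
have [z1|z1] := eqVneq z.2 (F1 z.1).
  exists (trace D1 G (z.1, F1 z.1)); rewrite [z]surjective_pairing /= z1.
  apply: (interface_has_trace rF1 loc1 _ _ _ _ tr1 tn1) => //.
  - by move=> x; rewrite closure_above//=.
  - by move=> x; rewrite closure_between//= lexx (ltW (F21 x)).
  - by move=> z' [h|h]; apply: dPhi; left; [left|right].
  - by move=> G' /uc[].
  - by move=> z' /OE[].
have [z2|z2] := eqVneq z.2 (F2 z.1).
  exists (trace D2 G (z.1, F2 z.1)); rewrite [z]surjective_pairing /= z2.
  apply: (interface_has_trace rF2 loc2 _ _ _ _ tr2 tn2) => //.
  - by move=> x; rewrite closure_between//= lexx (ltW (F21 x)).
  - by move=> x; rewrite closure_below//=.
  - by move=> z' [h|h]; apply: dPhi; [left; right|right].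
  - by move=> G' /uc[].
  - by move=> z' /OE[].
have Oz : O z by apply/OE.
by exists (G z); apply: has_trace_continuous; have [c1 c2] := cont Oz; case: hG => ->.
Qed.

Let P := trace O Phi.
Let Q := trace O Gy.

Let cP : continuous P.
Proof. by apply: continuous_trace => // z; apply: has_trace_O; left. Qed.

Let cQ : continuous Q.
Proof. by apply: continuous_trace => // z; apply: has_trace_O; right. Qed.

Let PE z : O z -> Phi z = P z.
Proof. by move=> Oz; rewrite /P trace_interior//; have [] := cont Oz. Qed.

Let QE z : O z -> Q z = Gy z.
Proof. by move=> Oz; rewrite /Q trace_interior//; have [] := cont Oz. Qed.

Let dP_O z : O z -> is_derive z (1, 0) P (Gx z) /\ is_derive z (0, 1) P (Gy z).
Proof.
move=> Oz; have [h1 h2] := dPhi Oz.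
by split; apply: (is_derive_congr oO Oz PE).
Qed.

Let vertical z : exists2 r, 0 < r & forall t, 0 < `|t| < r -> O (z.1, z.2 + t).
Proof.
have one F : exists2 r : R, 0 < r & forall t, 0 < `|t| < r -> z.2 + t != F z.1.
  have [zF|zF] := eqVneq (F z.1) z.2.
    exists 1 => // t /andP[t0 _]; rewrite zF addrC -subr_eq0 addrK.
    by rewrite -normr_gt0.
  exists `|F z.1 - z.2|; first by rewrite normr_gt0 subr_eq0.
  move=> t /andP[_ h]; apply/eqP => zE; move: h.
  by rewrite -zE addrC addKr ltxx.
have [r1 r10 h1] := one F1; have [r2 r20 h2] := one F2.
exists (Num.min r1 r2); first by rewrite lt_min r10.
move=> t; rewrite lt_min => /andP[t0 /andP[ta tb]].
by apply/OE; split; [apply: h1|apply: h2]; rewrite t0.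
Qed.

(** Off the curves the vertical derivative of P is Q, which is continuous in the whole plane; each
    vertical line meets the curves in isolated points, so [side_derive_limit] from both sides
    carries the identity across. *)
Let dP z : is_derive z (0, 1) P (Q z).
Proof.
have hs s : `|s| = 1 -> side_derive s (fun y => P (z.1, y)) z.2 (Q z).
  move=> s1; apply: (@side_derive_limit _ s _ (fun y => Q (z.1, y))) => //.
    by apply: (continuous_cvg _ (@cP (z.1, z.2))); exact: continuous_vertical.
  move=> e e0; have [r r0 hr] := vertical z.
  have /cvgrPdist_le/(_ _ e0)/norm_nearP[d d0 hd] := @cQ z.
  exists (Num.min r d); first by rewrite lt_min r0.
  move=> t /andP[t0]; rewrite lt_min => /andP[tr td].
  have st : `|s * t| = t by rewrite normrM s1 mul1r gtr0_norm.
  have Ozt : O (z.1, z.2 + s * t) by apply: hr; rewrite st t0.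
  split; first by rewrite QE//; have [_ /is_derive_dy] := dP_O Ozt.
  rewrite distrC; apply: hd.
  by rewrite norm_plane /= subrr normr0 (addrC z.2) addrK st gt_max d0.
apply/is_derive_dy; apply: side_derive_is_derive; apply: hs.
  by rewrite normr1.
by rewrite normrN normr1.
Qed.

Let Q_vanish e : 0 < e -> exists M, forall z, M < `|z| -> `|Q z| <= e.
Proof.
move=> e0; have [M hM] := vanish e0; exists M => z Mz.
have [l hl] := @has_trace_O Gy z (or_intror erefl).
rewrite /Q (has_trace_trace (@dO z) hl); apply/ler_addgt0Pl => r r0.
have [d d0 hd] := hl r r0.
have m0 : 0 < Num.min d (`|z| - M) by rewrite lt_min d0 subr_gt0.
have [z' Oz'] := (closure_normP O z).1 (@dO z) _ m0.
rewrite lt_min => /andP[zd zM].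
have zM' : M < `|z'|.
  by have := ler_distD z' z 0; rewrite !subr0 (distrC z); lra.
have [_ h2] := hM z' Oz' zM'.
have h1 := hd z' Oz' zd.
have := ler_distD (Gy z') l 0; rewrite !subr0 (distrC l); lra.
Qed.

(** P itself may fail to vanish at infinity; its vertical differences inherit the decay of the
    vertical derivative. *)
Let u (e : R) z := P (up e z) - P z.

Let u_vanish (b e : R) : 0 < e -> exists M, forall z, M < `|z| -> `|u b z| <= e.
Proof.
move=> e0; have b0 : 0 < `|b| + 1 by rewrite ltr_wpDl.
have [M hM] := Q_vanish (divr_gt0 e0 b0); exists (M + `|b|) => z zM.
have hd (y : R) : `|y - z.2| <= `|b| -> `|Q (z.1, y)| <= e / (`|b| + 1).
  move=> yb; apply: hM.
  have : `|z - (z.1, y)| <= `|b|.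
    by rewrite norm_plane /= subrr normr0 distrC ge_max yb normr_ge0.
  have := ler_distD (z.1, y) z 0; rewrite !subr0; lra.
have bE : `|z.2 + b - z.2| = `|b| by rewrite addrC addKr.
have := @ler_MVT_ball _ (fun y => P (z.1, y)) (fun y => Q (z.1, y)) z.2 (z.2 + b) (e / (`|b| + 1)).
rewrite bE => h; rewrite /u [in P z](surjective_pairing z).
apply: (le_trans (h _ hd)).
  by move=> y _; have /is_derive_dy := dP (z.1, y).
by rewrite -mulrA ler_piMr ?(ltW e0)// mulrC ler_pdivrMr// mul1r lerDl.
Qed.

Let continuous_up (e : R) (G : plane R -> R) : continuous G -> continuous (G \o up e).
Proof.
move=> cG z; apply: (continuous_cvg _ (@cG (up e z))).
apply/cvgrPdist_lt => d d0.
suff : \forall z' \near z, `|up e z - up e z'| < d by [].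
by apply/norm_nearP; exists d => // z'; rewrite upB distrC.
Qed.

Let laplacian_P z : O z -> laplacian_at P z 0.
Proof.
move=> Oz; have [h1 h2] := dG Oz.
exists Gx, Gy, (H z), (- H z); split=> //; last by rewrite subrr.
by have /norm_nearP[r r0 hr] := open_near oO Oz; exists r => // z' /hr; exact: dP_O.
Qed.

Let compact_box (r : R) : compact [set z : plane R | `|z| <= r].
Proof.
rewrite (_ : mkset _ = `[- r, r]%classic `*` `[- r, r]%classic).
  by apply: compact_setX; exact: segment_compact.
apply/seteqP; split => z; rewrite /= norm_plane ge_max !ler_norml !in_itv /=.
  by move=> /andP[-> ->].
by move=> [-> ->].
Qed.

(** The maximum principle. If u has a positive value m, a perturbation V of u has a maximum inside a
    large box. Positive kinks keep this maximum off the curves and their translates, where the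
    Laplacian of V is positive: a contradiction. *)
Let u_le0 b z0 : u b z0 <= 0.
Proof.
rewrite leNgt; apply/negP; set m := u b z0 => m0.
have m4 : 0 < m / 4 by rewrite divr_gt0.
have [M hM] := u_vanish b m4.
pose r := Num.max `|M| `|z0| + 1.
have rM : M < r by rewrite (le_lt_trans (ler_norm M))// ltr_pwDr// le_max lexx.
have rz0 : `|z0| < r by rewrite ltr_pwDr// le_max lexx orbT.
have r0 : 0 < r by exact: le_lt_trans (normr_ge0 _) rz0.
have N0 : 0 < r + 1 by rewrite addr_gt0.
(* With parameter r + 1 the kinks are positive at all curve points with first coordinate in the box;
   vertical shifts do not change that coordinate. *)
pose S F := barrier (r + 1) F.
(* Four barriers, since u fails to be smooth on both curves and on both curves shifted by -b. *)
pose T z := (S F1 z + S F2 z) + ((S F1 \o up b) z + (S F2 \o up b) z).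
have [B1 hB1] := bounded_barrier a01 N0 rF1.
have [B2 hB2] := bounded_barrier a01 N0 rF2.
pose B := (B1 + B2) + (B1 + B2).
have hB z : `|T z| <= B.
  have nd (x y c d : R) : `|x| <= c -> `|y| <= d -> `|x + y| <= c + d.
    by move=> xc yd; apply: (le_trans (ler_normD _ _)); apply: lerD.
  by apply: (nd); apply: (nd); [exact: hB1|exact: hB2|exact: hB1|exact: hB2].
have B0 : 0 <= B by apply: le_trans (hB z0).
(* Both perturbations are at most m / 4 on the box. Thus V exceeds 3 m / 4 at z0 and stays below
   that value where |z| = r, as |u| <= m / 4 there. *)
pose eps := m / (4 * (B + 1)); have B10 : 0 < B + 1 by rewrite ltr_wpDl.
have eps0 : 0 < eps by rewrite divr_gt0// mulr_gt0.
have epsT z : `|eps * T z| < m / 4.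
  rewrite normrM gtr0_norm//; apply: (le_lt_trans (ler_wpM2l (ltW eps0) (hB z))).
  have -> : eps * B = m / 4 * (B / (B + 1)) by rewrite /eps; field; rewrite gt_eqF.
  by rewrite -[ltRHS]mulr1 ltr_pM2l// ltr_pdivrMr// mul1r ltrDl.
pose del := m / (8 * r ^+ 2); have r2 : 0 < r ^+ 2 by rewrite exprn_gt0.
have del0 : 0 < del by rewrite divr_gt0// mulr_gt0.
have delz z : `|z| <= r -> 0 <= del * sqr_norm z <= m / 4.
  move=> zr; have s0 : 0 <= sqr_norm z by rewrite addr_ge0 ?sqr_ge0.
  rewrite mulr_ge0 ?(ltW del0)//=.
  have sr : sqr_norm z <= 2 * r ^+ 2.
    move: zr; rewrite norm_plane ge_max => /andP[h1 h2].
    have e1 : z.1 ^+ 2 <= r ^+ 2.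
      by rewrite -(real_normK (num_real z.1)) ler_sqr ?nnegrE ?(ltW r0).
    have e2 : z.2 ^+ 2 <= r ^+ 2.
      by rewrite -(real_normK (num_real z.2)) ler_sqr ?nnegrE ?(ltW r0).
    by rewrite /sqr_norm; lra.
  apply: (le_trans (ler_wpM2l (ltW del0) sr)); rewrite /del le_eqVlt; apply/orP; left.
  by apply/eqP; field; rewrite gt_eqF.
pose V z := u b z + (eps * T z + del * sqr_norm z).
have cS F : regular_curve a F -> continuous (S F).
  by move=> rF; exact: (continuous_barrier a01 N0 rF).
have cV : continuous V.
  have cS1 := @cS F1 rF1; have cS2 := @cS F2 rF2.
  have cSu1 := @continuous_up b _ cS1; have cSu2 := @continuous_up b _ cS2.
  have cPu := @continuous_up b _ cP.
  move=> z; apply: cvgD.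
    by apply: cvgB; [exact: cPu|exact: cP].
  apply: cvgD; (apply: cvgM; first exact: cvg_cst).
    by apply: cvgD; apply: cvgD; [exact: cS1|exact: cS2|exact: cSu1|exact: cSu2].
  by apply: cvgD; apply: cvgM; first [exact: cvg_fst|exact: cvg_snd].
have [zm] : exists2 zm : plane R, zm \in [set z : plane R | `|z| <= r] &
    forall z, z \in [set z : plane R | `|z| <= r] -> V z <= V zm.
  apply: compact_EVT_max; [by exists z0 => /=; exact: ltW|exact: compact_box|].
  exact: continuous_subspaceT.
rewrite inE /= => zmr hmax.
have V0 : 3 * (m / 4) < V z0.
  have := epsT z0; have := delz z0 (ltW rz0); rewrite ltr_norml /V -/m.
  by move=> /andP[h1 _] /andP[h2 _]; lra.
have zmr' : `|zm| < r.
  rewrite ltNge; apply/negP => rzm.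
  have h1 := hM zm (lt_le_trans rM rzm).
  have := epsT zm; have := delz zm zmr; rewrite ltr_norml => /andP[_ h2] /andP[_ h3].
  have := hmax z0; rewrite inE /= => /(_ (ltW rz0)); move: h1; rewrite ler_norml => /andP[_ h1].
  rewrite [V zm]/V; move: V0 (u b zm) (eps * T zm) (del * sqr_norm zm) h1 h2 h3.
  by move: (V z0) (m / 4) => v n vn x y z' h1 h2 h3; lra.
have d0 : 0 < r - `|zm| by rewrite subr_gt0.
have lmax z : `|z - zm| < r - `|zm| -> V z <= V zm.
  move=> zz; apply: hmax; rewrite inE /=.
  have h := ler_distD zm z 0; rewrite !subr0 in h.
  by apply: (le_trans h); rewrite -lerBrDr; exact: ltW.
have zmN : `|zm.1| < r + 1.
  apply: (@lt_trans _ _ r); last by rewrite ltrDl.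
  by apply: le_lt_trans zmr'; rewrite [leRHS]norm_plane le_max lexx.
have [k1 hk1 ek1] := kinked_barrier a01 N0 rF1 zmN.
have [k2 hk2 ek2] := kinked_barrier a01 N0 rF2 zmN.
have [k3 hk3 ek3] := @kinked_barrier _ _ _ _ a01 N0 rF1 (up b zm) zmN.
have [k4 hk4 ek4] := @kinked_barrier _ _ _ _ a01 N0 rF2 (up b zm) zmN.
have kP : kinked (u b) zm 0.
  have := kinked_lin 1 (- 1) (kinked_up (kinked_derive (dP (up b zm)))) (kinked_derive (dP zm)).
  rewrite !mulr0 addr0; congr (kinked _ _ _); apply/funext => z.
  by rewrite /u mul1r mulN1r.
have kT : kinked T zm (k1 + k2 + (k3 + k4)).
  exact: kinkedD (kinkedD hk1 hk2) (kinkedD (kinked_up hk3) (kinked_up hk4)).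
have kV := kinkedD kP (kinked_lin eps del kT (kinked_sqr_norm zm)).
have kle := kinked_max d0 lmax kV.
have kge (F : R -> R) (k : R) (w : plane R) : (if w.2 == F w.1 then 0 < k else k == 0) -> 0 <= k.
  by case: ifP => _ => [/ltW//|/eqP->].
have [n1 n2] := (@kge _ _ _ ek1, @kge _ _ _ ek2).
have [n3 n4] := (@kge _ _ _ ek3, @kge _ _ _ ek4).
(* P has no vertical kink and neither has |z|^2, so only the barriers contribute to the jump. *)
have ksum : k1 + k2 + (k3 + k4) <= 0.
  by rewrite -(pmulr_rle0 _ eps0); move: kle; rewrite mulr0 addr0 add0r.
have off (F : R -> R) (k : R) (w : plane R) : (if w.2 == F w.1 then 0 < k else k == 0) -> k <= 0 -> w.2 != F w.1.
  by case: ifP => // _ h /(lt_le_trans h); rewrite ltxx.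
(* The four kinks are nonnegative with nonpositive sum, so all are zero, whereas a kink on its own
   curve is positive. *)
have o1 : zm.2 != F1 zm.1 by apply: (@off _ _ _ ek1); lra.
have o2 : zm.2 != F2 zm.1 by apply: (@off _ _ _ ek2); lra.
have o3 : (up b zm).2 != F1 (up b zm).1 by apply: (@off _ _ _ ek3); lra.
have o4 : (up b zm).2 != F2 (up b zm).1 by apply: (@off _ _ _ ek4); lra.
have O1 : O zm by apply/OE.
have O2 : O (up b zm) by apply/OE.
have lP : laplacian_at (u b) zm 0.
  have := laplacian_at_lin 1 (- 1) (laplacian_at_up (laplacian_P O2)) (laplacian_P O1).
  rewrite !mulr0 addr0; congr (laplacian_at _ _ _); apply/funext => z.
  by rewrite /u mul1r mulN1r.
have lT : laplacian_at T zm 0.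
  have l1 := laplacian_at_barrier a01 N0 rF1 o1.
  have l2 := laplacian_at_barrier a01 N0 rF2 o2.
  have l3 := laplacian_at_up (laplacian_at_barrier a01 N0 rF1 o3).
  have l4 := laplacian_at_up (laplacian_at_barrier a01 N0 rF2 o4).
  by have := laplacian_atD (laplacian_atD l1 l2) (laplacian_atD l3 l4); rewrite !addr0.
have lV := laplacian_atD lP (laplacian_at_lin eps del lT (laplacian_at_sqr_norm zm)).
have := laplacian_max d0 lmax lV; rewrite mulr0 !add0r leNgt => /negP; apply.
by rewrite mulr_gt0.
Qed.

(** [u_le0] for the shift b at z and for the shift -b at the shifted point. *)
Let P_up b z : P (up b z) = P z.
Proof.
apply/eqP; rewrite eq_le; apply/andP; split; first by rewrite -subr_le0; exact: u_le0.
have := u_le0 (- b) (up b z); rewrite /u subr_le0.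
by rewrite (_ : up (- b) (up b z) = z)// /up /= addrK -surjective_pairing.
Qed.

Let P_fst x y y' : P (x, y) = P (x, y').
Proof. by rewrite -(P_up (y' - y) (x, y)) /up /= addrC subrK. Qed.

(** P does not depend on the height, hence neither does its horizontal derivative, which tends to 0
    far up in the top layer. *)
Let Gx_D1 x y : F1 x < y -> Gx (x, y) = 0.
Proof.
move=> xy; apply/eqP; rewrite -normr_eq0 eq_le normr_ge0 andbT.
apply/ler_addgt0Pl => e e0; rewrite addr0; have [M hM] := vanish e0.
pose y' := Num.max y (M + 1).
have xy' : F1 x < y' by rewrite /y' lt_max xy.
have Oy : O (x, y) by left; left.
have Oy' : O (x, y') by left; left.
have [/is_derive_dx h _] := dP_O Oy; have [/is_derive_dx h' _] := dP_O Oy'.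
have E : (fun t => P (t, y)) = (fun t => P (t, y')) by apply/funext => t; exact: P_fst.
rewrite /= E in h; have -> : Gx (x, y) = Gx (x, y').
  by rewrite -(is_derive1E h) (is_derive1E h').
have [|/ltW //] := hM _ Oy'; rewrite norm_plane lt_max; apply/orP; right => /=.
by rewrite (lt_le_trans _ (ler_norm _))// lt_max ltrDl ltr01 orbT.
Qed.

(** P is independent of y; along the horizontal axis its derivative equals that at points just above
    the upper curve, which is 0. *)
Theorem harmonic_transmission_rigid : exists C, forall z, O z -> Phi z = C.
Proof.
exists (P (0, 0)) => z Oz; rewrite PE// (surjective_pairing z) (P_fst _ _ 0).
have hd (x : R) : is_derive x 1 (fun x => P (x, 0)) 0.
  have xy : F1 x < F1 x + 1 by rewrite ltrDl.
  have Oy : O (x, F1 x + 1) by left; left.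
  have [/is_derive_dx h _] := dP_O Oy; rewrite Gx_D1// /= in h.
  by rewrite (_ : (fun _ => _) = (fun x' => P (x', F1 x + 1)))//; apply/funext => t; exact: P_fst.
have := @ler_MVT_ball _ (fun x => P (x, 0)) (fun=> 0) 0 z.1 0 (fun x _ => hd x).
rewrite normr0 mul0r => /(_ (fun _ _ => lexx _)); rewrite normr_le0 subr_eq0.
by move=> /eqP.
Qed.

End Rigidity.

(** * Solutions depend only on the values inside the layers *)

Section LayerCongruence.
Context {R : realType}.
Implicit Types (D : set (plane R)) (v w : plane R -> plane R) (p q : plane R -> R).

Lemma Cn_derivable D G z : Cn D 1 G -> D z ->
  is_derive z (1, 0) G (dx G z) /\ is_derive z (0, 1) G (dy G z).
Proof. by move=> [_ [h _ _]] /h[h1 h2]; split; apply: DeriveDef. Qed.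

Lemma dx_congr D G G' z : open D -> D z -> (forall z, D z -> G z = G' z) ->
  Cn D 1 G -> dx G' z = dx G z /\ dy G' z = dy G z.
Proof.
move=> oD Dz GG' CG; have [h1 h2] := Cn_derivable CG Dz.
have [_ <-] := is_derive_congr oD Dz GG' h1.
by have [_ <-] := is_derive_congr oD Dz GG' h2.
Qed.

Lemma BUC_congr D G G' : (forall z, D z -> G z = G' z) -> BUC D G -> BUC D G'.
Proof.
move=> GG' [/bounded_onP[M GM] uG]; split; last exact: unif_continuous_on_congr uG.
by apply/bounded_onP; exists M => z Dz; rewrite -GG'//; exact: GM.
Qed.

(** Total functions represent functions on D. This invariance yields the converse direction in the
    description of all solutions. *)
Lemma layer_congr k mu g rho D v w p q : open D ->
  (forall z, D z -> v z = w z) -> (forall z, D z -> p z = q z) ->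
  layer k mu g rho D v p -> layer k mu g rho D w q.
Proof.
move=> oD vw pq [[[b1 b2] [c1 c2]] [[C1 U1] Cp] darcy div van].
have vw1 z : D z -> (fst \o v) z = (fst \o w) z by move=> /vw /= ->.
have vw2 z : D z -> (snd \o v) z = (snd \o w) z by move=> /vw /= ->.
split.
- split; split; [exact: BUC_congr b1|exact: BUC_congr b2| |].
    by move=> n; exact: Cn_congr (c1 n).
  by move=> n; exact: Cn_congr (c2 n).
- split; last by move=> n; exact: Cn_congr (Cp n).
  split; first exact: Cn_congr C1.
  by apply: (partials_upto_congr oD _ pq U1) => G G'; exact: unif_continuous_on_congr.
- move=> z Dz; have [ex ey] := dx_congr oD Dz pq C1.
  by rewrite -vw// darcy// /grad ex ey.
- move=> z Dz; have [ex _] := dx_congr oD Dz vw1 (c1 1).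
  have [_ ey] := dx_congr oD Dz vw2 (c2 1).
  by rewrite /divergence ex ey; exact: div.
- by move=> e /van[M hM]; exists M => z Dz Mz; rewrite -vw//; exact: hM.
Qed.

Lemma transmission_congr phi D D' v v' w w' p p' q q' :
  (forall z, D z -> v z = w z) -> (forall z, D z -> p z = q z) ->
  (forall z, D' z -> v' z = w' z) -> (forall z, D' z -> p' z = q' z) ->
  transmission phi D D' v v' p p' -> transmission phi D D' w w' q q'.
Proof.
move=> vw pq vw' pq' h z /h.
have e1 : trace2 D v z = trace2 D w z.
  by rewrite /trace2; congr pair; apply: trace_congr => y Dy /=; rewrite vw.
have e2 : trace2 D' v' z = trace2 D' w' z.
  by rewrite /trace2; congr pair; apply: trace_congr => y Dy /=; rewrite vw'.
by rewrite e1 e2 (trace_congr z pq) (trace_congr z pq').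
Qed.

End LayerCongruence.

(** * The difference of two solutions in one layer *)

Section LayerDifference.
Context {R : realType}.
Context (k mu g rho : R) (D : set (plane R)).
Context (v w : plane R -> plane R) (p q : plane R -> R).
Hypotheses (k0 : k != 0) (mu0 : mu != 0) (oD : open D).
Hypotheses (lv : layer k mu g rho D v p) (lw : layer k mu g rho D w q).
Implicit Types (z : plane R).

(** Gravity cancels in the difference: by Darcy's law [diff_x] and [diff_y] are the partial
    derivatives of [diff_p], and by incompressibility [diff_xx] is the derivative of the one in x
    and minus that of the other in y. *)
Definition diff_p z := 1 * q z + (- 1) * p z.
Definition diff_x z := - (mu / k) * (w z).1 + (mu / k) * (v z).1.
Definition diff_y z := - (mu / k) * (w z).2 + (mu / k) * (v z).2.
Definition diff_xx z := - (mu / k) * dx (fst \o w) z + (mu / k) * dx (fst \o v) z.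

Let grad_layer u r z : layer k mu g rho D u r -> D z ->
  dx r z = - (mu / k) * (u z).1 /\ dy r z = - (mu / k) * (u z).2 - rho * g.
Proof.
move=> [_ _ darcy _ _] Dz; rewrite darcy//= /GRing.scale /=.
by split; field; rewrite k0 mu0.
Qed.

Lemma diff_p_derive z : D z ->
  is_derive z (1, 0) diff_p (diff_x z) /\ is_derive z (0, 1) diff_p (diff_y z).
Proof.
move=> Dz; have [_ [[Cp _] _] _ _ _] := lv; have [_ [[Cq _] _] _ _ _] := lw.
have [px py] := Cn_derivable Cp Dz; have [qx qy] := Cn_derivable Cq Dz.
have [gx gy] := grad_layer lv Dz; have [gx' gy'] := grad_layer lw Dz.
split.
  have -> : diff_x z = 1 * dx q z + (- 1) * dx p z by rewrite gx gx' /diff_x; ring.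
  by apply: is_deriveD; apply: is_deriveZ.
have -> : diff_y z = 1 * dy q z + (- 1) * dy p z by rewrite gy gy' /diff_y; ring.
by apply: is_deriveD; apply: is_deriveZ.
Qed.

Lemma diff_x_derive z : D z ->
  is_derive z (1, 0) diff_x (diff_xx z) /\ is_derive z (0, 1) diff_y (- diff_xx z).
Proof.
move=> Dz; have [[_ [c1 c2]] _ _ dv _] := lv; have [[_ [c1' c2']] _ _ dw _] := lw.
have [vx _] := Cn_derivable (c1 1) Dz; have [_ vy] := Cn_derivable (c2 1) Dz.
have [wx _] := Cn_derivable (c1' 1) Dz; have [_ wy] := Cn_derivable (c2' 1) Dz.
split; first by apply: is_deriveD; apply: is_deriveZ.
have -> : - diff_xx z = - (mu / k) * dy (snd \o w) z + (mu / k) * dy (snd \o v) z.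
  have := dv z Dz; have := dw z Dz; rewrite /divergence /diff_xx => /eqP.
  by rewrite addrC addr_eq0 => /eqP -> /eqP; rewrite addrC addr_eq0 => /eqP ->; ring.
by apply: is_deriveD; apply: is_deriveZ.
Qed.

Lemma diff_p_continuous z : D z -> {for z, continuous diff_p} /\ {for z, continuous diff_y}.
Proof.
move=> Dz; have zD : z \in D by rewrite inE.
have [[_ [_ c2]] [_ Cp] _ _ _] := lv; have [[_ [_ c2']] [_ Cq] _ _ _] := lw.
have [[hp _] [hq _]] := (Cn_lin 1 (- 1) oD (Cq 0) (Cp 0), Cq 0).
have [hy _] := Cn_lin (- (mu / k)) (mu / k) oD (c2' 0) (c2 0).
by split; [exact: hp|exact: hy].
Qed.

Lemma diff_uc G : G = diff_p \/ G = diff_x \/ G = diff_y -> unif_continuous_on D G.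
Proof.
have [[[[_ b1] [_ b2]] _] [[_ [up _]] _] _ _ _] := lv.
have [[[[_ b1'] [_ b2']] _] [[_ [uq _]] _] _ _ _] := lw.
by move=> [|[]] ->; apply: unif_continuous_on_lin.
Qed.

Lemma diff_trace z : closure D z ->
  [/\ trace D diff_p z = trace D q z - trace D p z,
      trace D diff_x z = - (mu / k) * (trace2 D w z).1 + (mu / k) * (trace2 D v z).1 &
      trace D diff_y z = - (mu / k) * (trace2 D w z).2 + (mu / k) * (trace2 D v z).2].
Proof.
have [[[[_ b1] [_ b2]] _] [[_ [up _]] _] _ _ _] := lv.
have [[[[_ b1'] [_ b2']] _] [[_ [uq _]] _] _ _ _] := lw.
have lin G G' (c d : R) : closure D z -> unif_continuous_on D G -> unif_continuous_on D G' ->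
    trace D (fun z => c * G z + d * G' z) z = c * trace D G z + d * trace D G' z.
  move=> Dz uG uG'; apply: has_trace_trace => //.
  by apply: has_traceD; apply: has_traceZ; exact: unif_continuous_trace.
move=> Dz; split; [|exact: lin|exact: lin].
by rewrite -[diff_p]/(fun z => 1 * q z + (- 1) * p z) lin// mul1r mulN1r.
Qed.

Lemma diff_vanish e : 0 < e -> exists M, forall z, D z -> M < `|z| ->
  `|diff_x z| < e /\ `|diff_y z| < e.
Proof.
move=> e0; pose K := `|mu / k| + `|mu / k| + 1.
have K0 : 0 < K by rewrite ltr_wpDl// addr_ge0.
have [_ _ _ _ vv] := lv; have [_ _ _ _ vw] := lw.
have [M hM] := vv _ (divr_gt0 e0 K0); have [M' hM'] := vw _ (divr_gt0 e0 K0).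
exists (Num.max M M') => z Dz; rewrite gt_max => /andP[/(hM z Dz) h /(hM' z Dz) h'].
move: h h'; rewrite !norm_plane !gt_max => /andP[h1 h2] /andP[h1' h2'].
have main (x y : R) : `|x| < e / K -> `|y| < e / K -> `|- (mu / k) * x + (mu / k) * y| < e.
  move=> /ltW hx /ltW hy; apply: (le_lt_trans (ler_normD _ _)).
    rewrite (normrM _ x) (normrM _ y) normrN.
  apply: (@le_lt_trans _ _ (`|mu / k| * (e / K) + `|mu / k| * (e / K))).
    by apply: lerD; apply: ler_wpM2l.
  by rewrite -mulrDl mulrCA -[ltRHS]mulr1 ltr_pM2l// ltr_pdivrMr// mul1r ltrDl.
by split; apply: main.
Qed.

Lemma diff_p_constant C : (forall z, D z -> diff_p z = C) ->
  forall z, D z -> q z = p z + C /\ w z = v z.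
Proof.
move=> dC z Dz; split; first by rewrite -(dC z Dz) /diff_p; ring.
have [hx hy] := diff_p_derive Dz.
have [_ ex] := is_derive_congr oD Dz dC hx; have [_ ey] := is_derive_congr oD Dz dC hy.
have c0 u : 'D_u (fun=> C) z = 0 by exact: derive_cst.
rewrite c0 in ex; rewrite c0 in ey.
have muk : mu / k != 0 by rewrite mulf_neq0// invr_eq0.
have eqv (x y : R) : 0 = - (mu / k) * x + (mu / k) * y -> x = y.
  move=> /eqP; rewrite eq_sym mulNr addrC subr_eq0 => /eqP /(mulfI muk) //.
rewrite [LHS]surjective_pairing [RHS]surjective_pairing.
by congr pair; apply: eqv.
Qed.

End LayerDifference.

(** * Uniqueness up to a constant in the pressures *)

Section Uniqueness.
Context {R : realType}.
Context (a : R) (F1 F2 : R -> R) (a01 : 0 < a < 1).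
Hypotheses (rF1 : regular_curve a F1) (rF2 : regular_curve a F2).
Hypothesis F21 : forall x, F2 x < F1 x.
Implicit Types (z : plane R) (G : plane R -> R).

Let cF1 : continuous F1. Proof. exact: regular_curve_continuous rF1. Qed.
Let cF2 : continuous F2. Proof. exact: regular_curve_continuous rF2. Qed.

(** Joins functions on the layers into one function, to which the rigidity theorem applies. On a
    curve the value is that of the layer beneath. *)
Definition glue G1 G2 G3 z :=
  if F1 z.1 < z.2 then G1 z else if F2 z.1 < z.2 then G2 z else G3 z.

Lemma glue1 G1 G2 G3 z : above F1 z -> G1 z = glue G1 G2 G3 z.
Proof. by rewrite /above /glue /= => ->. Qed.

Lemma glue2 G1 G2 G3 z : between F1 F2 z -> G2 z = glue G1 G2 G3 z.
Proof.
by rewrite betweenE// /above /below /glue /= => -[h ->]; rewrite ltNge (ltW h).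
Qed.

Lemma glue3 G1 G2 G3 z : below F2 z -> G3 z = glue G1 G2 G3 z.
Proof.
rewrite /below /glue /= => h.
by rewrite ltNge (ltW (lt_trans h (F21 _))) /= ltNge (ltW h).
Qed.

Context (k mu g rho1 rho2 rho3 : R) (k0 : k != 0) (mu0 : mu != 0).
Context (v1 v2 v3 w1 w2 w3 : plane R -> plane R) (p1 p2 p3 q1 q2 q3 : plane R -> R).
Hypotheses (sv : muskat_solution k mu g rho1 rho2 rho3 F1 F2 v1 v2 v3 p1 p2 p3)
  (sw : muskat_solution k mu g rho1 rho2 rho3 F1 F2 w1 w2 w3 q1 q2 q3).

Let oD1 : open (above F1). Proof. exact: open_above. Qed.
Let oD2 : open (between F1 F2). Proof. exact: open_between. Qed.
Let oD3 : open (below F2). Proof. exact: open_below. Qed.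

Let is_derive_glue u G1 G2 G3 G1' G2' G3' :
  (forall z, above F1 z -> is_derive z u G1 (G1' z)) ->
  (forall z, between F1 F2 z -> is_derive z u G2 (G2' z)) ->
  (forall z, below F2 z -> is_derive z u G3 (G3' z)) ->
  forall z, (above F1 `|` between F1 F2 `|` below F2) z ->
  is_derive z u (glue G1 G2 G3) (glue G1' G2' G3' z).
Proof.
move=> h1 h2 h3 z [[hz|hz]|hz].
- rewrite -glue1//; apply: (is_derive_congr oD1 hz _ (h1 z hz)) => y; exact: glue1.
- rewrite -glue2//; apply: (is_derive_congr oD2 hz _ (h2 z hz)) => y; exact: glue2.
- rewrite -glue3//; apply: (is_derive_congr oD3 hz _ (h3 z hz)) => y; exact: glue3.
Qed.

Let continuous_glue G1 G2 G3 :
  (forall z, above F1 z -> {for z, continuous G1}) ->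
  (forall z, between F1 F2 z -> {for z, continuous G2}) ->
  (forall z, below F2 z -> {for z, continuous G3}) ->
  forall z, (above F1 `|` between F1 F2 `|` below F2) z ->
  {for z, continuous (glue G1 G2 G3)}.
Proof.
move=> h1 h2 h3 z hz.
have c1 := @continuous_congr _ _ G1 (glue G1 G2 G3) oD1 (glue1 G1 G2 G3).
have c2 := @continuous_congr _ _ G2 (glue G1 G2 G3) oD2 (glue2 G1 G2 G3).
have c3 := @continuous_congr _ _ G3 (glue G1 G2 G3) oD3 (glue3 G1 G2 G3).
case: hz => [[hz|hz]|hz].
- by apply: c1; rewrite ?inE// => y; rewrite inE; exact: h1.
- by apply: c2; rewrite ?inE// => y; rewrite inE; exact: h2.
- by apply: c3; rewrite ?inE// => y; rewrite inE; exact: h3.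
Qed.

Theorem muskat_unique : exists C,
  [/\ forall z, above F1 z -> q1 z = p1 z + C /\ w1 z = v1 z,
      forall z, between F1 F2 z -> q2 z = p2 z + C /\ w2 z = v2 z &
      forall z, below F2 z -> q3 z = p3 z + C /\ w3 z = v3 z].
Proof.
have [lv1 lv2 lv3 tv1 tv2] := sv; have [lw1 lw2 lw3 tw1 tw2] := sw.
pose Phi := glue (diff_p p1 q1) (diff_p p2 q2) (diff_p p3 q3).
pose Gx := glue (diff_x k mu v1 w1) (diff_x k mu v2 w2) (diff_x k mu v3 w3).
pose Gy := glue (diff_y k mu v1 w1) (diff_y k mu v2 w2) (diff_y k mu v3 w3).
pose H := glue (diff_xx k mu v1 w1) (diff_xx k mu v2 w2) (diff_xx k mu v3 w3).
have nz (phi : R -> R) x : (Num.sqrt (1 + derive1 phi x ^+ 2))^-1 != 0.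
  by rewrite invr_eq0 gt_eqF// sqrtr_gt0 ltr_pwDl// sqr_ge0.
(* Continuity of the normal velocity, freed from the normalising factor of the normal and written
   for the gradient of the pressure difference. *)
have flux (phi : R -> R) (D D' : set (plane R)) v v' w w' z : closure D z -> closure D' z ->
    dot (trace2 D v z) (normal phi z.1) = dot (trace2 D' v' z) (normal phi z.1) ->
    dot (trace2 D w z) (normal phi z.1) = dot (trace2 D' w' z) (normal phi z.1) ->
    (- (mu / k) * (trace2 D w z).2 + (mu / k) * (trace2 D v z).2) -
      derive1 phi z.1 * (- (mu / k) * (trace2 D w z).1 + (mu / k) * (trace2 D v z).1) =
    (- (mu / k) * (trace2 D' w' z).2 + (mu / k) * (trace2 D' v' z).2) -
      derive1 phi z.1 * (- (mu / k) * (trace2 D' w' z).1 + (mu / k) * (trace2 D' v' z).1).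
  move=> Dz D'z; rewrite /dot /normal /trace2 /= /GRing.scale /= mulr1.
  have alg (s b x1 x2 y1 y2 : R) : s != 0 ->
      x1 * (s * - b) + x2 * s = y1 * (s * - b) + y2 * s -> x2 - b * x1 = y2 - b * y1.
    by move=> s0 e; apply: (mulfI s0); move: e; lra.
  move=> /(alg _ _ _ _ _ _ (nz phi z.1)) f1 /(alg _ _ _ _ _ _ (nz phi z.1)) f2.
  rewrite (_ : _ - _ = (mu / k) * ((trace D (snd \o v) z - derive1 phi z.1 * trace D (fst \o v) z) -
    (trace D (snd \o w) z - derive1 phi z.1 * trace D (fst \o w) z))); last by ring.
  by rewrite f1 f2; ring.
have upper z : z.2 = F1 z.1 -> closure (above F1) z /\ closure (between F1 F2) z.
  move=> zE; rewrite closure_above// closure_between//= zE lexx.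
  by rewrite (ltW (F21 _)).
have lower z : z.2 = F2 z.1 -> closure (between F1 F2) z /\ closure (below F2) z.
  move=> zE; rewrite closure_below// closure_between//= zE lexx.
  by rewrite (ltW (F21 _)).
have [C hC] : exists C, forall z, (above F1 `|` between F1 F2 `|` below F2) z -> Phi z = C.
  apply: (@harmonic_transmission_rigid _ a F1 F2 a01 rF1 rF2 F21 Phi Gx Gy H).
  - move=> z Oz; split; (apply: is_derive_glue => // {z Oz} z hz).
    + by have [] := diff_p_derive k0 mu0 lv1 lw1 hz.
    + by have [] := diff_p_derive k0 mu0 lv2 lw2 hz.
    + by have [] := diff_p_derive k0 mu0 lv3 lw3 hz.
    + by have [] := diff_p_derive k0 mu0 lv1 lw1 hz.
    + by have [] := diff_p_derive k0 mu0 lv2 lw2 hz.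
    + by have [] := diff_p_derive k0 mu0 lv3 lw3 hz.
  - move=> z Oz; split.
      apply: is_derive_glue => // {z Oz} z hz.
      + by have [] := diff_x_derive lv1 lw1 hz.
      + by have [] := diff_x_derive lv2 lw2 hz.
      + by have [] := diff_x_derive lv3 lw3 hz.
    have := @is_derive_glue (0, 1) (diff_y k mu v1 w1) (diff_y k mu v2 w2) (diff_y k mu v3 w3)
      (fun z => - diff_xx k mu v1 w1 z) (fun z => - diff_xx k mu v2 w2 z)
      (fun z => - diff_xx k mu v3 w3 z).
    rewrite (_ : - H z = glue (fun z => - diff_xx k mu v1 w1 z)
      (fun z => - diff_xx k mu v2 w2 z) (fun z => - diff_xx k mu v3 w3 z) z); last first.
      by rewrite /H /glue; do 2 case: ifP => //.
    apply=> // {z Oz} z hz.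
    + by have [] := diff_x_derive lv1 lw1 hz.
    + by have [] := diff_x_derive lv2 lw2 hz.
    + by have [] := diff_x_derive lv3 lw3 hz.
  - move=> z Oz; split; (apply: continuous_glue => // {z Oz} z hz).
    + by have [] := diff_p_continuous oD1 lv1 lw1 hz.
    + by have [] := diff_p_continuous oD2 lv2 lw2 hz.
    + by have [] := diff_p_continuous oD3 lv3 lw3 hz.
    + by have [] := diff_p_continuous oD1 lv1 lw1 hz.
    + by have [] := diff_p_continuous oD2 lv2 lw2 hz.
    + by have [] := diff_p_continuous oD3 lv3 lw3 hz.
  - have uc1 := diff_uc lv1 lw1; have uc2 := diff_uc lv2 lw2; have uc3 := diff_uc lv3 lw3.
    by move=> G [|[]] ->; split;
      first [apply: (unif_continuous_on_congr (glue1 _ _ _)); apply: uc1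
            |apply: (unif_continuous_on_congr (glue2 _ _ _)); apply: uc2
            |apply: (unif_continuous_on_congr (glue3 _ _ _)); apply: uc3]; tauto.
  - move=> x; have [c1 c2] := upper (x, F1 x) erefl.
    rewrite -(trace_congr _ (glue1 _ _ _)) -(trace_congr _ (glue2 _ _ _)).
    have [-> _ _] := diff_trace lv1 lw1 c1; have [-> _ _] := diff_trace lv2 lw2 c2.
    have bz := (boundary_above_between cF1 cF2 F21 (x, F1 x)).2 erefl.
    by have [-> _] := tv1 _ bz; have [-> _] := tw1 _ bz.
  - move=> x; have [c1 c2] := lower (x, F2 x) erefl.
    rewrite -(trace_congr _ (glue2 _ _ _)) -(trace_congr _ (glue3 _ _ _)).
    have [-> _ _] := diff_trace lv2 lw2 c1; have [-> _ _] := diff_trace lv3 lw3 c2.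
    have bz := (boundary_between_below cF1 cF2 F21 (x, F2 x)).2 erefl.
    by have [-> _] := tv2 _ bz; have [-> _] := tw2 _ bz.
  - move=> x z; have [c1 c2] := upper (x, F1 x) erefl.
    rewrite -!(trace_congr _ (glue1 _ _ _)) -!(trace_congr _ (glue2 _ _ _)).
    have [_ -> ->] := diff_trace lv1 lw1 c1; have [_ -> ->] := diff_trace lv2 lw2 c2.
    have bz := (boundary_above_between cF1 cF2 F21 (x, F1 x)).2 erefl.
    have [_ e1] := tv1 _ bz; have [_ e2] := tw1 _ bz.
    exact: (flux F1 _ _ _ _ _ _ (x, F1 x)).
  - move=> x z; have [c1 c2] := lower (x, F2 x) erefl.
    rewrite -!(trace_congr _ (glue2 _ _ _)) -!(trace_congr _ (glue3 _ _ _)).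
    have [_ -> ->] := diff_trace lv2 lw2 c1; have [_ -> ->] := diff_trace lv3 lw3 c2.
    have bz := (boundary_between_below cF1 cF2 F21 (x, F2 x)).2 erefl.
    have [_ e1] := tv2 _ bz; have [_ e2] := tw2 _ bz.
    exact: (flux F2 _ _ _ _ _ _ (x, F2 x)).
  - move=> e e0; have [M1 h1] := diff_vanish lv1 lw1 e0.
    have [M2 h2] := diff_vanish lv2 lw2 e0; have [M3 h3] := diff_vanish lv3 lw3 e0.
    exists (Num.max M1 (Num.max M2 M3)) => z hz; rewrite !gt_max => /andP[z1 /andP[z2 z3]].
    rewrite /Gx /Gy; case: hz => [[hz|hz]|hz].
    + by rewrite -!glue1//; exact: h1.
    + by rewrite -!glue2//; exact: h2.
    + by rewrite -!glue3//; exact: h3.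
exists C; split.
- apply: (diff_p_constant k0 mu0 oD1 lv1 lw1) => z hz.
  by rewrite -(hC z (or_introl (or_introl hz))) /Phi -glue1.
- apply: (diff_p_constant k0 mu0 oD2 lv2 lw2) => z hz.
  by rewrite -(hC z (or_introl (or_intror hz))) /Phi -glue2.
- apply: (diff_p_constant k0 mu0 oD3 lv3 lw3) => z hz.
  by rewrite -(hC z (or_intror hz)) /Phi -glue3.
Qed.

End Uniqueness.

(** * The integral formula in terms of Cauchy integrals *)

Section Formula.
Context {R : realType}.
Context (a : R) (F w : R -> R) (a01 : 0 < a < 1).
Hypotheses (rF : regular_curve a F) (dw : density a w).
Implicit Types (z : plane R) (s : R).

Let kernelE z s : w s *: muskat_kernel F z s =
  (w s * ckernel 0 1 1 (z.1 - s) (z.2 - F s), w s * ckernel 1 0 1 (z.1 - s) (z.2 - F s)).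
Proof.
by rewrite /muskat_kernel /ckernel /inv_pow /=; congr pair; do 2 rewrite /GRing.scale /=; ring.
Qed.

Lemma integrable2_muskat_kernel z : off_curve F z ->
  integrable2 (fun s => w s *: muskat_kernel F z s).
Proof.
have [dF _ _] := rF; have [L FL] := regular_curve_lipschitz rF.
have [_ _ wi] := dw; have a0 : 0 < a by case/andP: a01.
have cw := density_continuous a0 dw => zF.
have h1 := integrable_cauchy dF FL cw wi 0 1 0%N zF.
have h2 := integrable_cauchy dF FL cw wi 1 0 0%N zF.
split.
  by move: h1; congr (_.-integrable _ (EFin \o _)); apply/funext => s; rewrite /comp kernelE.
by move: h2; congr (_.-integrable _ (EFin \o _)); apply/funext => s; rewrite /comp kernelE.
Qed.

Lemma integral2_muskat_kernel z : integral2 (fun s => w s *: muskat_kernel F z s) =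
  (cauchy_int 0 1 1 F w z, cauchy_int 1 0 1 F w z).
Proof.
by rewrite /integral2 /cauchy_int; congr pair; apply: eq_Rintegral => s _; rewrite kernelE.
Qed.

End Formula.

(** One velocity field, defined by the formula, serves in all three layers. Existence provides a
    solution for every additive constant C, which together with uniqueness and invariance inside the
    layers describes all solutions. *)
Theorem theorem1p1 (R : realType) (k mu g rho1 rho2 rho3 : R)
    (k_gt0 : 0 < k) (mu_gt0 : 0 < mu) (g_gt0 : 0 < g)
    (rho1_gt0 : 0 < rho1) (rho12 : rho1 < rho2) (rho23 : rho2 < rho3)
    (r c : R) (r_gt : 3 / 2 < r) (r_lt : r < 2) (c_gt0 : 0 < c)
    (f h : R -> R) (Hf : sobolev r f) (Hh : sobolev r h)
    (fh : forall x : R, h x < c + f x) :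
  let cf := fun x : R => c + f x in
  let D1 := above cf in
  let D2 := between cf h in
  let D3 := below h in
  let Theta1 := k * g * (rho1 - rho2) / (2 * mu) in
  let Theta2 := k * g * (rho2 - rho3) / (2 * mu) in
  exists (v1 v2 v3 : plane R -> plane R) (p1 p2 p3 : plane R -> R),
  [/\ muskat_solution k mu g rho1 rho2 rho3 cf h v1 v2 v3 p1 p2 p3,
      forall (w1 w2 w3 : plane R -> plane R) (q1 q2 q3 : plane R -> R),
        muskat_solution k mu g rho1 rho2 rho3 cf h w1 w2 w3 q1 q2 q3 <->
        [/\ forall z, D1 z -> w1 z = v1 z,
            forall z, D2 z -> w2 z = v2 z,
            forall z, D3 z -> w3 z = v3 z &
            exists C : R,
              [/\ forall z, D1 z -> q1 z = p1 z + C,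
                  forall z, D2 z -> q2 z = p2 z + C &
                  forall z, D3 z -> q3 z = p3 z + C]] &
      forall z : plane R, ~ (curve h `|` curve cf) z ->
        let F1 := fun s : R => derive1 f s *: muskat_kernel cf z s in
        let F2 := fun s : R => derive1 h s *: muskat_kernel h z s in
        [/\ integrable2 F1, integrable2 F2 &
            \1_D1 z *: v1 z + \1_D2 z *: v2 z + \1_D3 z *: v3 z =
            (Theta1 / pi) *: integral2 F1 + (Theta2 / pi) *: integral2 F2]].
Proof.
move=> cf D1 D2 D3 Theta1 Theta2.
have k0 : k != 0 by rewrite gt_eqF.
have mu0 : mu != 0 by rewrite gt_eqF.
have r32 : 3 / 2 < r < 2 by rewrite r_gt.
have a01 : 0 < r - 3 / 2 < 1 by apply/andP; split; lra.
have [rf df df'] := sobolev_regular r32 Hf; have [rh dh dh'] := sobolev_regular r32 Hh.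
have rcf : regular_curve (r - 3 / 2) cf by exact: regular_curveD.
have ccf := regular_curve_continuous rcf; have ch := regular_curve_continuous rh.
have sol C := muskat_exists a01 rf df df' rh dh dh' g rho1 rho2 rho3 k0 mu0 fh C.
pose v := muskat_velocity f h c k mu g rho1 rho2 rho3.
pose p (rho C : R) := muskat_pressure f h c k mu g rho1 rho2 rho3 rho C.
have pD rho C C' z : p rho (C + C') z = p rho C z + C'.
  by rewrite /p /muskat_pressure /pressure; ring.
exists v, v, v, (p rho1 (0 + (rho1 - rho2) * g * c)), (p rho2 0), (p rho3 0).
split; first exact: sol.
- move=> w1 w2 w3 q1 q2 q3; split=> [sw|[e1 e2 e3 [C [E1 E2 E3]]]].
    have [C [h1 h2 h3]] := muskat_unique a01 rcf rh fh k0 mu0 (sol 0) sw.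
    split; [by move=> z /h1[]|by move=> z /h2[]|by move=> z /h3[]|].
    by exists C; split; [move=> z /h1[]|move=> z /h2[]|move=> z /h3[]].
  (* The solution with all pressures raised by C agrees with the given functions inside the
     layers. *)
  have [l1 l2 l3 t1 t2] := sol C.
  have V1 z : D1 z -> v z = w1 z by move=> /e1 ->.
  have V2 z : D2 z -> v z = w2 z by move=> /e2 ->.
  have V3 z : D3 z -> v z = w3 z by move=> /e3 ->.
  have Q1 z : D1 z -> p rho1 (C + (rho1 - rho2) * g * c) z = q1 z.
    by move=> /E1 ->; rewrite -pD; congr (p _ _ _); ring.
  have Q2 z : D2 z -> p rho2 C z = q2 z by move=> /E2 ->; rewrite -pD add0r.
  have Q3 z : D3 z -> p rho3 C z = q3 z by move=> /E3 ->; rewrite -pD add0r.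
  split.
  + exact: (layer_congr (open_above ccf) V1 Q1).
  + exact: (layer_congr (open_between ccf ch) V2 Q2).
  + exact: (layer_congr (open_below ch) V3 Q3).
  + exact: (transmission_congr V1 Q1 V2 Q2).
  + exact: (transmission_congr V2 Q2 V3 Q3).
move=> z zO F1 F2.
have z1 : off_curve cf z.
  apply/eqP => zE; apply: zO; right; exists z.1 => //.
  by rewrite [RHS]surjective_pairing zE.
have z2 : off_curve h z.
  apply/eqP => zE; apply: zO; left; exists z.1 => //.
  by rewrite [RHS]surjective_pairing zE.
split; [exact: integrable2_muskat_kernel df' _ z1|exact: integrable2_muskat_kernel dh' _ z2|].
rewrite (integral2_muskat_kernel cf) (integral2_muskat_kernel h).
transitivity (v z); last first.
  by rewrite /v /muskat_velocity /velocity /field -/Theta1 -/Theta2.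
have fhz : h z.1 < cf z.1 by exact: fh.
(* Off the curves exactly one of the three indicators equals 1; being above the upper and below the
   lower curve is excluded by h < c + f. *)
rewrite -[RHS]scale1r -!scalerDl !indicE; congr (_ *: _).
have m1 : (z \in D1) = (cf z.1 < z.2) by apply/idP/idP; rewrite inE.
have m2 : (z \in D2) = (z.2 < cf z.1) && (h z.1 < z.2).
  by apply/idP/idP; rewrite inE /D2 betweenE// => /andP.
have m3 : (z \in D3) = (z.2 < h z.1) by apply/idP/idP; rewrite inE.
rewrite m1 m2 m3; move: z1 z2; rewrite /off_curve /= !neq_lt => /orP[] u1 /orP[] u2.
- by rewrite u1 u2 (lt_gtF u1) (lt_gtF u2) /= !add0r.
- by rewrite u1 u2 (lt_gtF u1) (lt_gtF u2) /= add0r addr0.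
- by have := lt_trans (lt_trans u2 fhz) u1; rewrite ltxx.
- by rewrite u1 u2 (lt_gtF u1) (lt_gtF u2) /= !addr0.
Qed.
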